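(* For every $n\ge0$ and every $i\in\mathbb{Z}$ there is an almost split sequence in the category of finite-dimensional right $B$-comodules of the form $$0\to\Omega^{i+1}(S(n))\to\Omega^{i}(S(n-1))\oplus\Omega^{i}(S(n+1))\oplus E_i\to\Omega^{i-1}(S(n))\to0,$$ where $E_0=I_n$, $E_i=0$ for $i\neq0$, and $S(-1)=0$ (for $i=0$ these are the sequences $0\to\mathrm{rad}(I_n)\to\mathrm{rad}(I_n)/\mathrm{soc}(I_n)\oplus I_n\to I_n/\mathrm{soc}(I_n)\to0$, i.e. they are obtained from the latter by applying $\Omega^i$); and every almost split sequence of finite-dimensional right $B$-comodules is isomorphic to one of these.
   Context: $k$ is a field. $Q$ is the quiver with vertices $0,1,2,\dots$ and arrows $a_i:i\to i+1$, $b_i:i+1\to i$ ($i\ge0$); $kQ$ its path coalgebra (basis all paths $p=\alpha_m\cdots\alpha_1$, $\alpha_1$ first; vertices are group-likes $g_i$; $\Delta(p)=t(p)\otimes p+p\otimes s(p)+\sum_{p=p_2p_1}p_2\otimes p_1$ over factorizations into nontrivial subpaths). $B\subseteq kQ$ is the subcoalgebra spanned by $g_i,a_i,b_i$ ($i\ge0$), $d_0=b_0a_0$ and $d_{i+1}=a_ib_i+b_{i+1}a_{i+1}$ (the basic coalgebra of a nontrivial block of $k_\zeta[SL(2)]$ at a root of unity of odd order in characteristic zero). $S(n)=kg_n$ is the simple right $B$-comodule at $n$; $I_n=kg_n+ka_{n-1}+kb_n+kd_n$ ($n\ge1$), $I_0=kg_0+kb_0+kd_0$ are the injective hulls of the $S(n)$,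 and they are projective. For a finite-dimensional comodule $M$, $\Omega(M)$ is the kernel of its projective cover, $\Omega^{-1}(M)$ the cokernel of its injective hull, $\Omega^0(M)=M$, and $\Omega^m$ the $|m|$-fold iterate of $\Omega$ or $\Omega^{-1}$; $\mathrm{rad}$ and $\mathrm{soc}$ are radical and socle. A short exact sequence $0\to X\to Y\to Z\to 0$ of finite-dimensional comodules is almost split if $X,Z$ are indecomposable, it is nonsplit, and every non-split-mono map from $X$ factors through $X\to Y$ (equivalently every non-split-epi map to $Z$ factors through $Y\to Z$). *)

(* Defs.v *)
From HB Require Import structures.
From mathcomp Require Import all_boot all_order all_algebra.
Set Implicit Arguments. Unset Strict Implicit. Unset Printing Implicit Defensive.
Import GRing.Theory.
Local Open Scope ring_scope.

Inductive Bbasis : Type :=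
| G of nat      (* g_i, vertex i *)
| A of nat      (* a_i : i -> i+1 *)
| Bb of nat     (* b_i : i+1 -> i *)
| D of nat.     (* d_0 = b_0 a_0, d_{i+1} = a_i b_i + b_{i+1} a_{i+1} *)

Scheme Equality for Bbasis.
HB.instance Definition _ := hasDecEq.Build Bbasis (compareP Bbasis_eq_dec).

Definition bidx (c : Bbasis) : nat :=
  match c with G i | A i | Bb i | D i => i end.

(* comul_pair c1 c2 = Some e  iff the term c1 (x) c2 occurs in Delta(e)
   (all structure constants of Delta on this basis are 0 or 1, and every
   pair c1 (x) c2 occurs in Delta(e) for at most one basis element e).
   Delta(g_i) = g_i(x)g_i ; Delta(a_i) = g_{i+1}(x)a_i + a_i(x)g_i ;
   Delta(b_i) = g_i(x)b_i + b_i(x)g_{i+1} ;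
   Delta(d_0) = g_0(x)d_0 + d_0(x)g_0 + b_0(x)a_0 ;
   Delta(d_{i+1}) = g_{i+1}(x)d_{i+1} + d_{i+1}(x)g_{i+1}
                    + a_i(x)b_i + b_{i+1}(x)a_{i+1}.
   (This is the comultiplication of the path coalgebra kQ restricted to B.) *)
Definition comul_pair (c1 c2 : Bbasis) : option Bbasis :=
  match c1, c2 with
  | G j, G i => if j == i then Some (G i) else None
  | G j, A i => if j == i.+1 then Some (A i) else None
  | A i, G j => if j == i then Some (A i) else None
  | G j, Bb i => if j == i then Some (Bb i) else None
  | Bb i, G j => if j == i.+1 then Some (Bb i) else None
  | G j, D i => if j == i then Some (D i) else None
  | D i, G j => if j == i then Some (D i) else None
  | Bb i, A j => if i == j then Some (D i) else None
  | A i, Bb j => if i == j then Some (D i.+1) else None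
  | _, _ => None
  end.

Section Comodules.
Variable k : fieldType.

(* A finite-dimensional right B-comodule: M = k^d (row vectors), with
   rho(m) = \sum_c (m *m coact c) (x) c  (finitely supported). *)
Record comod := Comod {
  cdim : nat;
  coact : Bbasis -> 'M[k]_cdim;
  cbound : nat;
  coact_fin : forall c, (cbound <= bidx c)%N -> coact c = 0;
  (* counit: (id (x) eps) rho = id, eps(g_i) = 1, eps = 0 on a_i, b_i, d_i *)
  coact_counit : \sum_(i < cbound) coact (G i) = 1%:M;
  coact_coassoc : forall c c',
     coact c *m coact c' =
     match comul_pair c' c with Some e => coact e | None => 0 end
}.

Definition is_hom (X Y : comod) (f : 'M[k]_(cdim X, cdim Y)) : Prop :=
  forall c, coact X c *m f = f *m coact Y c.

Definition is_iso (X Y : comod) (f : 'M[k]_(cdim X, cdim Y)) : Prop :=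
  is_hom f /\ exists g : 'M[k]_(cdim Y, cdim X),
    is_hom g /\ f *m g = 1%:M /\ g *m f = 1%:M.

Definition biprod2 (Y X1 X2 : comod) : Prop :=
  exists (i1 : 'M[k]_(cdim X1, cdim Y)) (i2 : 'M[k]_(cdim X2, cdim Y))
         (p1 : 'M[k]_(cdim Y, cdim X1)) (p2 : 'M[k]_(cdim Y, cdim X2)),
    [/\ is_hom i1, is_hom i2, is_hom p1 & is_hom p2] /\
    [/\ i1 *m p1 = 1%:M, i2 *m p2 = 1%:M, i1 *m p2 = 0, i2 *m p1 = 0
      & p1 *m i1 + p2 *m i2 = 1%:M].

Definition indecomposable (X : comod) : Prop :=
  (0 < cdim X)%N /\
  forall X1 X2 : comod, biprod2 X X1 X2 -> cdim X1 = 0%N \/ cdim X2 = 0%N.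

Definition projective (P : comod) : Prop :=
  forall (Y Z : comod) (g : 'M[k]_(cdim Y, cdim Z)) (f : 'M[k]_(cdim P, cdim Z)),
    is_hom g -> row_full g -> is_hom f ->
    exists h : 'M[k]_(cdim P, cdim Y), is_hom h /\ h *m g = f.

Definition injective (E : comod) : Prop :=
  forall (X Y : comod) (f : 'M[k]_(cdim X, cdim Y)) (u : 'M[k]_(cdim X, cdim E)),
    is_hom f -> row_free f -> is_hom u ->
    exists h : 'M[k]_(cdim Y, cdim E), is_hom h /\ f *m h = u.

Definition proj_cover (P M : comod) (p : 'M[k]_(cdim P, cdim M)) : Prop :=
  [/\ projective P, is_hom p, row_full p &
    forall (N : comod) (h : 'M[k]_(cdim N, cdim P)),
      is_hom h -> row_full (h *m p) -> row_full h].

Definition inj_hull (M E : comod) (e : 'M[k]_(cdim M, cdim E)) : Prop :=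
  [/\ injective E, is_hom e, row_free e &
    forall (N : comod) (h : 'M[k]_(cdim E, cdim N)),
      is_hom h -> row_free (e *m h) -> row_free h].

Definition Omega1 (M X : comod) : Prop :=
  exists (P : comod) (p : 'M[k]_(cdim P, cdim M)) (j : 'M[k]_(cdim X, cdim P)),
    [/\ proj_cover p, is_hom j, row_free j & (j == kermx p)%MS].

Definition OmegaInv1 (M Y : comod) : Prop :=
  exists (E : comod) (e : 'M[k]_(cdim M, cdim E)) (q : 'M[k]_(cdim E, cdim Y)),
    [/\ inj_hull e, is_hom q, row_full q & (e == kermx q)%MS].

(* Iterates, on isomorphism classes given as predicates. *)
Fixpoint OmegaN (n : nat) (P : comod -> Prop) : comod -> Prop :=
  match n with
  | 0 => P
  | n'.+1 => fun X => exists Y, OmegaN n' P Y /\ Omega1 Y X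
  end.

Fixpoint OmegaInvN (n : nat) (P : comod -> Prop) : comod -> Prop :=
  match n with
  | 0 => P
  | n'.+1 => fun X => exists Y, OmegaInvN n' P Y /\ OmegaInv1 Y X
  end.

Definition Omega (m : int) (P : comod -> Prop) : comod -> Prop :=
  match m with
  | Posz n => OmegaN n P
  | Negz n => OmegaInvN n.+1 P
  end.

(* The right subcomodule of B (with rho = Delta) spanned by a list L of basis
   elements closed under left factors; on the basis L the coaction is
   rho_c(e_i) = \sum_j [comul_pair (L_j) c = Some (L_i)] e_j. *)
Definition regmat (L : seq Bbasis) (c : Bbasis) : 'M[k]_(size L) :=
  \matrix_(i < size L, j < size L)
    (if comul_pair (nth (G 0) L j) c == Some (nth (G 0) L i) then 1 else 0).

Definition realizes (X : comod) (L : seq Bbasis) : Prop :=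
  exists (f : 'M[k]_(size L, cdim X)) (g : 'M[k]_(cdim X, size L)),
    [/\ f *m g = 1%:M, g *m f = 1%:M & forall c, regmat L c *m f = f *m coact X c].

Definition IsS (n : int) (X : comod) : Prop :=
  match n with
  | Posz m => realizes X [:: G m]
  | Negz _ => cdim X = 0%N
  end.

Definition Ibasis (n : nat) : seq Bbasis :=
  match n with
  | 0 => [:: G 0; Bb 0; D 0]
  | m.+1 => [:: G n; A m; Bb n; D n]
  end.

Definition IsI (n : nat) (X : comod) : Prop := realizes X (Ibasis n).

Definition is_ses (X Y Z : comod) (f : 'M[k]_(cdim X, cdim Y))
  (g : 'M[k]_(cdim Y, cdim Z)) : Prop :=
  [/\ is_hom f, is_hom g, row_free f, row_full g & (f == kermx g)%MS].

Definition split_mono (X U : comod) (u : 'M[k]_(cdim X, cdim U)) : Prop :=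
  exists r : 'M[k]_(cdim U, cdim X), is_hom r /\ u *m r = 1%:M.

Definition almost_split (X Y Z : comod) (f : 'M[k]_(cdim X, cdim Y))
  (g : 'M[k]_(cdim Y, cdim Z)) : Prop :=
  [/\ is_ses f g, indecomposable X, indecomposable Z, ~ split_mono f &
    forall (U : comod) (u : 'M[k]_(cdim X, cdim U)),
      is_hom u -> ~ split_mono u ->
      exists h : 'M[k]_(cdim Y, cdim U), is_hom h /\ f *m h = u].

Definition ses_iso (X Y Z X' Y' Z' : comod)
  (f : 'M[k]_(cdim X, cdim Y)) (g : 'M[k]_(cdim Y, cdim Z))
  (f' : 'M[k]_(cdim X', cdim Y')) (g' : 'M[k]_(cdim Y', cdim Z')) : Prop :=
  exists (al : 'M[k]_(cdim X, cdim X')) (be : 'M[k]_(cdim Y, cdim Y'))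
         (ga : 'M[k]_(cdim Z, cdim Z')),
    [/\ is_iso al, is_iso be, is_iso ga,
        f *m be = al *m f' & g *m ga = be *m g'].

Definition biprod3 (Y A C E : comod) : Prop :=
  exists W : comod, biprod2 W A C /\ biprod2 Y W E.

Definition IsE (n : nat) (i : int) (E : comod) : Prop :=
  if i == 0 then IsI n E else cdim E = 0%N.

End Comodules.

(* Main.v *)
(* For 0 -> X -> P -> Y -> 0 exact with P projective (equivalently injective),
   P -> Y is a projective cover iff all d_n act as zero on X, and X -> P is an
   injective hull iff they act as zero on Y. So Omega and Omega^-1 are mutually
   inverse on the comodules killed by the d_n, which contain all nonprojective
   indecomposables.

   Existence. For i = 0 the sequence starting at rad I_n is checked by hand.
   Lifting maps along 0 -> X -> P -> Y -> 0 shows that Omega^-1 preserves almost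
   split sequences, up to an injective summand of the middle term. It vanishes
   because dimensions weighted by n+1 at the vertex n balance: Omega^i S(n) has
   weight (2|i|+1)(n+1). Vector space duality, which exchanges a_i and b_i, gives
   the remaining i.

   Completeness. An almost split sequence is determined by its left end X, so it
   suffices that an indecomposable nonprojective X is some Omega^i S(n). As long
   as Omega^-j X is not simple, its socle and top have the dimension vectors u_j
   and u_(j-1), where u_(j+1) + u_(j-1) = (u_j shifted left) + (u_j shifted
   right): a discrete wave equation on the half-line. Up to duality its linear
   weight does not increase, which confines u_j to a fixed interval; a weight
   concave on that interval is then a strictly concave nonnegative function of
   j, which cannot exist for all j. *)

Require Import Defs.
From HB Require Import structures.
From mathcomp Require Import all_boot all_order all_algebra.
From mathcomp Require Import zify.
From Stdlib Require Import Classical.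
Set Implicit Arguments. Unset Strict Implicit. Unset Printing Implicit Defensive.
(* Imported again so that [injective] is the notion for comodules. *)
Import Defs.
Import GRing.Theory.
Local Open Scope ring_scope.

(** [I_n] is both free and cofree on one vector at the vertex [n]: [D n] generates it, [G n] spans
    its socle, and the form given by [codual] pairs left and right factors of [D n]. So in any
    injective comodule the image of [D n] is the whole [S(n)]-part of the socle, which turns
    minimality of covers and hulls into the vanishing of operators, a condition that transposes
    well. The wave equation comes from cancellation. A nonsimple indecomposable killed by all [D n]
    has its radical equal to its socle, so its dimension vector is socle plus top. Since [I_n] has
    the composition factors [S(n)] twice, [S(n-1)] and [S(n+1)], adding up the vectors of [X] and of
    its cosyzygy and removing the socle of [X] twice leaves only the two shifts. The weight [n+1] is
    the harmonic function of this equation that vanishes at [-1], so the linear weight is affine in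
    time; that alone contradicts nothing, since it may be constant. A strictly concave quantity is
    needed, and a concave weight is nonnegative only on a bounded interval: hence the two
    weights. *)

Notation hom X Y f := (@is_hom _ X Y f).

(** * Homomorphisms, isomorphisms and rank conditions *)

Section Basics.
Variable k : fieldType.
Implicit Types X Y Z U V W P Q E M : comod k.

Definition iso X Y := exists f : 'M[k]_(cdim X, cdim Y), is_iso f.

Lemma hom1 X : hom X X 1%:M.
Proof. by move=> c; rewrite mulmx1 mul1mx. Qed.

Lemma hom0 X Y : hom X Y 0.
Proof. by move=> c; rewrite mulmx0 mul0mx. Qed.

Lemma homM X Y Z (f : 'M_(cdim X, cdim Y)) (g : 'M_(cdim Y, cdim Z)) :
  hom X Y f -> hom Y Z g -> hom X Z (f *m g).
Proof. by move=> hf hg c; rewrite mulmxA hf -!mulmxA hg. Qed.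

Lemma homD X Y (f g : 'M_(cdim X, cdim Y)) :
  hom X Y f -> hom X Y g -> hom X Y (f + g).
Proof. by move=> hf hg c; rewrite mulmxDl mulmxDr hf hg. Qed.

Lemma homN X Y (f : 'M_(cdim X, cdim Y)) : hom X Y f -> hom X Y (- f).
Proof. by move=> hf c; rewrite mulmxN mulNmx hf. Qed.

Lemma homB X Y (f g : 'M_(cdim X, cdim Y)) :
  hom X Y f -> hom X Y g -> hom X Y (f - g).
Proof. by move=> hf hg; apply/homD/homN. Qed.

Lemma homV X Y (f : 'M_(cdim X, cdim Y)) (g : 'M_(cdim Y, cdim X)) :
  hom X Y f -> f *m g = 1%:M -> g *m f = 1%:M -> hom Y X g.
Proof.
move=> hf fg gf c.
by rewrite -[LHS]mul1mx -gf -mulmxA (mulmxA f) -hf -!mulmxA fg mulmx1.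
Qed.

Lemma iso_refl X : iso X X.
Proof.
by exists 1%:M; split; [exact: hom1 | exists 1%:M; rewrite mulmx1; split => //; exact: hom1].
Qed.

Lemma is_isoV X Y (f : 'M_(cdim X, cdim Y)) :
  is_iso f -> exists2 g : 'M_(cdim Y, cdim X), is_iso g & f *m g = 1%:M /\ g *m f = 1%:M.
Proof. by move=> [hf [g [hg [fg gf]]]]; exists g => //; split => //; exists f. Qed.

Lemma iso_sym X Y : iso X Y -> iso Y X.
Proof. by move=> [f /is_isoV[g ig _]]; exists g. Qed.

Lemma is_isoM X Y Z (f : 'M_(cdim X, cdim Y)) (g : 'M_(cdim Y, cdim Z)) :
  is_iso f -> is_iso g -> @is_iso k X Z (f *m g).
Proof.
move=> [hf [f' [hf' [ff' f'f]]]] [hg [g' [hg' [gg' g'g]]]]; split; first exact: homM hf hg.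
exists (g' *m f'); split; first exact: homM hg' hf'.
by rewrite -mulmxA (mulmxA g) gg' mul1mx ff' -mulmxA (mulmxA f') f'f mul1mx g'g.
Qed.

Lemma iso_trans Y X Z : iso X Y -> iso Y Z -> iso X Z.
Proof. by move=> [f If] [g Ig]; exists (f *m g); apply: is_isoM. Qed.

Lemma iso_dim X Y : iso X Y -> cdim X = cdim Y.
Proof.
move=> [f [_ [g [_ [fg gf]]]]]; apply/eqP; rewrite eqn_leq.
by rewrite (mulmx1_min fg) (mulmx1_min gf).
Qed.

Lemma iso_dim0 X Y : cdim X = 0%N -> cdim Y = 0%N -> iso X Y.
Proof.
move=> X0 Y0; exists 0; split; first exact: hom0.
exists 0; split; first exact: hom0.
by split; apply/matrixP => i; [case: (i) | case: (i)] => m; rewrite ?X0 ?Y0.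
Qed.

Lemma full_free_iso X Y (f : 'M_(cdim X, cdim Y)) :
  hom X Y f -> row_free f -> row_full f -> is_iso f.
Proof.
move=> hf /row_freeP[g fg] /row_fullP[g' gf].
have E : g = g' by rewrite -[g]mul1mx -gf -mulmxA fg mulmx1.
subst g'; split => //; exists g; split => //; exact: (homV hf).
Qed.

Lemma iso_free X Y (f : 'M_(cdim X, cdim Y)) : is_iso f -> row_free f.
Proof. by move=> [_ [g [_ [fg _]]]]; apply/row_freeP; exists g. Qed.

Lemma iso_full X Y (f : 'M_(cdim X, cdim Y)) : is_iso f -> row_full f.
Proof. by move=> [_ [g [_ [_ gf]]]]; apply/row_fullP; exists g. Qed.

Lemma dimle_iso X Y (f : 'M_(cdim X, cdim Y)) :
  hom X Y f -> row_free f -> (cdim Y <= cdim X)%N -> is_iso f.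
Proof.
move=> hf fr le; apply: full_free_iso => //.
by rewrite /row_full eqn_leq rank_leq_col (eqP fr).
Qed.

Lemma unit_iso X (f : 'M_(cdim X)) : hom X X f -> f \in unitmx -> @is_iso k X X f.
Proof. by move=> hf uf; apply: full_free_iso; rewrite ?row_free_unit ?row_full_unit. Qed.

Lemma free_comp m n p (A : 'M[k]_(m, n)) (B : 'M_(n, p)) :
  row_free A -> row_free B -> row_free (A *m B).
Proof. by move=> fA fB; rewrite /row_free mxrankMfree. Qed.

Lemma full_comp m n p (A : 'M[k]_(m, n)) (B : 'M_(n, p)) :
  row_full A -> row_full B -> row_full (A *m B).
Proof. by move=> fA fB; rewrite /row_full eqmxMfull. Qed.

Lemma free_compl m n p (A : 'M[k]_(m, n)) (B : 'M_(n, p)) : row_free (A *m B) -> row_free A.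
Proof. by move/row_freeP=> [C E]; apply/row_freeP; exists (B *m C); rewrite mulmxA. Qed.

Lemma full_compr m n p (A : 'M[k]_(m, n)) (B : 'M_(n, p)) : row_full (A *m B) -> row_full B.
Proof. by move/row_fullP=> [C E]; apply/row_fullP; exists (C *m A); rewrite -mulmxA. Qed.

Lemma not_row_free m n (A : 'M[k]_(m, n)) :
  ~~ row_free A -> exists2 v : 'rV_m, v != 0 & v *m A = 0.
Proof.
rewrite -kermx_eq0 => /rowV0Pn[v /sub_kermxP vA nz]; by exists v.
Qed.

Lemma row_freeV0 m n (A : 'M[k]_(m, n)) :
  (forall v : 'rV_m, v *m A = 0 -> v = 0) -> row_free A.
Proof.
move=> H; apply/negPn/negP => /not_row_free[v nz /H v0].
by rewrite v0 eqxx in nz.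
Qed.

Lemma free_eq0 m n p (A : 'M[k]_(m, n)) (B : 'M_(n, p)) :
  row_free B -> A *m B = 0 -> A = 0.
Proof. by move=> fB /eqP; rewrite mulmx_free_eq0 // => /eqP. Qed.

Lemma full_eq0 m n p (A : 'M[k]_(m, n)) (B : 'M_(n, p)) :
  row_full A -> A *m B = 0 -> B = 0.
Proof. by move=> fA AB; apply: (row_full_inj fA); rewrite AB mulmx0. Qed.

Lemma tr_free m n (A : 'M[k]_(m, n)) : row_free A^T = row_full A.
Proof. by rewrite /row_free /row_full mxrank_tr. Qed.

Lemma tr_full m n (A : 'M[k]_(m, n)) : row_full A^T = row_free A.
Proof. by rewrite /row_free /row_full mxrank_tr. Qed.

Lemma not_submx m n p (A : 'M[k]_(m, n)) (B : 'M_(p, n)) :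
  ~~ (A <= B)%MS -> exists v : 'rV_m, ~~ (v *m A <= B)%MS.
Proof. by move/row_subPn=> [i ni]; exists (delta_mx 0 i); rewrite -rowE. Qed.

Lemma neq0_row m n (A : 'M[k]_(m, n)) : A != 0 -> exists v : 'rV_m, v *m A != 0.
Proof.
move=> nz; have : ~~ (A <= (0 : 'M_n))%MS by rewrite submx0.
by move/not_submx=> [v]; rewrite submx0; exists v.
Qed.

(** * Subobjects, quotients, sums and duals *)

Lemma coactGG X n : coact X (G n) *m coact X (G n) = coact X (G n).
Proof. by rewrite coact_coassoc /= eqxx. Qed.

Lemma sum_coactG X N : (cbound X <= N)%N -> \sum_(i < N) coact X (G i) = 1%:M.
Proof.
move=> le; rewrite -(coact_counit X) (big_ord_widen N (fun i => coact X (G i)) le) [RHS]big_mkcond /=.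
apply: eq_bigr => i _; case: ltnP => // le'; exact: coact_fin.
Qed.

Section Transport.
Variables (X : comod k) (r : nat) (N : Bbasis -> 'M[k]_r).

(** The comodule axioms for [N] become those of [X] after composition with [j], which can be
    cancelled. In [comod_epi] a surjection is cancelled on the other side. *)
Lemma comod_mono (j : 'M_(r, cdim X)) :
  row_free j -> (forall c, N c *m j = j *m coact X c) ->
  exists S : comod k, exists j' : 'M_(cdim S, cdim X),
    [/\ hom S X j', row_free j' & (j' :=: j)%MS].
Proof.
move=> fj Nj.
have fin c : (cbound X <= bidx c)%N -> N c = 0.
  by move=> le; apply: (free_eq0 fj); rewrite Nj coact_fin ?mulmx0.
have cou : \sum_(i < cbound X) N (G i) = 1%:M.
  apply: (row_free_inj fj); rewrite mulmx_suml; under eq_bigr do rewrite Nj.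
  by rewrite -mulmx_sumr sum_coactG // mulmx1 mul1mx.
have ass c c' : N c *m N c' = match comul_pair c' c with Some e => N e | None => 0 end.
  apply: (row_free_inj fj); rewrite -mulmxA Nj mulmxA Nj -mulmxA coact_coassoc.
  by case: comul_pair => [e|]; rewrite ?Nj // mulmx0 mul0mx.
by exists (Comod fin cou ass), j.
Qed.

Lemma comod_epi (q : 'M_(cdim X, r)) :
  row_full q -> (forall c, q *m N c = coact X c *m q) ->
  exists S : comod k, exists q' : 'M_(cdim X, cdim S),
    [/\ hom X S q', row_full q' & (kermx q' :=: kermx q)%MS].
Proof.
move=> fq Nq.
have fin c : (cbound X <= bidx c)%N -> N c = 0.
  by move=> le; apply: (full_eq0 fq); rewrite Nq coact_fin ?mul0mx.
have cou : \sum_(i < cbound X) N (G i) = 1%:M.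
  apply: (row_full_inj fq); rewrite mulmx_sumr; under eq_bigr do rewrite Nq.
  by rewrite -mulmx_suml sum_coactG // mulmx1 mul1mx.
have ass c c' : N c *m N c' = match comul_pair c' c with Some e => N e | None => 0 end.
  apply: (row_full_inj fq); rewrite mulmxA Nq -mulmxA Nq mulmxA coact_coassoc.
  by case: comul_pair => [e|]; rewrite ?Nq // mulmx0 mul0mx.
exists (Comod fin cou ass), q; split=> // c; exact: esym (Nq c).
Qed.

End Transport.

Lemma sub_ex X m (U : 'M_(m, cdim X)) :
  (forall c, (U *m coact X c <= U)%MS) ->
  exists S : comod k, exists j : 'M_(cdim S, cdim X),
    [/\ hom S X j, row_free j & (j :=: U)%MS].
Proof.
move=> inv; pose j := row_base U.
have fj : row_free j := row_base_free U.
have inv' c : (j *m coact X c <= j)%MS.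
  by rewrite /j (eqmxMr _ (eq_row_base U)) eq_row_base.
have [S [j' [h f e]]] := @comod_mono X _ (fun c => j *m coact X c *m pinvmx j) j fj
  (fun c => mulmxKpV (inv' c)).
by exists S, j'; split=> //; apply: eqmx_trans e (eq_row_base U).
Qed.

Lemma quot_ex X m (U : 'M_(m, cdim X)) :
  (forall c, (U *m coact X c <= U)%MS) ->
  exists S : comod k, exists q : 'M_(cdim X, cdim S),
    [/\ hom X S q, row_full q & (kermx q :=: U)%MS].
Proof.
(* [cokermx U] is a square matrix whose kernel is the row space of [U]; its column basis is a
   surjection with the same kernel. *)
move=> inv; pose q := col_base (cokermx U).
have fq : row_full q := col_base_full (cokermx U).
have eqK : (kermx q :=: U)%MS.
  apply/eqmxP/andP; split.
    rewrite submxE; apply/eqP; transitivity (kermx q *m (q *m row_base (cokermx U))).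
      by rewrite mulmx_base.
    by rewrite mulmxA mulmx_ker mul0mx.
  apply/sub_kermxP; apply: (free_eq0 (row_base_free (cokermx U))).
  by rewrite -mulmxA mulmx_base mulmx_coker.
have Nq c : q *m (pinvmx q *m coact X c *m q) = coact X c *m q.
  apply/eqP; rewrite -subr_eq0.
  have -> : q *m (pinvmx q *m coact X c *m q) - coact X c *m q
            = (q *m pinvmx q - 1%:M) *m (coact X c *m q) by rewrite mulmxBl mul1mx !mulmxA.
  have : (q *m pinvmx q - 1%:M <= U)%MS.
    by rewrite -eqK; apply/sub_kermxP; rewrite mulmxBl -mulmxA mulVpmx // mulmx1 mul1mx subrr.
  move/submxP=> [D ->]; rewrite -mulmxA; apply/eqP.
  have /submxP[D' E] := inv c; rewrite (mulmxA U) E -(mulmxA D').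
  have -> : U *m q = 0 by apply/sub_kermxP; rewrite eqK.
  by rewrite !mulmx0.
have [S [q' [h f e]]] := @comod_epi X _ (fun c => pinvmx q *m coact X c *m q) q fq Nq.
by exists S, q'; split=> //; apply: eqmx_trans e eqK.
Qed.

Lemma factor_mono X Y P (j : 'M_(cdim Y, cdim P)) (f : 'M_(cdim X, cdim P)) :
  hom Y P j -> row_free j -> hom X P f -> (f <= j)%MS ->
  exists2 h : 'M_(cdim X, cdim Y), hom X Y h & h *m j = f.
Proof.
move=> hj fj hf /mulmxKpV E; exists (f *m pinvmx j) => // c.
by apply: (row_free_inj fj); rewrite -(mulmxA (coact X c)) E -(mulmxA (f *m _)) hj mulmxA E.
Qed.

Lemma factor_epi X P Z (q : 'M_(cdim P, cdim Z)) (f : 'M_(cdim P, cdim X)) :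
  hom P Z q -> row_full q -> hom P X f -> kermx q *m f = 0 ->
  exists2 h : 'M_(cdim Z, cdim X), hom Z X h & q *m h = f.
Proof.
move=> hq fq hf kf.
have E : q *m (pinvmx q *m f) = f.
  apply/eqP; rewrite -subr_eq0 mulmxA -[X in _ - X]mul1mx -mulmxBl.
  have /submxP[D ->] : (q *m pinvmx q - 1%:M <= kermx q)%MS.
    by apply/sub_kermxP; rewrite mulmxBl -mulmxA mulVpmx // mulmx1 mul1mx subrr.
  by rewrite -mulmxA kf mulmx0.
exists (pinvmx q *m f) => // c.
by apply: (row_full_inj fq); rewrite mulmxA -hq -mulmxA E hf mulmxA E.
Qed.

Lemma ker_ex X Y (f : 'M_(cdim X, cdim Y)) : hom X Y f ->
  exists S : comod k, exists j : 'M_(cdim S, cdim X),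
    [/\ hom S X j, row_free j & (j :=: kermx f)%MS].
Proof.
move=> hf; apply: sub_ex => c; apply/sub_kermxP.
by rewrite -mulmxA hf mulmxA mulmx_ker mul0mx.
Qed.

Lemma coker_ex X Y (f : 'M_(cdim X, cdim Y)) : hom X Y f ->
  exists S : comod k, exists q : 'M_(cdim Y, cdim S),
    [/\ hom Y S q, row_full q & (kermx q :=: f)%MS].
Proof. by move=> hf; apply: quot_ex => c; rewrite -hf submxMl. Qed.

Lemma im_ex X Y (f : 'M_(cdim X, cdim Y)) : hom X Y f ->
  exists S : comod k, exists p : 'M_(cdim X, cdim S), exists j : 'M_(cdim S, cdim Y),
    [/\ hom X S p, row_full p, hom S Y j, row_free j & p *m j = f].
Proof.
move=> hf; have [S [j [hj fj E]]] : exists S : comod k, exists j : 'M_(cdim S, cdim Y),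
    [/\ hom S Y j, row_free j & (j :=: f)%MS].
  by apply: sub_ex => c; rewrite -hf submxMl.
have [] := factor_mono hj fj hf; first by rewrite E.
move=> p hp pj; exists S, p, j; split=> //.
have : (1%:M *m j <= p *m j)%MS by rewrite pj mul1mx E.
by rewrite submxMfree // sub1mx.
Qed.

Lemma dsum_ex X Y : exists Z : comod k, biprod2 Z X Y.
Proof.
pose N c := block_mx (coact X c) 0 0 (coact Y c).
have fin c : (maxn (cbound X) (cbound Y) <= bidx c)%N -> N c = 0.
  by rewrite geq_max => /andP[a b]; rewrite /N !coact_fin // block_mx_const.
have cou : \sum_(i < maxn (cbound X) (cbound Y)) N (G i) = 1%:M.
  rewrite scalar_mx_block -(sum_coactG (leq_maxl (cbound X) (cbound Y))).
  rewrite -(sum_coactG (leq_maxr (cbound X) (cbound Y))).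
  elim/big_ind3: _ => [|A1 A2 A3 B1 B2 B3 -> ->|//]; first by rewrite block_mx_const.
  by rewrite add_block_mx !addr0.
have ass c c' : N c *m N c' = match comul_pair c' c with Some e => N e | None => 0 end.
  rewrite /N mulmx_block !mul0mx !mulmx0 !addr0 !add0r !coact_coassoc.
  by case: comul_pair => // ; rewrite block_mx_const.
exists (Comod fin cou ass), (row_mx 1%:M 0), (row_mx 0 1%:M), (col_mx 1%:M 0), (col_mx 0 1%:M).
split; split.
- by move=> c /=; rewrite mul_mx_row mul_row_block !mulmx0 !mul0mx mul1mx mulmx1 !addr0.
- by move=> c /=; rewrite mul_mx_row mul_row_block !mulmx0 !mul0mx mul1mx mulmx1 !add0r.
- by move=> c /=; rewrite mul_block_col [RHS]mul_col_mx !mulmx0 !mul0mx mul1mx mulmx1 !addr0.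
- by move=> c /=; rewrite mul_block_col [RHS]mul_col_mx !mulmx0 !mul0mx mul1mx mulmx1 !add0r.
- by rewrite mul_row_col mulmx1 mulmx0 addr0.
- by rewrite mul_row_col mulmx1 mulmx0 add0r.
- by rewrite mul_row_col mulmx0 mul0mx addr0.
- by rewrite mul_row_col mulmx0 mul0mx addr0.
- rewrite !mul_col_row !mulmx1 ?mulmx0 ?mul0mx add_block_mx !addr0 !add0r.
  by rewrite -scalar_mx_block.
Qed.

Lemma zero_fin (c : Bbasis) : (0 <= bidx c)%N -> (fun _ : Bbasis => 0 : 'M[k]_0) c = 0.
Proof. by []. Qed.
Lemma zero_counit : \sum_(i < 0) (fun _ : Bbasis => 0 : 'M[k]_0) (G i) = 1%:M.
Proof. by rewrite big_ord0; apply/matrixP => -[]. Qed.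
Lemma zero_coassoc (c c' : Bbasis) :
  (0 : 'M[k]_0) *m (0 : 'M[k]_0) = match comul_pair c' c with Some e => (fun _ : Bbasis => 0 : 'M[k]_0) e | None => 0 end.
Proof. by case: comul_pair; rewrite mul0mx. Qed.
Definition zero_comod : comod k := Comod zero_fin zero_counit zero_coassoc.

(** Path reversal, an anti-automorphism of [B]. Transposing a right coaction gives a left one, and
    composing with [swap] makes it a right one again, so [dual] stays among right comodules. *)
Definition swap (c : Bbasis) : Bbasis :=
  match c with G i => G i | A i => Bb i | Bb i => A i | D i => D i end.

Lemma swK : involutive swap. Proof. by case. Qed.

Lemma comul_swap c c' : comul_pair (swap c) (swap c') = omap swap (comul_pair c' c).
Proof.
case: c c' => i [] j //=; repeat (case: eqP => ? //=); subst => //; congruence.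
Qed.

Section Dual.
Variable X : comod k.
Let N c := (coact X (swap c))^T.
Lemma dual_fin c : (cbound X <= bidx c)%N -> N c = 0.
Proof. by move=> le; rewrite /N coact_fin ?trmx0 //; case: c le. Qed.
Lemma dual_counit : \sum_(i < cbound X) N (G i) = 1%:M.
Proof. by rewrite /N /= -linear_sum /= sum_coactG // trmx1. Qed.
Lemma dual_coassoc c c' :
  N c *m N c' = match comul_pair c' c with Some e => N e | None => 0 end.
Proof.
rewrite /N -trmx_mul coact_coassoc comul_swap.
by case: comul_pair => //=; rewrite trmx0.
Qed.
Definition dual : comod k := Comod dual_fin dual_counit dual_coassoc.
End Dual.

Lemma hom_tr X Y (f : 'M_(cdim X, cdim Y)) : hom X Y f -> hom (dual Y) (dual X) f^T.
Proof. by move=> h c /=; rewrite -!trmx_mul h. Qed.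

Lemma hom_trl X Y (f : 'M_(cdim X, cdim Y)) : hom (dual X) Y f -> hom (dual Y) X f^T.
Proof.
by move=> h c /=; apply: trmx_inj; rewrite !trmx_mul !trmxK -h /= swK.
Qed.

Lemma hom_trr X Y (f : 'M_(cdim X, cdim Y)) : hom X (dual Y) f -> hom Y (dual X) f^T.
Proof.
by move=> h c /=; apply: trmx_inj; rewrite !trmx_mul !trmxK h /= swK.
Qed.

Lemma hom_trK X Y (f : 'M_(cdim X, cdim Y)) : hom (dual X) (dual Y) f -> hom Y X f^T.
Proof. by move=> h c; have /= := h (swap c); rewrite !swK => E; apply: trmx_inj; rewrite !trmx_mul trmxK E. Qed.

Lemma is_iso_tr X Y (f : 'M_(cdim X, cdim Y)) : is_iso f -> @is_iso k (dual Y) (dual X) f^T.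
Proof.
move=> [hf [g [hg [fg gf]]]]; split; first exact: hom_tr.
by exists g^T; rewrite -!trmx_mul fg gf !trmx1; split=> //; apply: hom_tr.
Qed.

Lemma iso_dual X Y : iso X Y -> iso (dual X) (dual Y).
Proof. by move=> /iso_sym[f If]; exists f^T; apply: is_iso_tr. Qed.

Lemma iso_dualK X : iso (dual (dual X)) X.
Proof.
have h : hom (dual (dual X)) X 1%:M by move=> c; rewrite mulmx1 mul1mx /= swK trmxK.
by exists 1%:M; apply: full_free_iso; rewrite ?row_free_unit ?row_full_unit ?unitmx1.
Qed.

Lemma biprod_dual Y X1 X2 : biprod2 Y X1 X2 -> biprod2 (dual Y) (dual X1) (dual X2).
Proof.
move=> [i1 [i2 [p1 [p2 [[hi1 hi2 hp1 hp2] [e1 e2 e12 e21 e]]]]]].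
exists p1^T, p2^T, i1^T, i2^T; split; split; try exact: hom_tr; rewrite -!trmx_mul.
- by rewrite e1 trmx1.
- by rewrite e2 trmx1.
- by rewrite e21 trmx0.
- by rewrite e12 trmx0.
- by rewrite -linearD /= e trmx1.
Qed.

Lemma biprod_iso Y X1 X2 Y' X1' X2' : iso Y Y' -> iso X1 X1' -> iso X2 X2' ->
  biprod2 Y X1 X2 -> biprod2 Y' X1' X2'.
Proof.
move=> [a [ha [a' [ha' [aa' a'a]]]]] [b [hb [b' [hb' [bb' b'b]]]]].
move=> [c [hc [c' [hc' [cc' c'c]]]]].
move=> [i1 [i2 [p1 [p2 [[hi1 hi2 hp1 hp2] [e1 e2 e12 e21 e]]]]]].
exists (b' *m i1 *m a), (c' *m i2 *m a), (a' *m p1 *m b), (a' *m p2 *m c).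
have K m n (x : 'M_(m, _)) (y : 'M_(_, n)) : x *m a *m (a' *m y) = x *m y.
  by rewrite -mulmxA (mulmxA a) aa' mul1mx.
split; split.
- exact: homM (homM hb' hi1) ha.
- exact: homM (homM hc' hi2) ha.
- exact: homM (homM ha' hp1) hb.
- exact: homM (homM ha' hp2) hc.
- by rewrite -(mulmxA a') K mulmxA -(mulmxA b') e1 mulmx1 b'b.
- by rewrite -(mulmxA a') K mulmxA -(mulmxA c') e2 mulmx1 c'c.
- by rewrite -(mulmxA a') K mulmxA -(mulmxA b') e12 mulmx0 mul0mx.
- by rewrite -(mulmxA a') K mulmxA -(mulmxA c') e21 mulmx0 mul0mx.
- rewrite !mulmxA -(mulmxA (a' *m p1)) bb' -(mulmxA (a' *m p2)) cc' !mulmx1.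
  by rewrite -mulmxDl -!(mulmxA a') -mulmxDr e mulmx1 a'a.
Qed.

(** * Short exact sequences *)

Section Ses.
Variables (X Y Z : comod k) (f : 'M[k]_(cdim X, cdim Y)) (g : 'M[k]_(cdim Y, cdim Z)).
Hypothesis ex : is_ses f g.

Lemma ses_homl : hom X Y f. Proof. by case: ex. Qed.
Lemma ses_homr : hom Y Z g. Proof. by case: ex. Qed.
Lemma ses_free : row_free f. Proof. by case: ex. Qed.
Lemma ses_full : row_full g. Proof. by case: ex. Qed.
Lemma ses_ker : (f == kermx g)%MS. Proof. by case: ex. Qed.

Lemma ses_comp0 : f *m g = 0.
Proof. by apply/sub_kermxP; case/andP: ses_ker. Qed.

Lemma ses_exact m (x : 'M_(m, cdim Y)) : x *m g = 0 -> exists y, x = y *m f.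
Proof.
move=> xg; have /submxP[y ->] : (x <= f)%MS; last by exists y.
by rewrite (eqmxP ses_ker) sub_kermx xg.
Qed.

Lemma ses_coexact n (x : 'M_(cdim Y, n)) : f *m x = 0 -> exists y, x = g *m y.
Proof.
move=> fx; exists (pinvmx g *m x); apply/eqP; rewrite eq_sym -subr_eq0.
rewrite mulmxA -[X in _ - X]mul1mx -mulmxBl.
have [y ->] : exists y, g *m pinvmx g - 1%:M = y *m f.
  by apply: ses_exact; rewrite mulmxBl -mulmxA mulVpmx ?ses_full // mulmx1 mul1mx subrr.
by rewrite -mulmxA fx mulmx0.
Qed.

Lemma ses_dim : (cdim X + cdim Z = cdim Y)%N.
Proof.
have := mxrank_ker g; rewrite -(eqmxP ses_ker) (eqP ses_free) (eqP ses_full).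
by have := rank_leq_row g; rewrite (eqP ses_full); lia.
Qed.

Lemma ses_liftl W (h : 'M_(cdim W, cdim Y)) : hom W Y h -> h *m g = 0 ->
  exists2 h' : 'M_(cdim W, cdim X), hom W X h' & h' *m f = h.
Proof.
move=> hh hg; apply: factor_mono => //; first exact: ses_homl; first exact: ses_free.
by have [y ->] := ses_exact hg; apply: submxMl.
Qed.

Lemma ses_liftr W (h : 'M_(cdim Y, cdim W)) : hom Y W h -> f *m h = 0 ->
  exists2 h' : 'M_(cdim Z, cdim W), hom Z W h' & g *m h' = h.
Proof.
move=> hh hg; apply: factor_epi => //; first exact: ses_homr; first exact: ses_full.
have [y ->] := ses_exact (mulmx_ker g).
by rewrite -mulmxA hg mulmx0.
Qed.

End Ses.

Lemma sesI X Y Z (f : 'M_(cdim X, cdim Y)) (g : 'M_(cdim Y, cdim Z)) :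
  hom X Y f -> hom Y Z g -> row_free f -> row_full g -> f *m g = 0 ->
  (forall v : 'rV_(cdim Y), v *m g = 0 -> (v <= f)%MS) -> is_ses f g.
Proof.
move=> hf hg ff fg fg0 H; split=> //; apply/andP; split; first by apply/sub_kermxP.
by apply/row_subP => i; apply: H; rewrite -row_mul mulmx_ker row0.
Qed.

Lemma sesI_dim X Y Z (f : 'M_(cdim X, cdim Y)) (g : 'M_(cdim Y, cdim Z)) :
  hom X Y f -> hom Y Z g -> row_free f -> row_full g -> f *m g = 0 ->
  (cdim X + cdim Z = cdim Y)%N -> is_ses f g.
Proof.
move=> hf hg ff fg fg0 H; split=> //.
have le : (f <= kermx g)%MS by apply/sub_kermxP.
rewrite le /= -(geq_leqif (mxrank_leqif_sup le)) mxrank_ker.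
by rewrite (eqP ff) (eqP fg) -H; lia.
Qed.

Lemma ses_dual X Y Z (f : 'M_(cdim X, cdim Y)) (g : 'M_(cdim Y, cdim Z)) :
  is_ses f g -> @is_ses k (dual Z) (dual Y) (dual X) g^T f^T.
Proof.
move=> ex; apply: sesI_dim.
- exact: hom_tr (ses_homr ex).
- exact: hom_tr (ses_homl ex).
- by rewrite tr_free (ses_full ex).
- by rewrite tr_full (ses_free ex).
- by rewrite -trmx_mul (ses_comp0 ex) trmx0.
- by rewrite /= addnC (ses_dim ex).
Qed.

Lemma ses_ker_ex Y Z (g : 'M_(cdim Y, cdim Z)) : hom Y Z g -> row_full g ->
  exists X : comod k, exists f : 'M_(cdim X, cdim Y), is_ses f g.
Proof.
move=> hg fg; have [X [f [hf ff E]]] := ker_ex hg.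
by exists X, f; split=> //; apply/eqmxP.
Qed.

Lemma ses_coker_ex X Y (f : 'M_(cdim X, cdim Y)) : hom X Y f -> row_free f ->
  exists Z : comod k, exists g : 'M_(cdim Y, cdim Z), is_ses f g.
Proof.
move=> hf ff; have [Z [g [hg fg E]]] := coker_ex hf.
by exists Z, g; split=> //; apply/eqmxP/eqmx_sym.
Qed.

Lemma ses_transport X Y Z X' Y' Z' (f : 'M_(cdim X, cdim Y)) (g : 'M_(cdim Y, cdim Z))
    (a : 'M_(cdim X', cdim X)) (b : 'M_(cdim Y, cdim Y')) (b' : 'M_(cdim Y', cdim Y))
    (c : 'M_(cdim Z, cdim Z')) :
  is_ses f g -> is_iso a -> is_iso b -> is_iso b' -> b *m b' = 1%:M -> is_iso c ->
  @is_ses k X' Y' Z' (a *m f *m b) (b' *m g *m c).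
Proof.
move=> ex ia ib ib' bb' ic; apply: sesI_dim.
- exact: homM (homM ia.1 (ses_homl ex)) ib.1.
- exact: homM (homM ib'.1 (ses_homr ex)) ic.1.
- by rewrite !free_comp ?(iso_free ia) ?(iso_free ib) ?(ses_free ex).
- by rewrite !full_comp ?(iso_full ic) ?(iso_full ib') ?(ses_full ex).
- by rewrite !mulmxA -(mulmxA _ b) bb' mulmx1 -(mulmxA a) (ses_comp0 ex) mulmx0 mul0mx.
- rewrite (@iso_dim X' X) ?(@iso_dim Z' Z) ?(@iso_dim Y' Y) ?(ses_dim ex) //.
  + by exists b'.
  + by apply: iso_sym; exists c.
  + by exists a.
Qed.

Lemma biprod_ses Y X1 X2 : biprod2 Y X1 X2 ->
  exists (f : 'M_(cdim X1, cdim Y)) (g : 'M_(cdim Y, cdim X2)), is_ses f g.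
Proof.
move=> [i1 [i2 [p1 [p2 [[hi1 hi2 hp1 hp2] [e1 e2 e12 e21 e]]]]]]; exists i1, p2.
apply: sesI => //; [by apply/row_freeP; exists p1 | by apply/row_fullP; exists i2 |].
move=> v v2; apply/submxP; exists (v *m p1).
by rewrite -[LHS]mulmx1 -e mulmxDr !mulmxA v2 mul0mx addr0.
Qed.

Lemma ses_sum X1 Y1 Z1 X2 Y2 Z2 X Y Z
    (f1 : 'M_(cdim X1, cdim Y1)) (g1 : 'M_(cdim Y1, cdim Z1))
    (f2 : 'M_(cdim X2, cdim Y2)) (g2 : 'M_(cdim Y2, cdim Z2)) :
  is_ses f1 g1 -> is_ses f2 g2 ->
  biprod2 X X1 X2 -> biprod2 Y Y1 Y2 -> biprod2 Z Z1 Z2 ->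
  exists (f : 'M_(cdim X, cdim Y)) (g : 'M_(cdim Y, cdim Z)), is_ses f g.
Proof.
move=> ex1 ex2 [ix1 [ix2 [px1 [px2 [[hix1 hix2 hpx1 hpx2] [ex11 ex22 ex12 ex21 ex]]]]]].
move=> [iy1 [iy2 [py1 [py2 [[hiy1 hiy2 hpy1 hpy2] [ey11 ey22 ey12 ey21 ey]]]]]].
move=> [iz1 [iz2 [pz1 [pz2 [[hiz1 hiz2 hpz1 hpz2] [ez11 ez22 ez12 ez21 ez]]]]]].
have hf1 := ses_homl ex1; have hf2 := ses_homl ex2.
have hg1 := ses_homr ex1; have hg2 := ses_homr ex2.
set f := px1 *m f1 *m iy1 + px2 *m f2 *m iy2.
set g := py1 *m g1 *m iz1 + py2 *m g2 *m iz2.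
have fp1 : f *m py1 = px1 *m f1.
  by rewrite mulmxDl -!(mulmxA _ _ py1) ey11 ey21 mulmx0 addr0 mulmx1.
have fp2 : f *m py2 = px2 *m f2.
  by rewrite mulmxDl -!(mulmxA _ _ py2) ey12 ey22 mulmx0 add0r mulmx1.
have gp1 : g *m pz1 = py1 *m g1.
  by rewrite mulmxDl -!(mulmxA _ _ pz1) ez11 ez21 mulmx0 addr0 mulmx1.
have gp2 : g *m pz2 = py2 *m g2.
  by rewrite mulmxDl -!(mulmxA _ _ pz2) ez12 ez22 mulmx0 add0r mulmx1.
exists f, g; apply: sesI.
- apply: homD; first exact: homM (homM hpx1 hf1) hiy1.
  exact: homM (homM hpx2 hf2) hiy2.
- apply: homD; first exact: homM (homM hpy1 hg1) hiz1.
  exact: homM (homM hpy2 hg2) hiz2.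
- apply: row_freeV0 => v vf.
  have v1 : v *m px1 = 0.
    by apply: (free_eq0 (ses_free ex1)); rewrite -mulmxA -fp1 mulmxA vf mul0mx.
  have v2 : v *m px2 = 0.
    by apply: (free_eq0 (ses_free ex2)); rewrite -mulmxA -fp2 mulmxA vf mul0mx.
  by rewrite -[v]mulmx1 -ex mulmxDr !mulmxA v1 v2 !mul0mx addr0.
- rewrite -tr_free; apply: row_freeV0 => v /(congr1 trmx).
  rewrite trmx_mul !trmxK trmx0 => gv.
  have v1 : iz1 *m v^T = 0.
    apply: (full_eq0 (ses_full ex1)).
    have -> : g1 = iy1 *m g *m pz1 by rewrite -mulmxA gp1 mulmxA ey11 mul1mx.
    have : iy1 *m g *m (pz1 *m iz1 + pz2 *m iz2) *m v^T = 0.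
      by rewrite ez mulmx1 -mulmxA gv mulmx0.
    by rewrite mulmxDr mulmxDl !mulmxA -!(mulmxA iy1 g) gp2 gp1 !mulmxA ey12 !mul0mx addr0.
  have v2 : iz2 *m v^T = 0.
    apply: (full_eq0 (ses_full ex2)).
    have -> : g2 = iy2 *m g *m pz2 by rewrite -mulmxA gp2 mulmxA ey22 mul1mx.
    have : iy2 *m g *m (pz1 *m iz1 + pz2 *m iz2) *m v^T = 0.
      by rewrite ez mulmx1 -mulmxA gv mulmx0.
    by rewrite mulmxDr mulmxDl !mulmxA -!(mulmxA iy2 g) gp2 gp1 !mulmxA ey21 !mul0mx add0r.
  apply: trmx_inj; rewrite trmx0 -[v^T]mul1mx -ez mulmxDl -!mulmxA v1 v2.
  by rewrite !mulmx0 addr0.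
- rewrite mulmxDr !mulmxA fp1 fp2 -(mulmxA px1) (ses_comp0 ex1) -(mulmxA px2).
  by rewrite (ses_comp0 ex2) !mulmx0 !mul0mx addr0.
- move=> v vg.
  have [|y1 E1] := @ses_exact _ _ _ _ _ ex1 _ (v *m py1).
    by rewrite -mulmxA -gp1 mulmxA vg mul0mx.
  have [|y2 E2] := @ses_exact _ _ _ _ _ ex2 _ (v *m py2).
    by rewrite -mulmxA -gp2 mulmxA vg mul0mx.
  apply/submxP; exists (y1 *m ix1 + y2 *m ix2).
  have if1 : ix1 *m f = f1 *m iy1 by rewrite mulmxDr !mulmxA ex11 ex12 mul1mx !mul0mx addr0.
  have if2 : ix2 *m f = f2 *m iy2 by rewrite mulmxDr !mulmxA ex22 ex21 mul1mx !mul0mx add0r.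
  by rewrite -[v]mulmx1 -ey mulmxDr !mulmxA E1 E2 mulmxDl -!mulmxA if1 if2.
Qed.

End Basics.

(** * Idempotents and Fitting's lemma *)

Section Fitting.
Variable k : fieldType.
Implicit Types X Y Z U V W P Q E M : comod k.

(** The summands are the images of [e] and [1 - e]. Each identity is tested between a surjection on
    the left and an injection on the right, where it becomes a polynomial identity in [e]. *)
Lemma idem_split X (e : 'M_(cdim X)) : hom X X e -> e *m e = e ->
  exists (X1 X2 : comod k)
    (i1 : 'M_(cdim X1, cdim X)) (i2 : 'M_(cdim X2, cdim X))
    (p1 : 'M_(cdim X, cdim X1)) (p2 : 'M_(cdim X, cdim X2)),
    [/\ [/\ hom X1 X i1, hom X2 X i2, hom X X1 p1 & hom X X2 p2],
        [/\ i1 *m p1 = 1%:M, i2 *m p2 = 1%:M, i1 *m p2 = 0, i2 *m p1 = 0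
          & p1 *m i1 + p2 *m i2 = 1%:M],
        p1 *m i1 = e & p2 *m i2 = 1%:M - e].
Proof.
move=> he ee.
have [X1 [p1 [i1 [hp1 fp1 hi1 fi1 E1]]]] := im_ex he.
have h2 : hom X X (1%:M - e) by apply: homB => //; apply: hom1.
have [X2 [p2 [i2 [hp2 fp2 hi2 fi2 E2]]]] := im_ex h2.
have cancel_mid m n (B : 'M[k]_(cdim X, m)) (C D : 'M_(m, n)) (A : 'M_(n, cdim X)) :
    row_full B -> row_free A -> B *m C *m A = B *m D *m A -> C = D.
  by move=> fB fA E; apply: (row_full_inj fB); apply: (row_free_inj fA).
exists X1, X2, i1, i2, p1, p2; split=> //; split=> //.
- apply: (cancel_mid _ _ p1 _ _ i1) => //.
  by rewrite mulmx1 mulmxA E1 -mulmxA E1.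
- apply: (cancel_mid _ _ p2 _ _ i2) => //.
  by rewrite mulmx1 mulmxA E2 -mulmxA E2 mulmxBl mul1mx mulmxBr mulmx1 ee subrr subr0.
- apply: (cancel_mid _ _ p1 _ _ i2) => //.
  by rewrite mulmx0 mul0mx mulmxA E1 -mulmxA E2 mulmxBr mulmx1 ee subrr.
- apply: (cancel_mid _ _ p2 _ _ i1) => //.
  by rewrite mulmx0 mul0mx mulmxA E2 -mulmxA E1 mulmxBl mul1mx ee subrr.
- by rewrite E1 E2 addrC subrK.
Qed.

Lemma indec_idem X (e : 'M_(cdim X)) : indecomposable X -> hom X X e -> e *m e = e ->
  e = 0 \/ e = 1%:M.
Proof.
move=> [_ ind] he ee.
have [X1 [X2 [i1 [i2 [p1 [p2 [hs es E1 E2]]]]]]] := idem_split he ee.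
have [z|z] := ind X1 X2 (ex_intro _ i1 (ex_intro _ i2 (ex_intro _ p1 (ex_intro _ p2 (conj hs es))))).
- left; rewrite -E1 (_ : i1 = 0) ?mulmx0 //.
  by apply/matrixP => -[i lt]; exfalso; move: lt; rewrite z.
- right; apply/eqP; rewrite eq_sym -subr_eq0 -E2 (_ : i2 = 0) ?mulmx0 //.
  by apply/matrixP => -[i lt]; exfalso; move: lt; rewrite z.
Qed.

Lemma idem_indec X : (0 < cdim X)%N ->
  (forall e : 'M_(cdim X), hom X X e -> e *m e = e -> e = 0 \/ e = 1%:M) ->
  indecomposable X.
Proof.
move=> pos H; split=> // X1 X2 [i1 [i2 [p1 [p2 [[hi1 hi2 hp1 hp2] [e1 e2 e12 e21 e]]]]]].
have dim0 m n (i : 'M[k]_(m, n)) (p : 'M_(n, m)) : i *m p = 1%:M -> i = 0 -> m = 0%N.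
  move=> ip i0; rewrite i0 mul0mx in ip.
  by have /eqP := mxrank1 k m; rewrite -ip mxrank0 eq_sym => /eqP.
have [||E|E] := H (p1 *m i1); first exact: homM hp1 hi1.
- by rewrite mulmxA -(mulmxA p1) e1 mulmx1.
- left; apply: (dim0 _ _ i1 p1) => //.
  by rewrite -[i1]mul1mx -e1 -mulmxA E mulmx0.
- right; apply: (dim0 _ _ i2 p2) => //.
  by rewrite -[i2]mulmx1 -E mulmxA e21 mul0mx.
Qed.

Lemma homX X (f : 'M_(cdim X)) n : hom X X f -> hom X X (f ^+ n).
Proof.
move=> hf; elim: n => [|n IH]; first exact: hom1.
by rewrite exprS; apply: homM.
Qed.

(** The exponent is doubled until the rank stops dropping. The condition [0 < m] excludes the
    trivial zeroth power and lets invertibility pass from [f ^+ m] to [f]. *)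
Lemma eventual_rank n (f : 'M[k]_n) : exists2 m : nat, (0 < m)%N & \rank (f ^+ m *m f ^+ m) = \rank (f ^+ m).
Proof.
suff H r : forall m, (0 < m)%N -> (\rank (f ^+ m) <= r)%N ->
    exists2 m, (0 < m)%N & \rank (f ^+ m *m f ^+ m) = \rank (f ^+ m).
  exact: (H _ 1%N isT (leqnn _)).
elim: r => [|r IH] m pos le.
  exists m => //; apply/eqP; rewrite eqn_leq mxrankM_maxl /=.
  exact: leq_trans le (leq0n _).
have [lt|ge] := ltnP (\rank (f ^+ m *m f ^+ m)) (\rank (f ^+ m)).
  apply: (IH (m + m)%N); first by lia.
  by rewrite exprD -ltnS; apply: leq_trans lt le.
by exists m => //; apply/eqP; rewrite eqn_leq mxrankM_maxl.
Qed.

(* Fitting: if [f] and [f^2] have the same rank then the image of [f] is a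
   direct summand, since [f] restricts to an automorphism of it. *)
Lemma indec_local X (f : 'M_(cdim X)) : indecomposable X -> hom X X f ->
  (exists n : nat, f ^+ n = 0) \/ f \in unitmx.
Proof.
move=> indX hf; have [m pos E] := eventual_rank f.
have hg := homX m hf; set g := f ^+ m in E hg.
have [S [p [j [hp fp hj fj pj]]]] := im_ex hg.
have hq := homM hj hp; set q := j *m p in hq.
have uq : q \in unitmx.
  rewrite -row_free_unit /row_free -(eqmxMfull _ fp) -(mxrankMfree _ fj).
  by rewrite /q -!mulmxA pj mulmxA pj E -pj eqmxMfull // -/(row_free j).
have [h [hh [qh hq1]]] := (unit_iso hq uq).2.
have [||E0|E1] := indec_idem indX (e := p *m h *m j).
- exact: homM (homM hp hh) hj.
- by rewrite !mulmxA -(mulmxA (p *m h)) -/q -(mulmxA p) hq1 mulmx1.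
- left; exists m; rewrite -/g -pj.
  have h0 : h = 0.
    by apply: (row_full_inj fp); apply: (row_free_inj fj); rewrite E0 mulmx0 mul0mx.
  by rewrite -[p]mulmx1 -hq1 h0 mul0mx mulmx0 mul0mx.
right; rewrite -row_free_unit.
have fg : row_free g.
  rewrite -pj free_comp //; apply/row_freeP; exists (h *m j); by rewrite mulmxA.
by move: fg; rewrite /g -(prednK pos) exprS -mulmxE => /free_compl.
Qed.

(** On a vector killed by [1 + f] the map [f] acts as [-1], so [f ^+ n] acts by a sign and the
    vector is zero. *)
Lemma indec_addnil X (f : 'M[k]_(cdim X)) n : indecomposable X -> hom X X f -> f ^+ n = 0 ->
  1%:M + f \in unitmx.
Proof.
move=> indX hf fn; rewrite -row_free_unit; apply: row_freeV0 => v.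
rewrite mulmxDr mulmx1 => /eqP; rewrite addr_eq0 => /eqP E.
have : v *m f ^+ n = (-1) ^+ n *: v.
  elim: {fn} n => [|n IH]; first by rewrite !expr0 mulmx1 scale1r.
  rewrite exprS -mulmxE mulmxA -[v *m f]opprK -E mulNmx IH exprS.
  by rewrite mulN1r scaleNr.
rewrite fn mulmx0 => /esym/eqP; rewrite scaler_eq0 signr_eq0 /=.
by move/eqP.
Qed.

Lemma indec_iso X Y : iso X Y -> indecomposable X -> indecomposable Y.
Proof.
move=> i [pos H]; split; first by rewrite -(iso_dim i).
move=> X1 X2 B; apply: H.
by apply: (biprod_iso _ _ _ B); [exact: iso_sym | exact: iso_refl | exact: iso_refl].
Qed.

Lemma indec_dual X : indecomposable X -> indecomposable (dual X).
Proof.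
move=> [pos H]; split=> // X1 X2 /biprod_dual B; apply: (H (dual X1) (dual X2)).
apply: (biprod_iso _ _ _ B); [exact: iso_dualK | exact: iso_refl | exact: iso_refl].
Qed.

(** * Projective and injective comodules *)

Lemma proj_dual X : projective X -> injective (dual X).
Proof.
move=> H Y Z f u hf ff hu.
have [|||h [hh E]] := H (dual Z) (dual Y) f^T u^T.
- exact: hom_tr.
- by rewrite tr_full.
- exact: hom_trr.
exists h^T; split; first exact: hom_trr.
by apply: trmx_inj; rewrite trmx_mul trmxK.
Qed.

Lemma inj_dual X : injective X -> projective (dual X).
Proof.
move=> H Y Z g f hg fg hf.
have [|||h [hh E]] := H (dual Z) (dual Y) g^T f^T.
- exact: hom_tr.
- by rewrite tr_free.
- exact: hom_trl.
exists h^T; split; first exact: hom_trl.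
by apply: trmx_inj; rewrite trmx_mul trmxK.
Qed.

Lemma proj_retract P X (i : 'M_(cdim X, cdim P)) (p : 'M_(cdim P, cdim X)) :
  projective P -> hom X P i -> hom P X p -> i *m p = 1%:M -> projective X.
Proof.
move=> pP hi hp ip Y Z g f hg fg hf.
have [h [hh E]] := pP Y Z g (p *m f) hg fg (homM hp hf).
exists (i *m h); split; first exact: homM hi hh.
by rewrite -mulmxA E mulmxA ip mul1mx.
Qed.

Lemma inj_retract P X (i : 'M_(cdim X, cdim P)) (p : 'M_(cdim P, cdim X)) :
  injective P -> hom X P i -> hom P X p -> i *m p = 1%:M -> injective X.
Proof.
move=> pP hi hp ip Y Z f u hf ff hu.
have [h [hh E]] := pP Y Z f (u *m i) hf ff (homM hu hi).
exists (h *m p); split; first exact: homM hh hp.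
by rewrite mulmxA E -mulmxA ip mulmx1.
Qed.

Lemma proj_iso X Y : iso X Y -> projective X -> projective Y.
Proof.
move=> [f [hf [g [hg [_ gf]]]]] pX; exact: (proj_retract pX hg hf gf).
Qed.

Lemma inj_iso X Y : iso X Y -> injective X -> injective Y.
Proof.
move=> [f [hf [g [hg [_ gf]]]]] pX; exact: (inj_retract pX hg hf gf).
Qed.

Lemma proj_sum P P1 P2 : biprod2 P P1 P2 -> projective P1 -> projective P2 -> projective P.
Proof.
move=> [i1 [i2 [p1 [p2 [[hi1 hi2 hp1 hp2] [_ _ _ _ e]]]]]] H1 H2 Y Z g f hg fg hf.
have [h1 [hh1 E1]] := H1 Y Z g (i1 *m f) hg fg (homM hi1 hf).
have [h2 [hh2 E2]] := H2 Y Z g (i2 *m f) hg fg (homM hi2 hf).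
exists (p1 *m h1 + p2 *m h2); split; first exact: homD (homM hp1 hh1) (homM hp2 hh2).
by rewrite mulmxDl -!mulmxA E1 E2 !mulmxA -mulmxDl e mul1mx.
Qed.

Lemma inj_sum P P1 P2 : biprod2 P P1 P2 -> injective P1 -> injective P2 -> injective P.
Proof.
move=> [i1 [i2 [p1 [p2 [[hi1 hi2 hp1 hp2] [_ _ _ _ e]]]]]] H1 H2 Y Z f u hf ff hu.
have [h1 [hh1 E1]] := H1 Y Z f (u *m p1) hf ff (homM hu hp1).
have [h2 [hh2 E2]] := H2 Y Z f (u *m p2) hf ff (homM hu hp2).
exists (h1 *m i1 + h2 *m i2); split; first exact: homD (homM hh1 hi1) (homM hh2 hi2).
by rewrite mulmxDr !mulmxA E1 E2 -!mulmxA -mulmxDr e mulmx1.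
Qed.

Lemma inj0 X : cdim X = 0%N -> injective X.
Proof.
move=> z Y Z f u _ _ _; exists 0; split; first exact: hom0.
by apply/matrixP => i [j lt]; exfalso; move: lt; rewrite z.
Qed.

End Fitting.

(** * The indecomposable injectives and the simples *)

Lemma Bbasis_eqE (c c' : Bbasis) : (c == c') =
  match c, c' with
  | G i, G j | A i, A j | Bb i, Bb j | D i, D j => i == j
  | _, _ => false end.
Proof.
apply/eqP/idP; first by move=> ->; case: c' => i /=.
by case: c; case: c' => //= i j /eqP ->.
Qed.

Definition rsrc (c : Bbasis) : nat :=
  match c with G i | A i | D i => i | Bb i => i.+1 end.

Lemma comul_G c i : comul_pair c (G i) = if i == rsrc c then Some c else None.
Proof. by case: c => j //=; case: (i =P j) => [->|ne] //; rewrite ?eqxx //; case: eqP => // E; subst. Qed.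

Lemma comul_assoc x y z :
  obind (fun xy => comul_pair xy z) (comul_pair x y) =
  obind (fun yz => comul_pair x yz) (comul_pair y z).
Proof.
case: x y z => x [] y [] z //=; repeat (case: eqP => //= ?; subst);
  rewrite ?eqxx //=; repeat (case: eqP => //= ?; subst); try congruence; try lia.
Qed.

Lemma Ibasis_uniq n : uniq (Ibasis n).
Proof. by case: n => [|n] //=; rewrite !inE !Bbasis_eqE. Qed.

Lemma mem_Ibasis n c : (c \in Ibasis n) = (comul_pair (G n) c == Some c).
Proof.
have E (b : bool) : ((if b then Some c else None) == Some c) = b by case: b; rewrite ?eqxx.
by case: n => [|n]; case: c E => i E; rewrite /= !inE !Bbasis_eqE ?E //= ?orbF ?orFb; lia.
Qed.

Definition tgt (c : Bbasis) : nat :=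
  match c with G i | Bb i | D i => i | A i => i.+1 end.

Lemma comul_Gl i c : comul_pair (G i) c = if i == tgt c then Some c else None.
Proof. by case: c => j //=; case: (i =P j) => [->|]. Qed.

(** [I_n] is spanned by the basis elements ending at [n]; membership in its basis thus becomes a
    condition on targets, uniform in [n]. *)
Lemma mem_Ibasis_tgt n c : (c \in Ibasis n) = (n == tgt c).
Proof. by rewrite mem_Ibasis comul_Gl; case: ifP; rewrite ?eqxx. Qed.

Lemma comul_tgt x y z : comul_pair x y = Some z -> tgt z = tgt x.
Proof. by case: x y => i [] j //=; case: eqP => // E [<-] //=; rewrite ?E. Qed.

(* [codual] pairs the left factors of [d_n] with its right factors. *)
Definition codual (c : Bbasis) : Bbasis :=
  match c with G i => D i | D i => G i | A i => Bb i | Bb i => A i end.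

Lemma dlK : involutive codual. Proof. by case. Qed.

Lemma rsrc_codual c : rsrc (codual c) = tgt c. Proof. by case: c. Qed.

(** Both sides say that the product of [e], [c] and [codual x] is [D] at the common target: [y]
    times [z] is [D (tgt y)] exactly when [z] is [codual y]. *)
Lemma comul_codual e c x : tgt e = tgt x ->
  (comul_pair e c == Some x) = (comul_pair c (codual x) == Some (codual e)).
Proof.
have E (b : bool) (y z : Bbasis) : ((if b then Some y else None) == Some z) = b && (y == z).
  by case: b.
case: e c x => i [] j [] l //=; rewrite ?E ?Bbasis_eqE ?andbF //=; lia.
Qed.

Section Inj.
Variable k : fieldType.

Section Ibas.
Variable n : nat.
Notation L := (Ibasis n).
(** [icol e] is the coordinate functional at [e] and [irow e] the basis vector [e]. They are indexed
    by basis elements instead of positions, and vanish when [e] is not in [L]. *)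
Definition icol e : 'cV[k]_(size L) := \col_j (nth (G 0) L j == e)%:R.
Definition irow e : 'rV[k]_(size L) := \row_j (nth (G 0) L j == e)%:R.
Definition ocol (o : option Bbasis) := if o is Some e then icol e else 0.

Lemma icol0 e : n != tgt e -> icol e = 0.
Proof.
rewrite -mem_Ibasis_tgt => ne; apply/matrixP => j i; rewrite !mxE.
by case: eqP => // E; rewrite -E mem_nth in ne.
Qed.

Lemma nth_Ibasis_neq x (lt : (index x L < size L)%N) (l : 'I_(size L)) :
  l != Ordinal lt -> (nth (G 0) L l == x) = false.
Proof.
move=> nl; apply/eqP => El; case/eqP: nl; apply: val_inj => /=.
by rewrite -El index_uniq ?Ibasis_uniq.
Qed.

Lemma irow_col x y : irow x *m icol y = ((x == y) && (n == tgt x))%:R%:M.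
Proof.
apply/matrixP => i0 j0; rewrite !ord1 !mxE eqxx mulr1n.
have [E|ne] := eqVneq n (tgt x); last first.
  rewrite andbF big1 // => j _; rewrite !mxE.
  case: eqP => [E|]; rewrite ?mul0r //.
  by move: ne; rewrite -mem_Ibasis_tgt -E mem_nth.
have mx : x \in L by rewrite mem_Ibasis_tgt E.
have lt : (index x L < size L)%N by rewrite index_mem.
rewrite andbT (bigD1 (Ordinal lt)) //= !mxE /= nth_index // eqxx mul1r.
by rewrite big1 ?addr0 // => j nj; rewrite !mxE nth_Ibasis_neq // mul0r.
Qed.

Lemma icol_ext m (M M' : 'M[k]_(m, size L)) :
  (forall x, M *m icol x = M' *m icol x) -> M = M'.
Proof.
have E (N : 'M[k]_(m, size L)) i (j : 'I_(size L)) : N i j = (N *m icol (nth (G 0) L j)) i 0.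
  rewrite mxE (bigD1 j) //= mxE eqxx mulr1 big1 ?addr0 // => l nl.
  by rewrite mxE nth_uniq ?Ibasis_uniq // (inj_eq val_inj) (negPf nl) mulr0.
by move=> H; apply/matrixP => i j; rewrite !E H.
Qed.

Lemma irow_ext m (M M' : 'M[k]_(size L, m)) :
  (forall x, n = tgt x -> irow x *m M = irow x *m M') -> M = M'.
Proof.
have E (N : 'M[k]_(size L, m)) (i : 'I_(size L)) j : N i j = (irow (nth (G 0) L i) *m N) 0 j.
  rewrite mxE (bigD1 i) //= mxE eqxx mul1r big1 ?addr0 // => l nl.
  by rewrite mxE nth_uniq ?Ibasis_uniq // (inj_eq val_inj) (negPf nl) mul0r.
move=> H; apply/matrixP => i j; rewrite !E H //.
by apply/eqP; rewrite -mem_Ibasis_tgt mem_nth.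
Qed.

Lemma regmat_col c e : regmat k L c *m icol e = ocol (comul_pair e c).
Proof.
have [E|ne] := eqVneq n (tgt e); last first.
  rewrite icol0 // mulmx0; case F : comul_pair => [z|] //=.
  by rewrite icol0 // (comul_tgt F).
have me : e \in L by rewrite mem_Ibasis_tgt E.
have lt : (index e L < size L)%N by rewrite index_mem.
apply/matrixP => i j; rewrite ord1 mxE (bigD1 (Ordinal lt)) //= !mxE /= nth_index // eqxx mulr1.
rewrite big1 ?addr0 => [|l nl]; last by rewrite !mxE nth_Ibasis_neq // mulr0.
by case: comul_pair => [z|]; rewrite !mxE // (inj_eq (@Some_inj _)) eq_sym; case: eqP.
Qed.

(** A basis element ending at [n] starts at [n+1] at the furthest, so its right factors have index
    at most [n+1]. *)
Lemma Inj_fin c : (n.+2 <= bidx c)%N -> regmat k L c = 0.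
Proof.
move=> le; apply: icol_ext => x; rewrite regmat_col mul0mx.
case E : comul_pair => [z|] //=; apply: icol0; apply/eqP => nz.
by case: x c E le => i [] j //=; case: eqP => // ? [?]; subst z; rewrite /= in nz; lia.
Qed.

Lemma Inj_counit : \sum_(i < n.+2) regmat k L (G i) = 1%:M.
Proof.
apply: icol_ext => x; rewrite mul1mx mulmx_suml.
under eq_bigr do rewrite regmat_col comul_G.
have [E|ne] := eqVneq n (tgt x); last first.
  by rewrite icol0 // big1 // => i _; case: ifP => //= _; rewrite icol0.
have lt : (rsrc x < n.+2)%N by rewrite E; case: (x) => i /=; lia.
rewrite (bigD1 (Ordinal lt)) //= eqxx big1 ?addr0 // => i ni.
by case: eqP => // Ei; case/eqP: ni; apply: val_inj.
Qed.

Lemma Inj_coassoc c c' :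
  regmat k L c *m regmat k L c' =
  match comul_pair c' c with Some e => regmat k L e | None => 0 end.
Proof.
apply: icol_ext => x; rewrite -mulmxA regmat_col.
have := comul_assoc x c' c; case: (comul_pair x c') => [y|] /=.
  by rewrite regmat_col => ->; case: comul_pair => [z|] /=; rewrite ?mul0mx // regmat_col.
by rewrite mulmx0; case: comul_pair => [z|] /=; rewrite ?mul0mx // regmat_col => <-.
Qed.

Definition Inj : comod k := Comod Inj_fin Inj_counit Inj_coassoc.

Lemma Inj_cogen (U : comod k) (f g : 'M_(cdim U, cdim Inj)) :
  hom U Inj f -> hom U Inj g -> f *m icol (G n) = g *m icol (G n) -> f = g.
Proof.
move=> hf hg E; apply: icol_ext => x.
have [nx|ne] := eqVneq n (tgt x); last by rewrite icol0 // !mulmx0.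
have -> : icol x = coact Inj x *m icol (G n) by rewrite regmat_col comul_Gl [_ == _](introT eqP nx).
by rewrite !mulmxA -hf -hg -!mulmxA E.
Qed.

(** The cofree property: with [Inj_cogen], maps from [U] to [I_n] are the functionals on the part of
    [U] at [n]. The coordinate at [x] has to be the action of [x] followed by [xi]. *)
Lemma hom_into (U : comod k) (xi : 'cV_(cdim U)) : coact U (G n) *m xi = xi ->
  exists2 t : 'M_(cdim U, cdim Inj), hom U Inj t & t *m icol (G n) = xi.
Proof.
move=> Gxi; pose t : 'M_(cdim U, size L) := \matrix_(i, j) (coact U (nth (G 0) L j) *m xi) i 0.
have tcol x : t *m icol x = coact U x *m xi.
  have [E|ne] := eqVneq n (tgt x); last first.
    by rewrite icol0 // mulmx0 -Gxi mulmxA coact_coassoc comul_Gl (negPf ne) mul0mx.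
  have mx : x \in L by rewrite mem_Ibasis_tgt E.
  have lt : (index x L < size L)%N by rewrite index_mem.
  apply/matrixP => i j; rewrite ord1 mxE (bigD1 (Ordinal lt)) //=.
  rewrite big1 => [|l nl]; last by rewrite [icol x _ _]mxE nth_Ibasis_neq // mulr0.
  by rewrite addr0 [icol x _ _]mxE [t _ _]mxE /= nth_index // eqxx mulr1.
exists t; last by rewrite tcol.
move=> c; apply: icol_ext => x; rewrite -!mulmxA tcol regmat_col mulmxA coact_coassoc.
by case: comul_pair => [z|]; rewrite /= ?tcol // mulmx0 mul0mx.
Qed.

(** The free property: the action of [codual e] takes the generator [D n] to [e], which forces the
    value at [e]. That these values define a homomorphism is the identity [comul_codual]. *)
Lemma hom_from (M : comod k) (m : 'rV_(cdim M)) : m *m coact M (G n) = m ->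
  exists2 f : 'M_(cdim Inj, cdim M), hom Inj M f & irow (D n) *m f = m.
Proof.
move=> mG; pose f : 'M_(size L, cdim M) := \sum_(e <- L) icol e *m (m *m coact M (codual e)).
have rowf x : n = tgt x -> irow x *m f = m *m coact M (codual x).
  move=> nx; have mx : x \in L by rewrite mem_Ibasis_tgt nx.
  rewrite mulmx_sumr (bigD1_seq x) ?Ibasis_uniq //= mulmxA irow_col eqxx -nx eqxx mul1mx.
  rewrite big1 ?addr0 // => y ny; rewrite mulmxA irow_col eq_sym (negPf ny).
  by rewrite mul_scalar_mx scale0r.
exists f; last by rewrite rowf //=.
move=> c; apply: irow_ext => x nx; rewrite [in RHS]mulmxA rowf // -mulmxA coact_coassoc.
rewrite mulmx_sumr mulmx_sumr big_seq.
under eq_bigr => e me.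
  rewrite (mulmxA _ (icol e)) regmat_col (mulmxA (irow x)).
  have -> : irow x *m ocol (comul_pair e c) = (comul_pair c (codual x) == Some (codual e))%:R%:M.
    rewrite -comul_codual; last by apply/eqP; rewrite -nx eq_sym -mem_Ibasis_tgt.
    case: comul_pair => [z|] /=; last by rewrite mulmx0; apply/matrixP => i j; rewrite !mxE mul0rn.
    by rewrite irow_col nx eqxx andbT (inj_eq (@Some_inj _)) eq_sym.
  rewrite mul_scalar_mx; over.
rewrite -big_seq; case E : comul_pair => [z|]; last by rewrite big1 ?mulmx0 // => e _; rewrite scale0r.
(* If [codual z] does not end at [n], then [z] does not start at [n] and kills [m], while no [e] of
   the basis contributes to the sum. *)
have [nz|ne] := eqVneq n (tgt (codual z)).
  rewrite (bigD1_seq (codual z)) ?Ibasis_uniq ?mem_Ibasis_tgt ?nz //= dlK eqxx scale1r.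
  rewrite big1 ?addr0 // => e ne; rewrite (inj_eq (@Some_inj _)).
  by case: eqP => [ze|]; rewrite ?scale0r //; rewrite ze dlK eqxx in ne.
rewrite big_seq big1 => [|e me].
  by rewrite -mG -mulmxA coact_coassoc comul_G -(dlK z) rsrc_codual (negPf ne) mulmx0.
rewrite (inj_eq (@Some_inj _)); case: eqP => [ze|]; rewrite ?scale0r //.
by rewrite ze dlK -mem_Ibasis_tgt me in ne.
Qed.

Lemma injI : injective Inj.
Proof.
move=> X Y f u hf ff hu; have /row_freeP[g fg] := ff.
have GI : coact Inj (G n) *m icol (G n) = icol (G n) by rewrite regmat_col /= eqxx.
(* The functional that determines [u] is extended linearly by means of [g] and then cut down to the
   vertex [n]. *)
have [|h hh E] := @hom_into Y (coact Y (G n) *m (g *m (u *m icol (G n)))).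
  by rewrite mulmxA coactGG.
exists h; split=> //; apply: Inj_cogen => //; first exact: homM hf hh.
rewrite -mulmxA E !mulmxA -hf -!(mulmxA (coact X _)) -!mulmxA (mulmxA f) fg mul1mx.
by rewrite mulmxA hu -mulmxA GI.
Qed.

Lemma irow_D x : n = tgt x -> irow (D n) *m coact Inj (codual x) = irow x.
Proof.
move=> nx; apply: icol_ext => y; rewrite -mulmxA regmat_col irow_col -nx eqxx andbT.
have [ny|ne] := eqVneq n (tgt y); last first.
  case: eqP => [xy|_]; first by rewrite -xy nx eqxx in ne.
  rewrite raddf0.
  case F : comul_pair => [z|] /=; last by rewrite mulmx0.
  by rewrite icol0 ?(comul_tgt F) // mulmx0.
have -> : (x == y) = (comul_pair y (codual x) == Some (D n)).
  rewrite comul_codual -?ny // comul_G rsrc_codual -nx eqxx.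
  by rewrite (inj_eq (@Some_inj _)) (inj_eq (can_inj dlK)).
case: comul_pair => [z|] /=; last by rewrite mulmx0 raddf0.
by rewrite irow_col /= eqxx andbT (inj_eq (@Some_inj _)) eq_sym.
Qed.

Lemma Inj_gen (M : comod k) (f g : 'M_(cdim Inj, cdim M)) :
  hom Inj M f -> hom Inj M g -> irow (D n) *m f = irow (D n) *m g -> f = g.
Proof.
move=> hf hg E; apply: irow_ext => x nx.
by rewrite -irow_D // -!mulmxA hf hg !mulmxA E.
Qed.

Lemma projI : projective Inj.
Proof.
move=> Y Z g f hg fg hf; have /row_fullP[g' gg] := fg.
have [|h hh E] := @hom_from Y (irow (D n) *m f *m g' *m coact Y (G n)).
  by rewrite -mulmxA coactGG.
exists h; split=> //; apply: Inj_gen => //; first exact: homM hh hg.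
rewrite mulmxA E -mulmxA hg mulmxA -(mulmxA _ g') gg mulmx1 -mulmxA -hf mulmxA.
by rewrite (@irow_D (D n)).
Qed.

End Ibas.
End Inj.

Section Simple.
Variables (k : fieldType) (n : nat).
Let N c : 'M[k]_1 := (c == G n)%:R%:M.

Lemma simp_fin c : (n.+1 <= bidx c)%N -> N c = 0.
Proof.
move=> le; rewrite /N Bbasis_eqE (_ : (match c with G i => i == n | _ => false end) = false) ?raddf0 //.
by case: c le => //= i le; apply/eqP; lia.
Qed.

Lemma simp_counit : \sum_(i < n.+1) N (G i) = 1%:M.
Proof.
rewrite big_ord_recr /= big1 ?add0r => [|i _]; first by rewrite /N eqxx.
by rewrite /N Bbasis_eqE ltn_eqF // raddf0.
Qed.

Lemma simp_coassoc c c' : N c *m N c' = match comul_pair c' c with Some e => N e | None => 0 end.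
Proof.
rewrite /N -scalar_mxM -natrM mulnb.
case: c c' => i [] j /=; rewrite ?Bbasis_eqE ?andbF ?raddf0 //;
  repeat (case: eqP => //= ?); subst; rewrite ?Bbasis_eqE ?raddf0 ?eqxx //; congruence.
Qed.

Definition simp : comod k := Comod simp_fin simp_counit simp_coassoc.
End Simple.

(** * Socles, and comodules killed by the [D n] *)

Definition Dfree (k : fieldType) (X : comod k) := forall n, coact X (D n) = 0.

(** The [S(n)]-part of the socle. There is no clause for [D i], which acts as [A i] followed by
    [Bb i]. *)
Definition soc (k : fieldType) (X : comod k) n (v : 'rV_(cdim X)) :=
  [/\ v *m coact X (G n) = v, forall i, v *m coact X (A i) = 0 & forall i, v *m coact X (Bb i) = 0].

Section Socle.
Variable k : fieldType.
Implicit Types X Y Z U V W P Q E M : comod k.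

Lemma coact_src X c : coact X (G (rsrc c)) *m coact X c = coact X c.
Proof. by rewrite coact_coassoc comul_G eqxx. Qed.

Lemma coact_tgt X c : coact X c *m coact X (G (tgt c)) = coact X c.
Proof. by rewrite coact_coassoc comul_Gl eqxx. Qed.

Lemma coact_srcN X c n : n != rsrc c -> coact X (G n) *m coact X c = 0.
Proof. by move=> ne; rewrite coact_coassoc comul_G (negPf ne). Qed.

Lemma coact_tgtN X c n : n != tgt c -> coact X c *m coact X (G n) = 0.
Proof. by move=> ne; rewrite coact_coassoc comul_Gl (negPf ne). Qed.

Lemma coactD X n : coact X (D n) = coact X (A n) *m coact X (Bb n).
Proof. by rewrite coact_coassoc /= eqxx. Qed.

Lemma soc_coact X n v : @soc k X n v -> forall c, v *m coact X c = (c == G n)%:R *: v.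
Proof.
move=> [vG vA vB] c; rewrite Bbasis_eqE; case: c => i; rewrite ?vA ?vB ?scale0r //.
  have [->|ne] := eqVneq i n; first by rewrite vG scale1r.
  by rewrite -vG -mulmxA coact_tgtN // mulmx0 scale0r.
by rewrite coactD mulmxA vA mul0mx.
Qed.

Lemma soc_simp X n v : @soc k X n v -> hom (simp k n) X v.
Proof. by move=> s c; rewrite (soc_coact s) /= mul_scalar_mx. Qed.

Lemma hom_soc X Y (f : 'M_(cdim X, cdim Y)) n v : hom X Y f -> @soc k X n v -> @soc k Y n (v *m f).
Proof.
move=> hf [vG vA vB]; split; first by rewrite -mulmxA -hf mulmxA vG.
- by move=> i; rewrite -mulmxA -hf mulmxA vA mul0mx.
- by move=> i; rewrite -mulmxA -hf mulmxA vB mul0mx.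
Qed.

Lemma hom_soc_free X Y (f : 'M_(cdim X, cdim Y)) n v :
  hom X Y f -> row_free f -> @soc k Y n (v *m f) -> @soc k X n v.
Proof.
move=> hf ff [vG vA vB]; split.
- by apply: (row_free_inj ff); rewrite -mulmxA hf mulmxA vG.
- by move=> i; apply: (row_free_inj ff); rewrite -mulmxA hf mulmxA vA mul0mx.
- by move=> i; apply: (row_free_inj ff); rewrite -mulmxA hf mulmxA vB mul0mx.
Qed.

Lemma homog_ex X m (x : 'M_(m, cdim X)) : x != 0 -> exists n, x *m coact X (G n) != 0.
Proof.
move=> nz; have [/existsP[i Hi]|] := boolP [exists i : 'I_(cbound X), x *m coact X (G i) != 0].
  by exists i.
rewrite negb_exists => /forallP H; case/eqP: nz.
rewrite -[x]mulmx1 -(coact_counit X) mulmx_sumr big1 // => i _.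
by apply/eqP; have := H i; rewrite negbK.
Qed.

Definition arrow c := match c with A _ | Bb _ => true | _ => false end.

Lemma comul_arrow c c' d : arrow c -> arrow c' -> comul_pair c c' = Some d -> d = D (tgt d).
Proof. by case: c c' => i [] j //= _ _; case: eqP => // _ [<-]. Qed.

Lemma comul_arrowD c i : arrow c -> comul_pair c (D i) = None.
Proof. by case: c. Qed.

Lemma not_soc X n y : y *m coact X (G n) = y -> soc n y \/ exists2 c, arrow c & y *m coact X c != 0.
Proof.
move=> yG; have [A0|nA] := eqVneq (y *m coact X (A n)) 0; last by right; exists (A n).
have [B0|nB] := eqVneq (if n is m.+1 then y *m coact X (Bb m) else 0) 0; last first.
  by case: n nB {yG A0} => [|m nB]; [rewrite eqxx | right; exists (Bb m)].
left; split=> // i.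
  by have [->//|ne] := eqVneq i n; rewrite -yG -mulmxA coact_srcN 1?eq_sym // mulmx0.
have [ni|ne] := eqVneq n i.+1; first by move: B0; rewrite ni.
by rewrite -yG -mulmxA coact_srcN // mulmx0.
Qed.

(** Arrows are applied to a homogeneous vector as long as the result is nonzero; three arrows in a
    row act as zero, so this ends after two of them. *)
Lemma soc_ex X m (U : 'M_(m, cdim X)) : (forall c, (U *m coact X c <= U)%MS) -> U != 0 ->
  exists n (v : 'rV_(cdim X)), [/\ v != 0, (v <= U)%MS & soc n v].
Proof.
move=> inv /neq0_row[x xU]; have [n nz] := homog_ex xU.
have step c (y : 'rV_(cdim X)) : (y <= U)%MS -> (y *m coact X c <= U)%MS.
  by move=> yU; apply: submx_trans (submxMr _ yU) (inv c).
pose y := x *m U *m coact X (G n).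
have yU : (y <= U)%MS := step (G n) _ (submxMl x U).
have yG : y *m coact X (G n) = y by rewrite -mulmxA coactGG.
have [s|[c ac zc]] := not_soc yG; first by exists n, y.
have zG : y *m coact X c *m coact X (G (tgt c)) = y *m coact X c by rewrite -mulmxA coact_tgt.
have [s|[c' ac' wc]] := not_soc zG.
  by exists (tgt c), (y *m coact X c); split=> //; apply: step.
have tw : y *m coact X c *m coact X c' *m coact X (G (tgt c')) = y *m coact X c *m coact X c'.
  by rewrite -mulmxA coact_tgt.
exists (tgt c'), (y *m coact X c *m coact X c'); split=> //; first by apply: (step c'); apply: step.
have [s|[d ad]] := not_soc tw; first by [].
rewrite -(mulmxA y) coact_coassoc; case E : comul_pair => [e|]; last by rewrite mulmx0 mul0mx eqxx.
by rewrite (comul_arrow ac' ac E) -mulmxA coact_coassoc comul_arrowD // mulmx0 eqxx.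
Qed.

Lemma ker_inv X Y (f : 'M_(cdim X, cdim Y)) : hom X Y f ->
  forall c, (kermx f *m coact X c <= kermx f)%MS.
Proof. by move=> hf c; apply/sub_kermxP; rewrite -mulmxA hf mulmxA mulmx_ker mul0mx. Qed.

Lemma free_soc X Y (f : 'M_(cdim X, cdim Y)) : hom X Y f ->
  (forall n v, soc n v -> v *m f = 0 -> v = 0) -> row_free f.
Proof.
move=> hf H; rewrite -kermx_eq0; apply/negPn/negP => nz.
have [n [v [nv /sub_kermxP vK s]]] := soc_ex (ker_inv hf) nz.
by case/eqP: nv; apply: H s vK.
Qed.

Lemma irow_G n : irow k n (D n) *m coact (Inj k n) (D n) = irow k n (G n).
Proof. by rewrite (@irow_D k n (G n)). Qed.

Lemma irow_Gcol n : irow k n (G n) *m icol k n (G n) = 1%:M.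
Proof. by rewrite irow_col !eqxx. Qed.

Lemma irow_neq0 n : irow k n (G n) != 0.
Proof.
apply/eqP => E; have := irow_Gcol n; rewrite E mul0mx => /matrixP/(_ 0 0).
by rewrite !mxE => /esym/eqP; rewrite oner_eq0.
Qed.

Lemma soc_D X (x : 'rV_(cdim X)) n : soc n (x *m coact X (D n)).
Proof.
split; first by rewrite -mulmxA coact_tgt.
- by move=> i; rewrite -mulmxA coact_coassoc mulmx0.
- by move=> i; rewrite -mulmxA coact_coassoc mulmx0.
Qed.

Lemma soc_irow n : @soc k (Inj k n) n (irow k n (G n)).
Proof. by rewrite -irow_G; apply: soc_D. Qed.

Lemma irow_hom n : hom (simp k n) (Inj k n) (irow k n (G n)).
Proof. exact: soc_simp (soc_irow n). Qed.

Lemma irow_free n : row_free (irow k n (G n)).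
Proof. by apply/row_freeP; exists (icol k n (G n)); apply: irow_Gcol. Qed.

Lemma soc_Inj n m v : @soc k (Inj k n) m v -> exists l : k, v = l *: irow k n (G n).
Proof.
move=> s; exists ((v *m icol k n (G n)) 0 0); apply: icol_ext => x.
have [nx|ne] := eqVneq n (tgt x); last by rewrite icol0 // !mulmx0.
rewrite -scalemxAl; have [->|ne] := eqVneq x (G n).
  by rewrite irow_Gcol scalemx1 -mx11_scalar.
rewrite irow_col eq_sym (negPf ne) raddf0 scaler0.
have -> : icol k n x = coact (Inj k n) x *m icol k n (G n).
  by rewrite regmat_col comul_Gl [_ == _](introT eqP nx).
rewrite mulmxA (soc_coact s) -scalemxAl; case: eqP => [E|_]; last by rewrite scale0r.
by case/eqP: ne; rewrite E; congr G; rewrite nx E.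
Qed.

(** The map from the simple comodule given by [v] extends to [I_n], where the socle is the image of
    the generator under [D n]. *)
Lemma soc_inj E n v : injective E -> @soc k E n v -> exists w : 'rV_(cdim E), v = w *m coact E (D n).
Proof.
move=> iE s; have [t [ht Et]] := iE _ _ _ _ (irow_hom n) (irow_free n) (soc_simp s).
exists (irow k n (D n) *m t); rewrite -mulmxA -ht mulmxA.
by rewrite irow_G Et.
Qed.

Lemma Dfree_inj0 X : injective X -> Dfree X -> cdim X = 0%N.
Proof.
move=> iX dX; have [/eqP|nz] := eqVneq (1%:M : 'M[k]_(cdim X)) 0.
  by rewrite -mxrank_eq0 mxrank1 => /eqP.
have [n [v [nv _ s]]] := @soc_ex X _ 1%:M (fun c => submx1 _) nz.
have [w Ew] := soc_inj iX s.
by rewrite Ew dX mulmx0 eqxx in nv.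
Qed.

(** The map from [I_n] that sends the generator to the part of [y] at [n] is nonzero on the simple
    socle, hence injective, and it splits because [I_n] is injective. *)
Lemma Inj_retract X n (y : 'rV_(cdim X)) : y *m coact X (D n) != 0 ->
  exists (f : 'M_(cdim (Inj k n), cdim X)) (r : 'M_(cdim X, cdim (Inj k n))),
    [/\ hom (Inj k n) X f, hom X (Inj k n) r, f *m r = 1%:M & irow k n (D n) *m f = y *m coact X (G n)].
Proof.
move=> nz; have [|f hf E] := @hom_from k n X (y *m coact X (G n)).
  by rewrite -mulmxA coactGG.
have ff : row_free f.
  apply: free_soc => // m v /soc_Inj[l ->]; rewrite -scalemxAl -irow_G.
  rewrite -mulmxA hf mulmxA E -(mulmxA y) (coact_src X (D n)) => /eqP.
  by rewrite scaler_eq0 (negPf nz) orbF => /eqP ->; rewrite scale0r.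
have [r [hr fr]] := injI hf ff (hom1 (Inj k n)).
by exists f, r.
Qed.

Lemma DfreeP X : Dfree X \/ exists n (y : 'rV_(cdim X)), y *m coact X (D n) != 0.
Proof.
have [/forallP H|] := boolP [forall i : 'I_(cbound X), coact X (D i) == 0].
  left=> n; have [lt|ge] := ltnP n (cbound X); last exact: coact_fin.
  exact: (eqP (H (Ordinal lt))).
rewrite negb_forall => /existsP[i /neq0_row[y ny]]; right; by exists i, y.
Qed.

Lemma indec_Dfree X : indecomposable X -> ~ injective X -> Dfree X.
Proof.
move=> indX nX; have [//|[n [y ny]]] := DfreeP X; case: nX.
have [f [r [hf hr fr Ef]]] := Inj_retract ny.
have [||E|E] := indec_idem indX (e := r *m f); first exact: homM hr hf.
- by rewrite mulmxA -(mulmxA r) fr mulmx1.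
- case/eqP: ny; have : irow k n (D n) *m f = 0.
    by rewrite -[f]mul1mx -fr -mulmxA E !mulmx0.
  rewrite Ef => y0; by rewrite -(coact_src X (D n)) mulmxA y0 mul0mx.
- exact: (inj_retract (@injI k n) hr hf E).
Qed.

Lemma Dfree_sub X Y (f : 'M_(cdim X, cdim Y)) : hom X Y f -> row_free f -> Dfree Y -> Dfree X.
Proof. by move=> hf ff dY n; apply: (free_eq0 ff); rewrite hf dY mulmx0. Qed.

Lemma Dfree_quot X Y (f : 'M_(cdim X, cdim Y)) : hom X Y f -> row_full f -> Dfree X -> Dfree Y.
Proof. by move=> hf ff dY n; apply: (full_eq0 ff); rewrite -hf dY mul0mx. Qed.

Lemma Dfree_iso X Y : iso X Y -> Dfree X -> Dfree Y.
Proof. by move=> [f If]; apply: (Dfree_quot If.1 (iso_full If)). Qed.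

Lemma Dfree_dual X : Dfree X -> Dfree (dual X).
Proof. by move=> dX n /=; rewrite dX trmx0. Qed.

Lemma Dfree_simp n : Dfree (simp k n).
Proof. by move=> i; rewrite [LHS]raddf0. Qed.

Lemma Dfree0 X : cdim X = 0%N -> Dfree X.
Proof. by move=> z n; apply/matrixP => -[i lt]; exfalso; move: lt; rewrite z. Qed.

Lemma Dfree_sum X X1 X2 : biprod2 X X1 X2 -> Dfree X1 -> Dfree X2 -> Dfree X.
Proof.
move=> [i1 [i2 [p1 [p2 [[hi1 hi2 hp1 hp2] [_ _ _ _ e]]]]]] d1 d2 n.
by rewrite -[LHS]mulmx1 -e mulmxDr !mulmxA hp1 hp2 d1 d2 !mulmx0 !mul0mx addr0.
Qed.

(** A vector outside the image of [p] has a homogeneous part outside it; adding a copy of [I_n] that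
    hits this part raises the rank. The sums obtained are injective as well as projective. *)
Lemma enough_proj M : exists P (p : 'M_(cdim P, cdim M)),
  [/\ projective P, injective P, hom P M p & row_full p].
Proof.
suff H r : exists P (p : 'M_(cdim P, cdim M)),
    [/\ projective P, injective P, hom P M p & (r <= \rank p)%N || row_full p].
  have [P [p [pP iP hp]]] := H (cdim M).+1.
  by rewrite ltnNge rank_leq_col /=; exists P, p.
elim: r => [|r [P [p [pP iP hp]]]].
  exists (zero_comod k), 0; split=> //; last exact: hom0; last exact: inj0.
  move=> Y Z g f _ _ _; exists 0; split; first exact: hom0.
  by apply/matrixP => -[].
have [fp _|nf] := boolP (row_full p); first by exists P, p; split=> //; rewrite fp orbT.
rewrite orbF => le.
have : ~~ (1%:M <= p)%MS by rewrite sub1mx.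
move=> /not_submx[v]; rewrite mulmx1 => nv.
have [n nvn] : exists n, ~~ (v *m coact M (G n) <= p)%MS.
  have [/existsP[i Hi]|] := boolP [exists i : 'I_(cbound M), ~~ (v *m coact M (G i) <= p)%MS].
    by exists i.
  rewrite negb_exists => /forallP H; case/negP: nv.
  rewrite -[v]mulmx1 -(coact_counit M) mulmx_sumr summx_sub // => i _.
  by have := H i; rewrite negbK.
have [|f hf Ef] := @hom_from k n M (v *m coact M (G n)); first by rewrite -mulmxA coactGG.
have [Q B] := dsum_ex P (Inj k n).
have [i1 [i2 [p1 [p2 [[hi1 hi2 hp1 hp2] [e11 e22 e12 e21 e]]]]]] := B.
exists Q, (p1 *m p + p2 *m f); split.
- exact: proj_sum B pP (@projI k n).
- exact: inj_sum B iP (@injI k n).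
- exact: homD (homM hp1 hp) (homM hp2 hf).
apply/orP; left; apply: leq_ltn_trans le _.
have E1 : i1 *m (p1 *m p + p2 *m f) = p.
  by rewrite mulmxDr !mulmxA e11 e12 mul1mx mul0mx addr0.
have E2 : irow k n (D n) *m i2 *m (p1 *m p + p2 *m f) = v *m coact M (G n).
  by rewrite -mulmxA mulmxDr !mulmxA e21 e22 mul0mx mul1mx add0r.
apply: rank_ltmx; rewrite ltmxE -{1}E1 submxMl /=.
apply: contra nvn => le; rewrite -E2; apply: submx_trans le; exact: submxMl.
Qed.

Lemma proj_inj P : projective P -> injective P.
Proof.
move=> pP; have [Q [q [_ iQ hq fq]]] := enough_proj P.
have [s [hs sq]] := pP _ _ q 1%:M hq fq (hom1 P).
exact: (inj_retract iQ hs hq sq).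
Qed.

Lemma inj_proj P : injective P -> projective P.
Proof.
move=> /inj_dual/proj_inj/inj_dual; apply: proj_iso; exact: iso_dualK.
Qed.

(** If some [D n] acts nontrivially on the kernel, a copy of [I_n] splits off from it; being
    injective it also splits off from [P], and its complement still covers [M]. The dimension bounds
    the number of removals. *)
Lemma cover_ex M : exists P (p : 'M_(cdim P, cdim M)),
  [/\ projective P, hom P M p, row_full p & forall n, kermx p *m coact P (D n) = 0].
Proof.
have [P [p [pP _ hp fp]]] := enough_proj M.
have [m] := ubnP (cdim P); elim: m P p pP hp fp => // m IH P p pP hp fp lt.
have [X [j exj]] := ses_ker_ex hp fp.
have [dX|[n [y ny]]] := DfreeP X.
  exists P, p; split=> // n; have [z ->] := ses_exact exj (mulmx_ker p).
  by rewrite -mulmxA -(ses_homl exj) dX mul0mx mulmx0.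
have [f [r [hf hr fr _]]] := Inj_retract ny.
have hj := ses_homl exj.
have [r' [hr' Er]] := injI hj (ses_free exj) hr.
pose e := r' *m (f *m j).
have he : hom P P e by exact: homM hr' (homM hf hj).
have ee : e *m e = e.
  by rewrite /e mulmxA -(mulmxA r') -(mulmxA f) Er fr mulmx1.
have ep : e *m p = 0 by rewrite /e -!mulmxA (ses_comp0 exj) !mulmx0.
have [X1 [X2 [i1 [i2 [p1 [p2 [hs es E1 E2]]]]]]] := idem_split he ee.
have [hi1 hi2 hp1 hp2] := hs; have [e1 e2 _ e21 ed] := es.
apply: (IH X2 (i2 *m p)).
- exact: (proj_retract pP hi2 hp2 e2).
- exact: homM hi2 hp.
- by apply: (@full_compr _ _ _ _ p2); rewrite mulmxA E2 mulmxBl ep subr0 mul1mx.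
(* The dimension really drops: otherwise [i2] is invertible, so [e] is zero, although [e] projects
   onto a copy of [I_n]. *)
rewrite -ltnS; apply: leq_trans lt; rewrite ltnS ltnNge; apply/negP => le.
have [_ [g [_ [_ gi]]]] : @is_iso k X2 P i2.
  by apply: dimle_iso => //; apply/row_freeP; exists p2.
have e0 : e = 0 by rewrite -[e]mul1mx -gi -mulmxA -E1 (mulmxA i2) e21 mul0mx mulmx0.
have fjr : f *m j *m r' = 1%:M by rewrite -mulmxA Er.
have : f *m j *m e *m r' = 1%:M by rewrite /e mulmxA fjr mul1mx fjr.
rewrite e0 mulmx0 mul0mx => E; case/eqP: (irow_neq0 n).
by rewrite -[irow k n _]mulmx1 -E mulmx0.
Qed.

(** * Projective covers and injective hulls *)

(** Essentiality says that the image of [e] contains the socle of [E], and by [soc_inj] the socle of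
    an injective is spanned by the images of the [D n]. *)
Lemma hullP M E (e : 'M_(cdim M, cdim E)) :
  inj_hull e <-> [/\ injective E, hom M E e, row_free e & forall n, (coact E (D n) <= e)%MS].
Proof.
split=> [[iE he fe ess]|[iE he fe De]]; split=> //.
  move=> n; apply/negPn/negP => /not_submx[w]; set v := w *m _ => nv.
  have sv : soc n v := soc_D w n.
  have inv c : (v *m coact E c <= v)%MS by rewrite (soc_coact sv) scalemx_sub.
  (* A socle vector [v] outside the image of [e] spans a line that meets this image in zero, so
     dividing by it stays injective on [M] but not on [E]. *)
  have [Q [q [hq fq Eq]]] := quot_ex inv.
  have vq : v *m q = 0 by apply/sub_kermxP; rewrite Eq.
  have fq' : row_free q.
    apply: (ess Q q hq); apply: row_freeV0 => x; rewrite mulmxA => /sub_kermxP; rewrite Eq.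
    move=> /sub_rVP[l El]; have [l0|nl] := eqVneq l 0.
      by apply: (free_eq0 fe); rewrite El l0 scale0r.
    by case/negP: nv; rewrite -[v]scale1r -(mulVf nl) -scalerA -El scalemx_sub ?submxMl.
  by move: nv; rewrite (free_eq0 fq' vq) sub0mx.
move=> Q h hh fh; apply: free_soc => // n v sv vh.
have [w Ew] := soc_inj iE sv.
have /submxP[y Ey] : (v <= e)%MS by rewrite Ew; apply: submx_trans (De n); apply: submxMl.
by rewrite Ey (_ : y = 0) ?mul0mx //; apply: (free_eq0 fh); rewrite mulmxA -Ey.
Qed.

Lemma hull_dual M P (p : 'M_(cdim P, cdim M)) :
  proj_cover p <-> @inj_hull k (dual M) (dual P) p^T.
Proof.
split=> [[pP hp fp ess]|[iP hp fp ess]]; split.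
- exact: proj_dual.
- exact: hom_tr.
- by rewrite tr_free.
- move=> Q h hh fh; rewrite -tr_full; apply: (ess (dual Q) h^T).
    exact: hom_trl.
  by rewrite -tr_free trmx_mul trmxK.
- by apply: proj_iso (iso_dualK P) _; apply: inj_dual.
- by have := hom_trK hp; rewrite trmxK.
- by rewrite -tr_free.
- move=> Q h hh fh; rewrite -tr_free; apply: (ess (dual Q) h^T); first exact: hom_tr.
  by rewrite -trmx_mul tr_free.
Qed.

Lemma coverP M P (p : 'M_(cdim P, cdim M)) :
  proj_cover p <-> [/\ projective P, hom P M p, row_full p & forall n, kermx p *m coact P (D n) = 0].
Proof.
rewrite hull_dual hullP; split=> [[iP hp fp H]|[pP hp fp H]]; split.
- by apply: proj_iso (iso_dualK P) _; apply: inj_dual.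
- by have := hom_trK hp; rewrite trmxK.
- by rewrite -tr_free.
- move=> n; have /= /submxP[y E] := H n; rewrite -[coact P _]trmxK E trmx_mul trmxK.
  by rewrite mulmxA mulmx_ker mul0mx.
- exact: proj_dual.
- exact: hom_tr.
- by rewrite tr_free.
- move=> n /=; apply/submxP; exists (pinvmx p *m coact P (D n))^T.
  rewrite -trmx_mul; congr (_^T); apply/eqP; rewrite -subr_eq0 mulmxA.
  rewrite -[X in X - _]mul1mx -mulmxBl.
  have /submxP[z ->] : (1%:M - p *m pinvmx p <= kermx p)%MS.
    by apply/sub_kermxP; rewrite mulmxBl -mulmxA mulVpmx // mulmx1 mul1mx subrr.
  by rewrite -mulmxA H mulmx0.
Qed.

End Socle.

(** * Syzygies and cosyzygies as one relation *)

Section Step.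
Variable k : fieldType.
Implicit Types X Y Z U V W P Q E M : comod k.

(* For an exact sequence [0 -> X -> P -> Y -> 0] with [P] projective, [P -> Y]
   is a projective cover iff [X] is D-free, and [X -> P] is an injective hull
   iff [Y] is D-free: [D_n] maps [P] onto the [S(n)]-part of its socle. *)
Definition step X Y := exists P (j : 'M_(cdim X, cdim P)) (p : 'M_(cdim P, cdim Y)),
  [/\ is_ses j p, projective P, Dfree X & Dfree Y].

Lemma Omega1_step M X : Dfree M -> (Omega1 M X <-> step X M).
Proof.
move=> dM; split.
  move=> [P [p [j [/coverP[pP hp fp H] hj fj /eqmxP E]]]]; exists P, j, p; split=> //.
    by split=> //; apply/eqmxP.
  move=> n; apply: (free_eq0 fj); rewrite hj.
  have /submxP[y ->] : (j <= kermx p)%MS by rewrite E.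
  by rewrite -mulmxA H mulmx0.
move=> [P [j [p [ex pP dX _]]]]; exists P, p, j; split.
- apply/coverP; split=> //; [exact: ses_homr ex | exact: ses_full ex |].
  move=> n; have [y ->] := ses_exact ex (mulmx_ker p).
  by rewrite -mulmxA -(ses_homl ex) dX mul0mx mulmx0.
- exact: ses_homl ex.
- exact: ses_free ex.
- exact: ses_ker ex.
Qed.

Lemma OmegaInv1_step X Y : Dfree X -> (OmegaInv1 X Y <-> step X Y).
Proof.
move=> dX; split.
  move=> [P [e [q [/hullP[iP he fe H] hq fq /eqmxP E]]]]; exists P, e, q; split=> //.
  - by split=> //; apply/eqmxP.
  - exact: inj_proj.
  move=> n; apply: (full_eq0 fq); rewrite -hq; apply/sub_kermxP.
  by rewrite -E.
move=> [P [j [p [ex pP _ dY]]]]; exists P, j, p; split.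
- apply/hullP; split; [exact: proj_inj | exact: ses_homl ex | exact: ses_free ex |].
  move=> n; rewrite (eqmxP (ses_ker ex)); apply/sub_kermxP.
  by rewrite (ses_homr ex) dY mulmx0.
- exact: ses_homr ex.
- exact: ses_full ex.
- exact: ses_ker ex.
Qed.

Lemma step_dual X Y : step X Y -> step (dual Y) (dual X).
Proof.
move=> [P [j [p [ex pP dX dY]]]]; exists (dual P), p^T, j^T; split.
- exact: ses_dual.
- by apply/inj_proj/proj_dual.
- exact: Dfree_dual.
- exact: Dfree_dual.
Qed.

Lemma step_iso X Y X' Y' : iso X X' -> iso Y Y' -> step X Y -> step X' Y'.
Proof.
move=> iX iY [P [j [p [ex pP dX dY]]]].
have [a Ia] := iso_sym iX; have [b Ib] := iY.
have I1 := (@unit_iso k P _ (hom1 P) (unitmx1 _ _)).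
exists P, (a *m j *m 1%:M), (1%:M *m p *m b); split=> //.
- by apply: (ses_transport ex Ia I1 I1) => //; rewrite mulmx1.
- exact: Dfree_iso iX dX.
- exact: Dfree_iso iY dY.
Qed.

Lemma step_ex_down M : Dfree M -> exists X, step X M.
Proof.
move=> dM; have [P [p [pP hp fp H]]] := cover_ex M.
have [X [j ex]] := ses_ker_ex hp fp.
exists X; apply/(Omega1_step _ dM); exists P, p, j; split.
- by apply/coverP.
- exact: ses_homl ex.
- exact: ses_free ex.
- exact: ses_ker ex.
Qed.

Lemma step_ex_up X : Dfree X -> exists Y, step X Y.
Proof.
move=> /Dfree_dual/step_ex_down[V /step_dual s]; exists (dual V).
by apply: step_iso s; [exact: iso_dualK | exact: iso_refl].
Qed.

(** * Morphisms between the sequences *)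

Definition ses_mor X P X' U Q U' (j : 'M_(cdim X, cdim P)) (p : 'M_(cdim P, cdim X'))
    (i : 'M_(cdim U, cdim Q)) (q : 'M_(cdim Q, cdim U'))
    (u : 'M_(cdim X, cdim U)) (uh : 'M_(cdim P, cdim Q)) (u' : 'M_(cdim X', cdim U')) :=
  [/\ hom X U u, hom P Q uh, hom X' U' u', j *m uh = u *m i & uh *m q = p *m u'].

Section Lift.
Variables (X P X' U Q U' : comod k).
Variables (j : 'M[k]_(cdim X, cdim P)) (p : 'M[k]_(cdim P, cdim X')).
Variables (i : 'M[k]_(cdim U, cdim Q)) (q : 'M[k]_(cdim Q, cdim U')).
Hypotheses (exX : is_ses j p) (exU : is_ses i q).

Lemma lift_down (u' : 'M_(cdim X', cdim U')) : projective P -> hom X' U' u' ->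
  exists u uh, ses_mor j p i q u uh u'.
Proof.
move=> pP hu'.
have [uh [huh E]] := pP _ _ q (p *m u') (ses_homr exU) (ses_full exU) (homM (ses_homr exX) hu').
have [|u hu Eu] := @ses_liftl _ _ _ _ _ _ exU X (j *m uh) (homM (ses_homl exX) huh).
  by rewrite -mulmxA E mulmxA (ses_comp0 exX) mul0mx.
by exists u, uh.
Qed.

Lemma lift_up (u : 'M_(cdim X, cdim U)) : injective Q -> hom X U u ->
  exists uh u', ses_mor j p i q u uh u'.
Proof.
move=> iQ hu.
have [uh [huh E]] := iQ _ _ j (u *m i) (ses_homl exX) (ses_free exX) (homM hu (ses_homl exU)).
have [|u' hu' Eu] := @ses_liftr _ _ _ _ _ _ exX U' (uh *m q) (homM huh (ses_homr exU)).
  by rewrite mulmxA E -mulmxA (ses_comp0 exU) mulmx0.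
by exists uh, u'.
Qed.

(** When [u'] vanishes, [uh] takes values in the image of [U], and this corestriction is [d]. In
    [mor_right0], dually, [uh] passes to the quotient [X']. *)
Lemma mor_left0 u uh u' : ses_mor j p i q u uh u' -> u' = 0 ->
  exists2 d : 'M_(cdim P, cdim U), hom P U d & u = j *m d.
Proof.
move=> [hu huh hu' E1 E2] u0.
have [|d hd Ed] := @ses_liftl _ _ _ _ _ _ exU P uh huh; first by rewrite E2 u0 mulmx0.
by exists d => //; apply: (row_free_inj (ses_free exU)); rewrite -mulmxA Ed E1.
Qed.

Lemma mor_right0 u uh u' : ses_mor j p i q u uh u' -> u = 0 ->
  exists2 d : 'M_(cdim X', cdim Q), hom X' Q d & u' = d *m q.
Proof.
move=> [hu huh hu' E1 E2] u0.
have [|d hd Ed] := @ses_liftr _ _ _ _ _ _ exX Q uh huh; first by rewrite E1 u0 mul0mx.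
by exists d => //; apply: (row_full_inj (ses_full exX)); rewrite mulmxA Ed E2.
Qed.

Lemma mor_sub u uh u' v vh v' : ses_mor j p i q u uh u' -> ses_mor j p i q v vh v' ->
  ses_mor j p i q (u - v) (uh - vh) (u' - v').
Proof.
move=> [h1 h2 h3 h4 h5] [g1 g2 g3 g4 g5]; split; try exact: homB.
  by rewrite mulmxBr mulmxBl h4 g4.
by rewrite mulmxBr mulmxBl h5 g5.
Qed.

End Lift.

Lemma mor_comp X P X' U Q U' V R V'
    (j : 'M[k]_(cdim X, cdim P)) (p : 'M[k]_(cdim P, cdim X'))
    (i : 'M[k]_(cdim U, cdim Q)) (q : 'M[k]_(cdim Q, cdim U'))
    (l : 'M[k]_(cdim V, cdim R)) (r : 'M[k]_(cdim R, cdim V')) u uh u' v vh v' :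
  ses_mor j p i q u uh u' -> ses_mor i q l r v vh v' ->
  ses_mor j p l r (u *m v) (uh *m vh) (u' *m v').
Proof.
move=> [h1 h2 h3 h4 h5] [g1 g2 g3 g4 g5]; split.
- exact: homM h1 g1.
- exact: homM h2 g2.
- exact: homM h3 g3.
- by rewrite mulmxA h4 -mulmxA g4 mulmxA.
- by rewrite -mulmxA g5 mulmxA h5 mulmxA.
Qed.

Lemma mor_1 X P X' (j : 'M[k]_(cdim X, cdim P)) (p : 'M[k]_(cdim P, cdim X')) :
  ses_mor j p j p 1%:M 1%:M 1%:M.
Proof. by split; rewrite ?mulmx1 ?mul1mx //; exact: hom1. Qed.

Lemma mor_exp X P X' (j : 'M[k]_(cdim X, cdim P)) (p : 'M[k]_(cdim P, cdim X')) u uh u' n :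
  ses_mor j p j p u uh u' -> ses_mor j p j p (u ^+ n) (uh ^+ n) (u' ^+ n).
Proof.
move=> h; elim: n => [|n IH]; first exact: mor_1.
by rewrite !exprS; apply: mor_comp IH.
Qed.

(** If [a *m b] were invertible, [X] would be a summand of the injective [P], and a D-free injective
    is zero. By Fitting it is therefore nilpotent. *)
Lemma indec_thru X P (a : 'M_(cdim X, cdim P)) (b : 'M_(cdim P, cdim X)) :
  indecomposable X -> Dfree X -> injective P -> hom X P a -> hom P X b ->
  @is_iso k X X (1%:M + a *m b).
Proof.
move=> indX dX iP ha hb; have hab := homM ha hb.
apply: unit_iso; first by apply: homD => //; apply: hom1.
have [[n nil]|u] := indec_local indX hab; first exact: indec_addnil nil.
have [_ [g [hg [abg _]]]] := unit_iso hab u.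
have := Dfree_inj0 (inj_retract iP ha (homM hb hg) _) dX.
rewrite mulmxA abg => /(_ erefl); by case: indX => pos _ z; rewrite z in pos.
Qed.

Lemma split_thru X U P (u : 'M_(cdim X, cdim U)) (r : 'M_(cdim U, cdim X))
    (a : 'M_(cdim X, cdim P)) (b : 'M_(cdim P, cdim X)) :
  indecomposable X -> Dfree X -> injective P -> hom X P a -> hom P X b ->
  hom U X r -> u *m r - 1%:M = a *m b -> split_mono u.
Proof.
move=> indX dX iP ha hb hr E.
have [_ [g [hg [Eg _]]]] := indec_thru indX dX iP ha hb.
exists (r *m g); split; first exact: homM hr hg.
by rewrite mulmxA -Eg -E addrC subrK.
Qed.

Section LiftSplit.
Variables (X P X' U Q U' : comod k).
Variables (j : 'M[k]_(cdim X, cdim P)) (p : 'M[k]_(cdim P, cdim X')).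
Variables (i : 'M[k]_(cdim U, cdim Q)) (q : 'M[k]_(cdim Q, cdim U')).
Hypotheses (exX : is_ses j p) (exU : is_ses i q).
Hypotheses (pP : projective P) (pQ : projective Q).
Variables (u : 'M[k]_(cdim X, cdim U)) (uh : 'M[k]_(cdim P, cdim Q)) (u' : 'M[k]_(cdim X', cdim U')).
Hypothesis mu : ses_mor j p i q u uh u'.

(** A retraction of [u'] lifts to a map [r] for which [u *m r] differs from the identity by a map
    through [P]; such an error can be corrected on a D-free indecomposable. *)
Lemma split_left : indecomposable X -> Dfree X -> split_mono u' -> split_mono u.
Proof.
move=> indX dX [r' [hr' E]].
have [r [rh mr]] := lift_down exU exX pQ hr'.
have m1 := mor_sub (mor_comp mu mr) (mor_1 j p).
have [|d hd Ed] := mor_left0 exX m1; first by rewrite E subrr.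
case: mr => hr _ _ _ _.
exact: (split_thru indX dX (proj_inj pP) (ses_homl exX) hd hr Ed).
Qed.

Lemma split_right : indecomposable X' -> Dfree X' -> split_mono u -> split_mono u'.
Proof.
move=> indX dX [r [hr E]].
have [rh [r' mr]] := lift_up exU exX (proj_inj pP) hr.
have m1 := mor_sub (mor_comp mu mr) (mor_1 j p).
have [|d hd Ed] := mor_right0 exX m1; first by rewrite E subrr.
case: mr => _ _ hr' _ _.
exact: (split_thru indX dX (proj_inj pP) hd (ses_homr exX) hr' Ed).
Qed.
End LiftSplit.

Lemma Dfree_idem_thru X P (e : 'M_(cdim X)) (a : 'M_(cdim X, cdim P)) (b : 'M_(cdim P, cdim X)) :
  Dfree X -> injective P -> hom X P a -> hom P X b -> e = a *m b -> e *m e = e -> e = 0.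
Proof.
move=> dX iP ha hb eE ee; have he : hom X X e by rewrite eE; apply: homM ha hb.
have [S [p [j [hp fp hj fj pj]]]] := im_ex he.
have dS := Dfree_sub hj fj dX.
have jp : j *m p = 1%:M.
  apply: (row_full_inj fp); apply: (row_free_inj fj).
  by rewrite mulmx1 mulmxA pj -mulmxA pj ee.
have z : cdim S = 0%N.
  apply: Dfree_inj0 dS; apply: (inj_retract iP (homM hj ha) (homM hb hp)).
  have -> : j *m a *m (b *m p) = (j *m p) *m (j *m p).
    by rewrite -!mulmxA (mulmxA a) -eE -pj !mulmxA.
  by rewrite jp mulmx1.
rewrite -pj; have -> : j = 0 by apply/matrixP => -[m lt]; exfalso; move: lt; rewrite z.
by rewrite mulmx0.
Qed.

(** An idempotent [e] of [Y] lifts to an endomorphism [u] of [X]. If [u] is nilpotent, [e], which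
    equals its powers, factors through [P]; if [u] is invertible, [1 - e] does. An idempotent of a
    D-free comodule that factors through an injective is zero. *)
Lemma step_indec_up X Y : step X Y -> indecomposable X -> indecomposable Y.
Proof.
move=> [P [j [p [ex pP dX dY]]]] indX; have iP := proj_inj pP.
apply: idem_indec.
  rewrite lt0n; apply/eqP => Y0.
  have IX : @is_iso k X P j.
    apply: dimle_iso; [exact: ses_homl ex | exact: ses_free ex |].
    by rewrite -(ses_dim ex) Y0 addn0.
  have : cdim X = 0%N.
    by apply: Dfree_inj0 dX; apply: inj_iso iP; apply: iso_sym; exists j.
  by case: indX => pos _ z; rewrite z in pos.
move=> e he ee; have [u [uh mu]] := lift_down ex ex pP he.
have [hu _ _ _ _] := mu.
have [[n un]|uu] := indec_local indX hu.
  have [|d hd Ed] := mor_right0 ex (mor_exp n.+1 mu); first by rewrite exprS un mulr0.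
  left; have en : e ^+ n.+1 = e.
    by elim: n {un d hd Ed} => [|n IH]; rewrite ?expr1 // exprS IH.
  by rewrite en in Ed; apply: (Dfree_idem_thru dY iP hd (ses_homr ex) Ed).
right; apply/eqP; rewrite eq_sym -subr_eq0; apply/eqP.
have [_ [v [hv [uv vu]]]] := unit_iso hu uu.
have m1 : ses_mor j p j p (1%:M - u) (1%:M - uh) (1%:M - e) := mor_sub (mor_1 j p) mu.
have m2 := mor_comp mu m1.
have [|d hd Ed] := mor_left0 ex m2; first by rewrite mulmxBr mulmx1 ee subrr.
(* [u (1 - u)] factors through [P], and multiplying by the inverse [v] of [u], extended to [P] as
   [a], shows that [1 - u] does too. Subtracting [m3] then leaves a morphism with zero left
   component. *)
have [a [ha Ea]] := iP _ _ j (v *m j) (ses_homl ex) (ses_free ex) (homM hv (ses_homl ex)).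
have m3 : ses_mor j p j p (1%:M - u) (a *m d *m j) 0.
  case: m1 => h1 _ _ _ _; split=> //.
  - exact: homM (homM ha hd) (ses_homl ex).
  - exact: hom0.
  - rewrite !mulmxA Ea -(mulmxA v) -Ed !mulmxA vu mul1mx //.
  - by rewrite -mulmxA (ses_comp0 ex) !mulmx0.
have [|d' hd' Ed'] := mor_right0 ex (mor_sub m1 m3); first by rewrite subrr.
rewrite subr0 in Ed'.
apply: (Dfree_idem_thru dY iP hd' (ses_homr ex) Ed').
by rewrite mulmxBl mul1mx mulmxBr mulmx1 ee subrr subr0.
Qed.

Lemma step_indec_down X Y : step X Y -> indecomposable Y -> indecomposable X.
Proof.
move=> /step_dual/step_indec_up H /indec_dual/H/indec_dual.
exact: indec_iso (iso_dualK X).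
Qed.

(** Lifting the identity in both directions gives maps between the two covers. Minimality makes them
    surjective, so the covers have the same dimension. *)
Lemma step_uniq_down X Y X' Y' : step X Y -> step X' Y' -> iso Y Y' -> iso X X'.
Proof.
move=> s s' iY; have {s} := step_iso (iso_refl X) iY s.
have dY' : Dfree Y' by case: s' => [? [? [? []]]].
move=> /(Omega1_step _ dY')[P [p [j [[pP hp fp ess] hj fj Ej]]]].
have /(Omega1_step _ dY')[P' [p' [j' [[pP' hp' fp' ess'] hj' fj' Ej']]]] := s'.
have exX : is_ses j p by [].
have exX' : is_ses j' p' by [].
have [u [uh [hu huh _ E1 E2]]] := lift_down exX exX' pP (hom1 Y').
have [v [vh [hv hvh _ E1' E2']]] := lift_down exX' exX pP' (hom1 Y').
rewrite mulmx1 in E2; rewrite mulmx1 in E2'.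
have fuh : row_full uh by apply: ess' => //; rewrite E2.
have fvh : row_full vh by apply: ess => //; rewrite E2'.
have le1 : (cdim P' <= cdim P)%N by rewrite -(eqP fuh) rank_leq_row.
have le2 : (cdim P <= cdim P')%N by rewrite -(eqP fvh) rank_leq_row.
have fr : row_free uh by rewrite /row_free (eqP fuh) eqn_leq le1 le2.
exists u; apply: dimle_iso => //.
  by apply: (@free_compl _ _ _ _ _ j'); rewrite -E1 free_comp.
by have := ses_dim exX; have := ses_dim exX'; lia.
Qed.

Lemma step_uniq_up X Y X' Y' : step X Y -> step X' Y' -> iso X X' -> iso Y Y'.
Proof.
move=> /step_dual s /step_dual s' /iso_dual i.
have /iso_dual j := step_uniq_down s s' i.
exact: iso_trans (iso_sym (iso_dualK Y)) (iso_trans j (iso_dualK Y')).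
Qed.

Lemma step_Dfreel X Y : step X Y -> Dfree X. Proof. by case=> [? [? [? []]]]. Qed.
Lemma step_Dfreer X Y : step X Y -> Dfree Y. Proof. by case=> [? [? [? []]]]. Qed.

(** * Iterated syzygies of simples *)

Definition Sz (m : int) : comod k := if m is Posz n then simp k n else zero_comod k.

Lemma realizes_iso (L : seq Bbasis) X Y : realizes X L -> iso X Y -> realizes Y L.
Proof.
move=> [f [g [fg gf E]]] [a [ha [b [hb [ab ba]]]]]; exists (f *m a), (b *m g); split.
- by rewrite mulmxA -(mulmxA f) ab mulmx1.
- by rewrite mulmxA -(mulmxA b) gf mulmx1.
- by move=> c; rewrite mulmxA E -!mulmxA ha.
Qed.

Lemma IsI_iso n X : IsI n X <-> iso (Inj k n) X.
Proof.
split; last first.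
  move=> i; apply: realizes_iso i; exists 1%:M, 1%:M.
  by rewrite !mulmx1; split=> // c; rewrite mul1mx mulmx1.
by move=> [f [g [fg gf E]]]; exists f; split=> //; exists g; split=> //; exact: (@homV k (Inj k n) X f g E fg gf).
Qed.

Lemma regmat_simp n c : regmat k [:: G n] c = coact (simp k n) c.
Proof.
apply/matrixP => i j; rewrite !ord1 !mxE eqxx mulr1n /=.
have -> : (comul_pair (G n) c == Some (G n)) = (c == G n).
  rewrite comul_Gl; have [_|ne] := eqVneq n (tgt c); first by rewrite (inj_eq (@Some_inj _)).
  by apply/esym/eqP => E; rewrite E eqxx in ne.
by case: eqP.
Qed.

Lemma IsS_iso m X : IsS m X <-> iso (Sz m) X.
Proof.
case: m => n; last first.
  split=> [z|i]; first exact: iso_dim0.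
  by rewrite /= -(iso_dim i).
split; last first.
  move=> i; apply: realizes_iso i; exists 1%:M, 1%:M.
  by rewrite !mulmx1; split=> // c; rewrite mul1mx mulmx1 regmat_simp.
move=> [f [g [fg gf E]]]; exists f; split; first by move=> c; rewrite -E regmat_simp.
exists g; split=> //; apply: (@homV k (simp k n) X f g _ fg gf) => c.
by rewrite -E regmat_simp.
Qed.

Lemma Dfree_Sz m : Dfree (Sz m).
Proof. by case: m => n; [apply: Dfree_simp | apply: Dfree0]. Qed.

Definition OmegaS (i m : int) X := Omega i (IsS m) X.

Lemma OmegaS0 m X : OmegaS 0 m X <-> iso (Sz m) X.
Proof. exact: IsS_iso. Qed.

(** D-freeness is carried along in the induction because only for a D-free comodule is [Omega1] the
    same as [step], for which uniqueness is known. *)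
Lemma OmegaN_char n m : (forall X, OmegaN n (IsS m) X -> Dfree X) /\
  (forall X Y, OmegaN n (IsS m) X -> (OmegaN n (IsS m) Y <-> iso X Y)).
Proof.
elim: n => [|n [IHd IHi]] /=.
  split; first by move=> X /IsS_iso i; apply: Dfree_iso i (Dfree_Sz m).
  move=> X Y /IsS_iso i; split; first by move/IsS_iso; apply: iso_trans; apply: iso_sym.
  by move=> j; apply/IsS_iso; apply: iso_trans i j.
split; first by move=> X [Z [oZ /(Omega1_step _ (IHd _ oZ)) /step_Dfreel]].
move=> X Y [Z [oZ /(Omega1_step _ (IHd _ oZ)) s]]; split.
  move=> [Z' [oZ' /(Omega1_step _ (IHd _ oZ')) s']].
  by apply: (step_uniq_down s s'); apply/(IHi _ _ oZ).
move=> i; exists Z; split=> //; apply/(Omega1_step _ (IHd _ oZ)).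
by apply: step_iso s => //; apply: iso_refl.
Qed.

Lemma OmegaInvN_char n m : (forall X, OmegaInvN n (IsS m) X -> @Dfree k X) /\
  (forall X Y, OmegaInvN n (IsS m) X -> (OmegaInvN n (IsS m) Y <-> iso X Y)).
Proof.
elim: n => [|n [IHd IHi]] /=; first exact: (OmegaN_char 0 m).
split; first by move=> X [Z [oZ /(OmegaInv1_step _ (IHd _ oZ)) /step_Dfreer]].
move=> X Y [Z [oZ /(OmegaInv1_step _ (IHd _ oZ)) s]]; split.
  move=> [Z' [oZ' /(OmegaInv1_step _ (IHd _ oZ')) s']].
  by apply: (step_uniq_up s s'); apply/(IHi _ _ oZ).
move=> i; exists Z; split=> //; apply/(OmegaInv1_step _ (IHd _ oZ)).
by apply: step_iso s => //; apply: iso_refl.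
Qed.

Lemma OmegaS_Dfree i m X : OmegaS i m X -> Dfree X.
Proof. by case: i => n; [case: (OmegaN_char n m) | case: (OmegaInvN_char n.+1 m)] => H _ /H. Qed.

Lemma OmegaS_iso i m X Y : OmegaS i m X -> iso X Y -> OmegaS i m Y.
Proof. by case: i => n; [case: (OmegaN_char n m) | case: (OmegaInvN_char n.+1 m)] => _ H oX /(H _ _ oX). Qed.

Lemma OmegaS_uniq i m X Y : OmegaS i m X -> OmegaS i m Y -> iso X Y.
Proof. by case: i => n; [case: (OmegaN_char n m) | case: (OmegaInvN_char n.+1 m)] => _ H oX /(H _ _ oX). Qed.

(** For positive [i] one cosyzygy has to undo the last syzygy, and this is the uniqueness of the
    right end of a step. *)
Lemma OmegaS_up i m X Y : OmegaS i m X -> step X Y -> OmegaS (i - 1) m Y.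
Proof.
case: i => [[|n]|n] oX s.
- by rewrite sub0r; exists X; split=> //; apply/OmegaInv1_step => //; apply: OmegaS_Dfree oX.
- have -> : n.+1%:Z - 1 = n%:Z by rewrite -addn1 PoszD addrK.
  case: oX => Z [oZ /Omega1_step s']; have {}s' := s' (@OmegaS_Dfree n m Z oZ).
  apply: (@OmegaS_iso n m Z Y oZ).
  exact: step_uniq_up (iso_refl X).
- rewrite NegzE -opprD -PoszD addn1 -NegzE.
  by exists X; split=> //; apply/OmegaInv1_step => //; apply: (@OmegaS_Dfree (Negz n) m X).
Qed.

Lemma OmegaS_down i m X Y : OmegaS i m Y -> step X Y -> OmegaS (i + 1) m X.
Proof.
case: i => [n|n] oY s.
  rewrite -PoszD addn1; exists Y; split=> //; apply/Omega1_step => //; exact: (@OmegaS_Dfree n m Y).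
have -> : Negz n + 1 = - n%:Z by rewrite NegzE -addn1 PoszD opprD subrK.
case: oY => Z [oZ /OmegaInv1_step s'].
have oZ' : OmegaS (- n%:Z) m Z by case: n oZ {s'} => //= n; rewrite -NegzE.
apply: (OmegaS_iso oZ'); have {}s' := s' (OmegaS_Dfree oZ').
exact: step_uniq_down (iso_refl Y).
Qed.

Lemma simp_dual n : iso (simp k n) (dual (simp k n)).
Proof.
exists 1%:M; apply: full_free_iso; rewrite ?row_free_unit ?row_full_unit ?unitmx1 // => c /=.
rewrite mulmx1 mul1mx tr_scalar_mx.
by congr (_%:R%:M); rewrite !Bbasis_eqE; case: c.
Qed.

Lemma Sz_dual m : iso (Sz m) (dual (Sz m)).
Proof. by case: m => n; [apply: simp_dual | apply: iso_dim0]. Qed.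

Lemma OmegaS_dual i m X : OmegaS i m X -> OmegaS (- i) m (dual X).
Proof.
have pos n Y : OmegaS (Posz n) m Y -> OmegaS (- n%:Z) m (dual Y).
  elim: n Y => [|n IH] Y.
    rewrite oppr0 => /OmegaS0 i0; apply/OmegaS0; apply: iso_trans (Sz_dual m) _.
    exact: iso_dual.
  case=> Z [oZ /Omega1_step s]; have {}s := s (@OmegaS_Dfree n m Z oZ).
  have := OmegaS_up (IH _ oZ) (step_dual s).
  by rewrite -opprD -PoszD addn1.
case: i => [n|n]; first exact: pos.
rewrite NegzE opprK; elim: n X => [|n IH] X [Z [oZ /OmegaInv1_step s]].
  have dZ : Dfree Z by apply: (@OmegaS_Dfree 0 m Z).
  have {}s := s dZ.
  have d0 : OmegaS 0 m (dual Z) by have := pos 0%N Z oZ; rewrite oppr0.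
  by have := OmegaS_down d0 (step_dual s).
have dZ : Dfree Z by apply: (@OmegaS_Dfree (Negz n) m Z).
have {}s := s dZ.
have := OmegaS_down (IH _ oZ) (step_dual s).
by rewrite -PoszD addn1.
Qed.

End Step.

(** * The almost split sequence starting at the radical of [I_n] *)

Lemma indec_simp (k : fieldType) n : indecomposable (simp k n).
Proof.
apply: idem_indec => // e _ ee.
have : e 0 0 * (e 0 0 - 1) = 0.
  by rewrite mulrBr mulr1; apply/eqP; rewrite subr_eq0 -{3}ee mxE big_ord1.
move=> /eqP; rewrite mulf_eq0 subr_eq0 => /orP[] /eqP E; [left|right].
  by apply/matrixP => i j; rewrite !ord1 E mxE.
by apply/matrixP => i j; rewrite !ord1 E !mxE eqxx.
Qed.

(** A nonzero entry of [v *m cokermx B] selects a column of the cokernel matrix, which is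
    rescaled. *)
Lemma sep_col (k : fieldType) m d (v : 'rV[k]_d) (B : 'M_(m, d)) : ~~ (v <= B)%MS ->
  exists xi : 'cV_d, v *m xi = 1%:M /\ B *m xi = 0.
Proof.
rewrite submxE => /rV0Pn[j nz]; set c := _ *m _ in nz.
exists ((c 0 j)^-1 *: (cokermx B *m delta_mx j 0)).
split; last by rewrite -scalemxAr mulmxA mulmx_coker mul0mx scaler0.
rewrite -scalemxAr mulmxA -/c -colE.
by apply/matrixP => i l; rewrite !ord1 [LHS]mxE [col _ _ _ _]mxE mulVf // mxE eqxx.
Qed.

Section Base.
Variables (k : fieldType) (n : nat).
Notation I := (Inj k n).
Notation S := (simp k n).
Notation ir := (irow k n).
Notation ic := (icol k n).

Lemma icol_irow_sum : \sum_(e <- Ibasis n) ic e *m ir e = 1%:M.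
Proof.
apply: icol_ext => x; rewrite mulmx_suml mul1mx.
have [nx|ne] := eqVneq n (tgt x); last by rewrite icol0 // big1 // => e _; rewrite mulmx0.
have mx : x \in Ibasis n by rewrite mem_Ibasis_tgt nx.
rewrite (bigD1_seq x) ?Ibasis_uniq //= -mulmxA irow_col eqxx -nx eqxx mulmx1.
by rewrite big1 ?addr0 // => e ne; rewrite -mulmxA irow_col (negPf ne) raddf0 mulmx0.
Qed.

Lemma coactI_D m : coact I (D m) = (m == n)%:R *: (ic (D n) *m ir (G n)).
Proof.
apply: icol_ext => x; rewrite regmat_col -scalemxAl -mulmxA irow_col /= eqxx andbT.
have [->|ne] := eqVneq m n; last first.
  rewrite scale0r; case: x => j //=; case: eqP => // _ /=.
  by rewrite icol0 //= eq_sym.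
rewrite scale1r Bbasis_eqE; case: x => j /=; rewrite ?raddf0 ?mulmx0 // eq_sym.
by case: eqP => _; rewrite ?mulmx1 ?raddf0 ?mulmx0.
Qed.

Lemma coactI_G : coact I (G n) = ic (G n) *m ir (G n) + ic (D n) *m ir (D n).
Proof.
apply: icol_ext => x; rewrite regmat_col comul_G mulmxDl -!mulmxA !irow_col /= eqxx !andbT.
rewrite !Bbasis_eqE; have [nx|ne] := eqVneq n (tgt x); last first.
  have -> : ocol k n (if n == rsrc x then Some x else None) = 0.
    by case: ifP => //= _; rewrite icol0.
  case: x ne => j /= ne; rewrite ?(negPf ne) ?raddf0 ?mulmx0 ?addr0 //.
case: x nx => j /= nx; rewrite ?raddf0 ?mulmx0 ?add0r ?addr0.
- by rewrite -nx eqxx mulmx1.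
- by rewrite ifF //; apply/eqP; lia.
- by rewrite ifF //; apply/eqP; lia.
- by rewrite -nx eqxx mulmx1.
Qed.

(** An arrow [e] equals a product [x c] with [c] an arrow only for [x] group-like, so only the
    coordinate at [G n] survives. *)
Lemma irow_arrow e c : arrow e -> arrow c ->
  exists l, ir e *m coact I c = l *: ir (G n).
Proof.
move=> ae ac; exists ((ir e *m coact I c *m ic (G n)) 0 0).
apply: icol_ext => x; rewrite -scalemxAl irow_col /= eqxx andbT.
have [<-|ne] := eqVneq (G n) x; first by rewrite scalemx1 -mx11_scalar.
rewrite raddf0 scaler0 -mulmxA regmat_col.
have [nx|ne'] := eqVneq n (tgt x); last first.
  by case E : comul_pair => [z|] /=; rewrite ?mulmx0 // icol0 ?(comul_tgt E) // mulmx0.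
case E : comul_pair => [z|] /=; rewrite ?mulmx0 // irow_col.
case: eqP => [ez|] /=; last by rewrite raddf0.
subst z; case/eqP: ne; rewrite nx; case: x c e {nx} ae ac E => i [] j [] l //= _ _;
  by case: eqP.
Qed.

Lemma irow_Gsrc e : ir e *m coact I (G (rsrc e)) = ir e.
Proof.
apply: icol_ext => x; rewrite -mulmxA regmat_col comul_G.
case: eqP => [_|ne] //=; rewrite mulmx0 irow_col; case: eqP => [E|]; last by rewrite raddf0.
by rewrite E in ne.
Qed.

Lemma top_hom : hom I S (ic (D n)).
Proof.
move=> c; rewrite regmat_col /= mul_mx_scalar.
case: c => j; rewrite ?Bbasis_eqE /= ?scale0r //.
by rewrite eq_sym; case: eqP; rewrite /= ?scale0r ?scale1r // => ->.
Qed.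

Lemma top_full : row_full (ic (D n)).
Proof. by apply/row_fullP; exists (ir (D n)); rewrite irow_col !eqxx. Qed.

Section Seq.
(** [X] is [rad I_n], [Z] is [I_n / soc I_n], and [M], the image of the composite from [X] to [Z],
    is [rad I_n / soc I_n]. *)
Variables (X Z M : comod k).
Variables (ka : 'M[k]_(cdim X, cdim I)) (q : 'M[k]_(cdim I, cdim Z)).
Hypotheses (exX : @is_ses k X I S ka (ic (D n))) (exZ : @is_ses k S I Z (ir (G n)) q).
Variables (pi : 'M[k]_(cdim X, cdim M)) (mu : 'M[k]_(cdim M, cdim Z)).
Hypotheses (hpi : hom X M pi) (fpi : row_full pi) (hmu : hom M Z mu) (fmu : row_free mu).
Hypothesis pimu : pi *m mu = ka *m q.

Let hka := ses_homl exX.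
Let fka := ses_free exX.
Let hq := ses_homr exZ.

Lemma base_stepX : step X S.
Proof.
exists I, ka, (ic (D n)); split=> //; [exact: projI | | exact: Dfree_simp].
move=> m; apply: (free_eq0 fka); rewrite hka coactI_D -scalemxAr mulmxA.
by rewrite (ses_comp0 exX) mul0mx scaler0.
Qed.

Lemma base_stepZ : step S Z.
Proof.
exists I, (ir (G n)), q; split=> //; [exact: projI | exact: Dfree_simp |].
move=> m; apply: (full_eq0 (ses_full exZ)); rewrite -hq coactI_D -scalemxAl -mulmxA.
by rewrite (ses_comp0 exZ) mulmx0 scaler0.
Qed.

(** The vector [ir e] has no component at the top, so it lies in [X]; the functional [ic e] kills
    the socle, so it is defined on [Z]. On [M] they become an inclusion and a projection for the
    simple at the source of [e]. *)
Lemma base_arrow e : arrow e -> n = tgt e ->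
  exists (r : 'rV_(cdim X)) (z : 'cV_(cdim Z)),
  [/\ hom (simp k (rsrc e)) M (r *m pi), hom M (simp k (rsrc e)) (mu *m z),
     r *m ka = ir e & q *m z = ic e].
Proof.
move=> ae ne.
have [r Er] : exists r, ir e = r *m ka.
  by apply: (ses_exact exX); rewrite irow_col Bbasis_eqE; case: e ae {ne} => // i _; rewrite raddf0.
have [z Ez] : exists z, ic e = q *m z.
  by apply: (ses_coexact exZ); rewrite irow_col Bbasis_eqE; case: e ae {ne Er} => // i _; rewrite raddf0.
exists r, z; split=> //.
  apply: soc_simp.
  have tr c : r *m pi *m coact M c *m mu = ir e *m coact I c *m q.
    by rewrite -!mulmxA hmu (mulmxA pi) pimu -(mulmxA ka) -hq (mulmxA r) -Er.
  have arr c : arrow c -> r *m pi *m coact M c = 0.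
    move=> ac; apply: (free_eq0 fmu); rewrite tr.
    have [l ->] := irow_arrow ae ac.
    by rewrite -scalemxAl (ses_comp0 exZ) scaler0.
  split=> [|i|i]; try exact: arr.
  by apply: (row_free_inj fmu); rewrite tr irow_Gsrc Er -!mulmxA pimu.
move=> c /=; apply: (row_full_inj fpi).
rewrite mul_mx_scalar -scalemxAr !mulmxA -hpi -(mulmxA (coact X c)) pimu !mulmxA hka.
rewrite -!mulmxA -Ez regmat_col.
case: c => j; case: e ae ne {Er Ez} => i //= _ ne; rewrite ?Bbasis_eqE /= ?scale0r ?mulmx0 //.
- by case: eqP; rewrite /= ?scale1r ?scale0r ?mulmx0.
- by case: eqP; rewrite /= ?scale1r ?scale0r ?mulmx0.
- by case: eqP => [_|]; rewrite /= ?mulmx0 // -ne (ses_comp0 exX).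
- by case: eqP => [_|]; rewrite /= ?mulmx0 // -ne (ses_comp0 exX).
Qed.

(** The identity of [I_n] is the sum of the [ic e *m ir e]. Between [ka] and [q] the terms of [D n]
    and [G n] die and those of the arrows ending at [n] remain: one for [n = 0], two otherwise. *)
Lemma base_middle : biprod2 M (Sz k (n%:Z - 1)) (Sz k (n%:Z + 1)).
Proof.
have -> : n%:Z + 1 = n.+1%:Z by rewrite -PoszD addn1.
have [rb [zb [hib hpb Erb Ezb]]] := @base_arrow (Bb n) erefl erefl.
have pair r z e e' : r *m ka = ir e -> q *m z = ic e' -> r *m pi *m (mu *m z) = ir e *m ic e'.
  by move=> Er Ez; rewrite -mulmxA (mulmxA pi) pimu -Ez -Er !mulmxA.
have one s : (forall T, T = pi *m s *m mu -> T = ka *m q) -> s = 1%:M.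
  by move=> H; apply: (row_full_inj fpi); apply: (row_free_inj fmu); rewrite mulmx1 pimu; apply: H.
have kq L : L = Ibasis n -> ka *m (\sum_(e <- L) ic e *m ir e) *m q = ka *m q.
  by move=> ->; rewrite icol_irow_sum mulmx1.
have outer r z e : r *m ka = ir e -> q *m z = ic e ->
    pi *m (mu *m z *m (r *m pi)) *m mu = ka *m (ic e *m ir e) *m q.
  move=> Er Ez; rewrite !mulmxA pimu -!mulmxA pimu (mulmxA r) Er (mulmxA q) Ez.
  by rewrite !mulmxA.
have kD e : ka *m (ic (D n) *m e) *m q = 0 by rewrite mulmxA (ses_comp0 exX) !mul0mx.
have qG e : ka *m (e *m ir (G n)) *m q = 0 by rewrite -!mulmxA (ses_comp0 exZ) !mulmx0.
have [En|[m En]] : n = 0%N \/ exists m, n = m.+1.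
- by case: (n) => [|m]; [left | right; exists m].
- have -> : n%:Z - 1 = Negz 0 by rewrite En.
  exists 0, (rb *m pi), 0, (mu *m zb); split; split=> //.
  + exact: hom0.
  + exact: hom0.
  + by apply/matrixP => -[].
  + by rewrite (pair _ _ (Bb n) (Bb n)) // irow_col !eqxx.
  + by apply/matrixP => -[].
  + by apply/matrixP => i [].
  apply: one => T ->; rewrite mul0mx add0r (outer _ _ (Bb n)) //.
  rewrite -(kq [:: G n; Bb n; D n]) ?En // !big_cons big_nil.
  by rewrite !mulmxDr !mulmxDl mulmx0 mul0mx kD qG !addr0 add0r.
have -> : n%:Z - 1 = m%:Z by rewrite En -addn1 PoszD addrK.
have [ra [za [hia hpa Era Eza]]] := @base_arrow (A m) erefl En.
exists (ra *m pi), (rb *m pi), (mu *m za), (mu *m zb); split; split=> //.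
- by rewrite (pair _ _ (A m) (A m)) // irow_col /= eqxx En eqxx.
- by rewrite (pair _ _ (Bb n) (Bb n)) // irow_col !eqxx.
- by rewrite (pair _ _ (A m) (Bb n)) // irow_col raddf0.
- by rewrite (pair _ _ (Bb n) (A m)) // irow_col raddf0.
apply: one => T ->; rewrite mulmxDr mulmxDl (outer _ _ (A m)) // (outer _ _ (Bb n)) //.
rewrite -(kq [:: G n; A m; Bb n; D n]) ?En // !big_cons big_nil.
by rewrite !mulmxDr !mulmxDl mulmx0 mul0mx kD qG !addr0 add0r.
Qed.

Variables (Y : comod k).
Variables (i1 : 'M[k]_(cdim M, cdim Y)) (i2 : 'M[k]_(cdim I, cdim Y)).
Variables (p1 : 'M[k]_(cdim Y, cdim M)) (p2 : 'M[k]_(cdim Y, cdim I)).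
Hypothesis hY : [/\ hom M Y i1, hom I Y i2, hom Y M p1 & hom Y I p2].
Hypothesis eY : [/\ i1 *m p1 = 1%:M, i2 *m p2 = 1%:M, i1 *m p2 = 0, i2 *m p1 = 0
      & p1 *m i1 + p2 *m i2 = 1%:M].

Let f := pi *m i1 + ka *m i2.
Let g := p2 *m q - p1 *m mu.

Lemma base_ses : @is_ses k X Y Z f g.
Proof.
have [hi1 hi2 hp1 hp2] := hY; have [e1 e2 e12 e21 e] := eY.
have fp1 : f *m p1 = pi by rewrite mulmxDl -!mulmxA e1 e21 mulmx0 addr0 mulmx1.
have fp2 : f *m p2 = ka by rewrite mulmxDl -!mulmxA e12 e2 mulmx0 add0r mulmx1.
have ig : i2 *m g = q by rewrite mulmxBr !mulmxA e2 e21 mul0mx subr0 mul1mx.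
apply: sesI.
- exact: homD (homM hpi hi1) (homM hka hi2).
- exact: homB (homM hp2 hq) (homM hp1 hmu).
- by apply: (@free_compl _ _ _ _ _ p2); rewrite fp2.
- by apply: (@full_compr _ _ _ _ i2); rewrite ig (ses_full exZ).
- by rewrite mulmxBr !mulmxA fp2 fp1 pimu subrr.
move=> v; rewrite mulmxBr !mulmxA => /eqP; rewrite subr_eq0 => /eqP E.
have [w Ew] : exists w, v *m p1 = w *m pi.
  by have /submxP[w Ew] : (v *m p1 <= pi)%MS := submx_full _ fpi; exists w.
have [l El] : exists l, v *m p2 - w *m ka = l *m ir (G n).
  by apply: (ses_exact exZ); rewrite mulmxBl E Ew -!mulmxA pimu subrr.
have [s Es] : exists s, ir (G n) = s *m ka.
  by apply: (ses_exact exX); rewrite irow_col raddf0.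
have spi : s *m pi = 0.
  by apply: (free_eq0 fmu); rewrite -mulmxA pimu mulmxA -Es (ses_comp0 exZ).
apply/submxP; exists (w + l *m s).
have v2 : v *m p2 = (w + l *m s) *m ka.
  by rewrite mulmxDl -(mulmxA l) -Es -El addrC subrK.
have v1 : v *m p1 = (w + l *m s) *m pi by rewrite mulmxDl -(mulmxA l) spi mulmx0 addr0.
by rewrite -[v]mulmx1 -e mulmxDr !mulmxA v1 v2 mulmxDr !mulmxA.
Qed.

(* If [u] sends the socle of [X = rad I_n] into [D_n U], then [u] minus a map
   extending to [I_n] kills that socle; otherwise a functional vanishing on
   [D_n U] gives a retraction of [u]. *)
Lemma base_left (U : comod k) (u : 'M_(cdim X, cdim U)) : hom X U u -> ~ split_mono u ->
  exists h : 'M_(cdim Y, cdim U), hom Y U h /\ f *m h = u.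
Proof.
have [hi1 hi2 hp1 hp2] := hY; have [e1 e2 e12 e21 e] := eY.
move=> hu nu.
have [s Es] : exists s, ir (G n) = s *m ka.
  by apply: (ses_exact exX); rewrite irow_col raddf0.
have GX : coact X (G n) = ka *m ic (G n) *m s.
  apply: (row_free_inj fka); rewrite hka coactI_G mulmxDr !mulmxA (ses_comp0 exX) mul0mx addr0.
  by rewrite -[in RHS]mulmxA -Es.
have sG : s *m coact X (G n) = s.
  apply: (row_free_inj fka); rewrite -mulmxA hka mulmxA -Es.
  by have [-> _ _] := soc_irow k n.
have vG : s *m u *m coact U (G n) = s *m u by rewrite -mulmxA -hu mulmxA sG.
have [le|nle] := boolP (s *m u <= coact U (D n))%MS.
  have /submxP[w Ew] := le.
  have [|h2 hh2 E2] := @hom_from k n U (w *m coact U (G n)); first by rewrite -mulmxA coactGG.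
  have su : s *m (u - ka *m h2) = 0.
    rewrite mulmxBr (mulmxA s) -Es -irow_G -mulmxA hh2 mulmxA E2.
    by rewrite -(mulmxA w) (coact_src U (D n)) -Ew subrr.
  have [||h1 hh1 E1] := @factor_epi k U X M pi (u - ka *m h2) hpi fpi.
  - by apply: homB => //; apply: homM hka hh2.
  - have [l El] : exists l, kermx pi *m ka = l *m ir (G n).
      by apply: (ses_exact exZ); rewrite -mulmxA -pimu mulmxA mulmx_ker mul0mx.
    have -> : kermx pi = l *m s by apply: (row_free_inj fka); rewrite El -mulmxA -Es.
    by rewrite -mulmxA su mulmx0.
  exists (p1 *m h1 + p2 *m h2); split; first exact: homD (homM hp1 hh1) (homM hp2 hh2).
  rewrite mulmxDr !mulmxA !mulmxDl -!(mulmxA pi) -!(mulmxA ka) -!(mulmxA _ _ h1) -!(mulmxA _ _ h2).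
  by rewrite !(mulmxA i1) !(mulmxA i2) e1 e2 e12 e21 !mul0mx !mulmx0 !mul1mx addr0 add0r E1 subrK.
case: nu; have [xi [vxi Dxi]] := sep_col nle.
have [|t ht Et] := @hom_into k n U (coact U (G n) *m xi); first by rewrite mulmxA coactGG.
have tpi : t *m ic (D n) = 0.
  have -> : ic (D n) = coact I (D n) *m ic (G n) by rewrite regmat_col /= eqxx.
  by rewrite mulmxA -ht -mulmxA Et mulmxA (coact_tgt U (D n)) Dxi.
have [r hr Er] := ses_liftl exX ht tpi.
exists r; split=> //; apply: (row_free_inj fka); rewrite -mulmxA Er mul1mx.
apply: Inj_cogen; [exact: homM hu ht | exact: hka |].
rewrite -mulmxA Et (mulmxA u) -hu GX -!mulmxA (mulmxA s) vxi mulmx1.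
by [].
Qed.

(** The socle of [X] reaches [Y] only through [I_n], where it is in the image of [D n]. A retraction
    would send it into the image of [D n] on the D-free [X]. *)
Lemma base_nsplit : ~ @split_mono k X Y f.
Proof.
move=> [r [hr E]]; have [hi1 hi2 hp1 hp2] := hY.
have [s Es] : exists s, ir (G n) = s *m ka.
  by apply: (ses_exact exX); rewrite irow_col raddf0.
have spi : s *m pi = 0.
  by apply: (free_eq0 fmu); rewrite -mulmxA pimu mulmxA -Es (ses_comp0 exZ).
case/eqP: (irow_neq0 k n); rewrite Es -[s]mulmx1 -E !mulmxA mulmxDr !mulmxA spi mul0mx add0r.
rewrite -Es -irow_G -!mulmxA (mulmxA (coact I _)) hi2 -!mulmxA (mulmxA (coact Y _)) hr.
by rewrite (step_Dfreel base_stepX) mulmx0 mul0mx !mulmx0.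
Qed.

Lemma base_almost_split : almost_split f g.
Proof.
split; [exact: base_ses | | | exact: base_nsplit | exact: base_left].
  exact: step_indec_down base_stepX (indec_simp k n).
exact: step_indec_up base_stepZ (indec_simp k n).
Qed.

End Seq.
Lemma base_ex : exists (X Z M Y : comod k) (f : 'M_(cdim X, cdim Y)) (g : 'M_(cdim Y, cdim Z)),
  [/\ exists ka, @is_ses k X I S ka (ic (D n)), exists q, @is_ses k S I Z (ir (G n)) q,
      almost_split f g,
      biprod2 M (Sz k (n%:Z - 1)) (Sz k (n%:Z + 1)) & biprod2 Y M I].
Proof.
have [X [ka exX]] := ses_ker_ex top_hom top_full.
have [Z [q exZ]] := ses_coker_ex (irow_hom k n) (irow_free k n).
have [M [pi [mu [hpi fpi hmu fmu E]]]] := im_ex (homM (ses_homl exX) (ses_homr exZ)).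
have [Y BY] := dsum_ex M I; have [i1 [i2 [p1 [p2 [hY eY]]]]] := BY.
exists X, Z, M, Y, (pi *m i1 + ka *m i2), (p2 *m q - p1 *m mu); split=> //.
- by exists ka.
- by exists q.
- exact: (base_almost_split exX exZ hpi fpi hmu fmu E hY eY).
- exact (base_middle exX exZ hpi fpi hmu fmu E).
Qed.

End Base.

(** * Dimension vectors and weights *)

Definition pred_seq (u : nat -> nat) n := if n is m.+1 then u m else 0%N.

Section Dims.
Variable k : fieldType.
Implicit Types X Y Z U V W P Q E : comod k.

Definition vdim X n := \rank (coact X (G n)).
Definition Ddim X n := \rank (coact X (D n)).

Lemma ses_vdim X Y Z (f : 'M_(cdim X, cdim Y)) (g : 'M_(cdim Y, cdim Z)) n :
  is_ses f g -> vdim Y n = (vdim X n + vdim Z n)%N.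
Proof.
move=> ex; rewrite /vdim; have := mxrank_mul_ker (coact Y (G n)) g.
rewrite (ses_homr ex) (eqmxMfull _ (ses_full ex)) => <-; rewrite addnC; congr (_ + _)%N.
rewrite -(mxrankMfree _ (ses_free ex)) (ses_homl ex); apply: eqmx_rank.
apply/andP; split; last first.
  by rewrite sub_capmx submxMl /= -(eqmxP (ses_ker ex)) -(ses_homl ex) submxMl.
apply/row_subP => i; set v := row i _.
have : (v <= coact Y (G n) :&: kermx g)%MS by apply: row_sub.
rewrite sub_capmx => /andP[/submxP[y Ey] /sub_kermxP vg].
have [z Ez] := ses_exact ex vg.
have -> : v = z *m (f *m coact Y (G n)).
  by rewrite mulmxA -Ez Ey -mulmxA coactGG.
exact: submxMl.
Qed.

Lemma biprod_rank Y X1 X2 c : biprod2 Y X1 X2 ->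
  \rank (coact Y c) = (\rank (coact X1 c) + \rank (coact X2 c))%N.
Proof.
move=> [i1 [i2 [p1 [p2 [[hi1 hi2 hp1 hp2] [e1 e2 e12 e21 e]]]]]].
have E : coact Y c = p1 *m coact X1 c *m i1 + p2 *m coact X2 c *m i2.
  by rewrite -hp1 -hp2 -!mulmxA -mulmxDr e mulmx1.
have [fi1 fi2] : row_free i1 /\ row_free i2.
  by split; apply/row_freeP; [exists p1 | exists p2].
have [fp1 fp2] : row_full p1 /\ row_full p2.
  by split; apply/row_fullP; [exists i1 | exists i2].
have R1 : \rank (p1 *m coact X1 c *m i1) = \rank (coact X1 c) by rewrite mxrankMfree // eqmxMfull.
have R2 : \rank (p2 *m coact X2 c *m i2) = \rank (coact X2 c) by rewrite mxrankMfree // eqmxMfull.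
rewrite -R1 -R2 -mxrank_disjoint_sum; last first.
  apply/eqP; rewrite -submx0; apply/rV_subP => v; rewrite sub_capmx => /andP[/submxP[x Ex] /submxP[y Ey]].
  have v2 : v *m p2 = 0 by rewrite Ex -!mulmxA e12 !mulmx0.
  have v1 : v *m p1 = 0 by rewrite Ey -!mulmxA e21 !mulmx0.
  by rewrite -[v]mulmx1 -e mulmxDr !mulmxA v1 v2 !mul0mx addr0 sub0mx.
apply: eqmx_rank; apply/andP; split.
  by rewrite {1}E addmx_sub // ?addsmxSl ?addsmxSr.
rewrite addsmx_sub -hp1 -hp2 -!(mulmxA (coact Y c)).
have -> : coact Y c *m (p1 *m i1) = p1 *m i1 *m coact Y c.
  by rewrite -mulmxA -hi1 !mulmxA hp1.
have -> : coact Y c *m (p2 *m i2) = p2 *m i2 *m coact Y c.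
  by rewrite -mulmxA -hi2 !mulmxA hp2.
by rewrite !submxMl.
Qed.

Lemma iso_rank X Y c : iso X Y -> \rank (coact X c) = \rank (coact Y c).
Proof.
move=> [f If]; rewrite -(mxrankMfree _ (iso_free If)) If.1 eqmxMfull //; exact: iso_full.
Qed.

Lemma vdim_simp n m : vdim (simp k n) m = (m == n).
Proof.
rewrite /vdim /= Bbasis_eqE; case: (m == n) => /=; last by rewrite raddf0 mxrank0.
by rewrite mxrank1.
Qed.

Lemma dim0_rank X c : cdim X = 0%N -> \rank (coact X c) = 0%N.
Proof. by move=> z; apply/eqP; rewrite -leqn0 -z rank_leq_row. Qed.

Lemma vdim_dim0 X : (forall n, vdim X n = 0%N) -> cdim X = 0%N.
Proof.
move=> H; rewrite -(mxrank1 k (cdim X)) -(coact_counit X) big1 ?mxrank0 // => i _.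
by apply/eqP; rewrite -mxrank_eq0 -/(vdim X i) H.
Qed.

Lemma rank_coact_fin X c : (cbound X <= bidx c)%N -> \rank (coact X c) = 0%N.
Proof. by move=> le; rewrite coact_fin // mxrank0. Qed.

(** The arrows leaving [n], and in [ain] those arriving at [n]. A sum loses nothing because its
    terms live at different vertices; hence [socdim] and [topdim] are the multiplicities of [S(n)]
    in the socle and in the top. *)
Definition aout X n : 'M_(cdim X) := coact X (A n) + (if n is m.+1 then coact X (Bb m) else 0).
Definition ain X n : 'M_(cdim X) := coact X (Bb n) + (if n is m.+1 then coact X (A m) else 0).
Definition socdim X n := (vdim X n - \rank (aout X n))%N.
Definition topdim X n := (vdim X n - \rank (ain X n))%N.

Lemma aout_dual X n : aout (dual X) n = (ain X n)^T.
Proof. by rewrite /aout /ain linearD /=; case: n => [|n] //=; rewrite linear0. Qed.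

Lemma ain_dual X n : ain (dual X) n = (aout X n)^T.
Proof. by rewrite /aout /ain linearD /=; case: n => [|n] //=; rewrite linear0. Qed.

Lemma vdim_dual X n : vdim (dual X) n = vdim X n.
Proof. by rewrite /vdim /= mxrank_tr. Qed.

Lemma socdim_dual X n : socdim (dual X) n = topdim X n.
Proof. by rewrite /socdim /topdim vdim_dual aout_dual mxrank_tr. Qed.

Lemma topdim_dual X n : topdim (dual X) n = socdim X n.
Proof. by rewrite /socdim /topdim vdim_dual ain_dual mxrank_tr. Qed.

Lemma aout_src X n : coact X (G n) *m aout X n = aout X n.
Proof.
rewrite mulmxDr (coact_src X (A n)); congr (_ + _).
by case: n => [|n]; rewrite ?mulmx0 // (coact_src X (Bb n)).
Qed.

Lemma ain_tgt X n : ain X n *m coact X (G n) = ain X n.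
Proof.
rewrite mulmxDl (coact_tgt X (Bb n)); congr (_ + _).
by case: n => [|n]; rewrite ?mul0mx // (coact_tgt X (A n)).
Qed.

Lemma aoutG X n : aout X n *m coact X (G n.+1) = coact X (A n).
Proof.
rewrite mulmxDl (coact_tgt X (A n)); case: n => [|n]; first by rewrite mul0mx addr0.
by rewrite coact_tgtN ?addr0 //= ; apply/eqP; lia.
Qed.

Lemma aoutGp X n : aout X n.+1 *m coact X (G n) = coact X (Bb n).
Proof.
by rewrite mulmxDl (coact_tgt X (Bb n)) coact_tgtN ?add0r //=; apply/eqP; lia.
Qed.

Lemma socP X n v : reflect (@soc k X n v) (v <= coact X (G n) :&: kermx (aout X n))%MS.
Proof.
apply: (iffP idP) => [|[vG vA vB]].
  rewrite sub_capmx => /andP[/submxP[y Ey] /sub_kermxP va].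
  have vG : v *m coact X (G n) = v by rewrite Ey -mulmxA coactGG.
  split=> // i.
    have [->|ne] := eqVneq i n; first by rewrite -aoutG mulmxA va mul0mx.
    by rewrite -vG -mulmxA coact_srcN 1?eq_sym // mulmx0.
  have [ni|ne] := eqVneq n i.+1; last by rewrite -vG -mulmxA coact_srcN // mulmx0.
  by rewrite ni in va; rewrite -aoutGp mulmxA va mul0mx.
rewrite sub_capmx -{1}vG submxMl /=; apply/sub_kermxP; rewrite mulmxDr vA add0r.
by case: (n) => [|m]; rewrite ?mulmx0.
Qed.

Lemma socdE X n : socdim X n = \rank (coact X (G n) :&: kermx (aout X n))%MS.
Proof. by rewrite /socdim /vdim -(mxrank_mul_ker _ (aout X n)) aout_src addKn. Qed.

(** The [S(n)]-part of the socle of [P] is the image of [D n], and it lies in [X] because [D n] acts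
    as zero on [Y]. *)
Lemma hull_socdim X P Y (j : 'M_(cdim X, cdim P)) (p : 'M_(cdim P, cdim Y)) n :
  is_ses j p -> injective P -> Dfree Y -> Ddim P n = socdim X n.
Proof.
move=> ex iP dY; rewrite socdE /Ddim -(mxrankMfree _ (ses_free ex)).
apply: eqmx_rank; apply/andP; split; apply/row_subP => i.
  have Dp : coact P (D n) *m p = 0 by rewrite (ses_homr ex) dY mulmx0.
  have Ri : row i (coact P (D n)) *m p = 0 by rewrite -row_mul Dp row0.
  have [x Ex] := ses_exact ex Ri.
  rewrite Ex submxMr //; apply/socP; apply: (hom_soc_free (ses_homl ex) (ses_free ex)).
  by rewrite -Ex rowE; apply: soc_D.
rewrite row_mul; have s : soc n (row i (coact X (G n) :&: kermx (aout X n))%MS *m j).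
  by apply: hom_soc (ses_homl ex) _; apply/socP; apply: row_sub.
by have [w ->] := soc_inj iP s; apply: submxMl.
Qed.

Lemma cover_topdim X P Y (j : 'M_(cdim X, cdim P)) (p : 'M_(cdim P, cdim Y)) n :
  is_ses j p -> projective P -> Dfree X -> Ddim P n = topdim Y n.
Proof.
move=> ex pP dX; rewrite -socdim_dual.
rewrite -(hull_socdim n (ses_dual ex) (proj_dual pP) (Dfree_dual dX)).
by rewrite /Ddim /= mxrank_tr.
Qed.

(** A composite of two arrows acts as zero or as some [D m], so in a D-free comodule the radical is
    contained in the socle. *)
Lemma ain_soc X n : Dfree X -> (ain X n <= coact X (G n) :&: kermx (aout X n))%MS.
Proof.
move=> dX; rewrite sub_capmx -{1}ain_tgt submxMl /=; apply/sub_kermxP.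
rewrite /ain /aout mulmxDl !mulmxDr; case: n => [|n].
  by rewrite !mulmx0 !mul0mx coact_coassoc /= ?eqxx ?dX !addr0.
rewrite !coact_coassoc /= !eqxx !dX.
by repeat (case: eqP => _; rewrite ?dX ?addr0 //); rewrite ?addr0.
Qed.

(** A functional that is 1 on [v] and 0 on the arrows arriving at [n], cut down to the vertex [n],
    is a homomorphism to the simple comodule. With [v] it gives a nonzero idempotent, which must be
    the identity. *)
Lemma simple_summand X n (v : 'rV_(cdim X)) : Dfree X -> indecomposable X -> soc n v ->
  ~~ (v <= ain X n)%MS -> iso (simp k n) X.
Proof.
move=> dX indX s /sep_col[xi [vxi axi]]; have [vG _ _] := s.
have hv := soc_simp s.
have vx : v *m (coact X (G n) *m xi) = 1%:M by rewrite mulmxA vG.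
have hxi : hom X (simp k n) (coact X (G n) *m xi).
  move=> c /=; rewrite mul_mx_scalar Bbasis_eqE mulmxA.
  have [nc|ne] := eqVneq n (tgt c); last first.
    by rewrite coact_tgtN // mul0mx; case: c ne => i //= ne; rewrite ?scale0r // eq_sym (negPf ne) scale0r.
  case: c nc => i /= ni.
  - by rewrite ni coactGG eqxx scale1r.
  - rewrite scale0r ni (coact_tgt X (A i)); move: axi; rewrite ni => /(congr1 (mulmx (coact X (G i)))).
    rewrite mulmx0 mulmxA mulmxDr (coact_src X (A i)) coact_srcN ?add0r //=; apply/eqP; lia.
  - rewrite scale0r -ni (coact_tgt X (Bb n)); move: axi => /(congr1 (mulmx (coact X (G n.+1)))).
    rewrite mulmx0 mulmxA mulmxDr (coact_src X (Bb n)).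
    case: (n) => [|m]; first by rewrite mulmx0 addr0.
    by rewrite coact_srcN ?addr0 //=; apply/eqP; lia.
  - by rewrite dX !mul0mx scale0r.
have [||E|E] := indec_idem indX (e := coact X (G n) *m xi *m v).
- exact: homM hxi hv.
- by rewrite mulmxA -(mulmxA (coact X (G n) *m xi)) vx mulmx1.
- have : v *m (coact X (G n) *m xi *m v) *m (coact X (G n) *m xi) = 1%:M.
    by rewrite (mulmxA v) vx mul1mx vx.
  rewrite E mulmx0 mul0mx => /matrixP/(_ 0 0); rewrite !mxE => /esym/eqP.
  by rewrite oner_eq0.
exists v; split=> //; by exists (coact X (G n) *m xi).
Qed.

(** At [n], either the socle exceeds the radical and a simple summand splits off, or both coincide
    and socle and top exhaust the dimension. *)
Lemma indec_layers X n : Dfree X -> indecomposable X ->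
  iso (simp k n) X \/ vdim X n = (socdim X n + topdim X n)%N.
Proof.
move=> dX indX; have le := ain_soc n dX.
have [ge|/not_submx[w nw]] := boolP (coact X (G n) :&: kermx (aout X n) <= ain X n)%MS.
  right; have E : socdim X n = \rank (ain X n).
    by rewrite socdE; apply: eqmx_rank; rewrite ge le.
  rewrite E subnKC // /vdim -ain_tgt; exact: mxrankM_maxr.
left; apply: (simple_summand dX indX _ nw).
by apply/socP; apply: submxMl.
Qed.

Lemma simp_arrow n c : arrow c -> coact (simp k n) c = 0.
Proof.
move=> ac; have -> : coact (simp k n) c = (c == G n)%:R%:M by [].
by rewrite Bbasis_eqE; case: c ac => // i _; rewrite raddf0.
Qed.

Lemma simp_topdim X n : iso (simp k n) X -> forall m, topdim X m = vdim X m.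
Proof.
move=> [f [hf [g [hg [fg gf]]]]] m; rewrite /topdim.
have z c : arrow c -> coact X c = 0.
  by move=> ac; rewrite -[LHS]mul1mx -gf -mulmxA -hf simp_arrow // mul0mx mulmx0.
by rewrite /ain z // add0r; case: (m) => [|l]; rewrite ?z // mxrank0 subn0.
Qed.

Lemma simp_socdim n m : socdim (simp k n) m = (m == n).
Proof.
rewrite /socdim vdim_simp /aout simp_arrow // add0r.
by case: m => [|m]; rewrite ?simp_arrow // mxrank0 subn0.
Qed.

Lemma Inj_Ddim n m : Ddim (Inj k n) m = (m == n).
Proof.
have [X [Z [M [Y [f [g [_ [q exZ] _ _ _]]]]]]] := base_ex k n.
rewrite (hull_socdim m exZ (@injI k n)) ?simp_socdim //.
exact: step_Dfreer (base_stepZ exZ).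
Qed.

Lemma Sz_gdE i m : vdim (Sz k i) m = (i == m%:Z).
Proof.
case: i => n; first by rewrite vdim_simp eqz_nat eq_sym.
by rewrite /vdim dim0_rank.
Qed.

(* The relation [2 [S(n)] + [S(n-1)] + [S(n+1)] = [I_n]] is read off from the
   almost split sequence starting at [rad I_n]. *)
Lemma Inj_dims n m :
  vdim (Inj k n) m = (2 * Ddim (Inj k n) m + pred_seq (Ddim (Inj k n)) m + Ddim (Inj k n) m.+1)%N.
Proof.
have [X [Z [M [Y [f [g [[ka exX] [q exZ] [ex _ _ _ _] BM BY]]]]]]] := base_ex k n.
have := ses_vdim m exX; have := ses_vdim m exZ; have := ses_vdim m ex.
rewrite /vdim (biprod_rank _ BY) (biprod_rank _ BM) -!/(vdim _ _) !Sz_gdE vdim_simp !Inj_Ddim.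
have -> : pred_seq (Ddim (Inj k n)) m = (m == n.+1) by case: m => [|m] //=; rewrite Inj_Ddim eqSS.
lia.
Qed.

(** Both sides are additive, and a nonzero injective splits off some [I_n], so induction on the
    dimension reduces this to [Inj_dims]. *)
Lemma inj_dims P : injective P -> forall m,
  vdim P m = (2 * Ddim P m + pred_seq (Ddim P) m + Ddim P m.+1)%N.
Proof.
have [N] := ubnP (cdim P); elim: N P => // N IH P lt iP m.
have [dP|[n [y ny]]] := DfreeP P.
  have z := Dfree_inj0 iP dP; rewrite /vdim /Ddim !dim0_rank //.
  by case: m => [|m] //=; rewrite dim0_rank.
have [f [r [hf hr fr _]]] := Inj_retract ny.
have he : hom P P (r *m f) := homM hr hf.
have ee : r *m f *m (r *m f) = r *m f by rewrite mulmxA -(mulmxA r) fr mulmx1.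
have [X1 [X2 [i1 [i2 [p1 [p2 [hs es E1 _]]]]]]] := idem_split he ee.
have B : biprod2 P X1 X2 by exists i1, i2, p1, p2.
have [hi1 hi2 hp1 hp2] := hs; have [e1 e2 _ _ _] := es.
have iX : iso X1 (Inj k n).
  exists (i1 *m r); split; first exact: homM hi1 hr.
  exists (f *m p1); split; first exact: homM hf hp1.
  split; first by rewrite mulmxA -(mulmxA i1) -E1 (mulmxA i1 p1) e1 mul1mx e1.
  by rewrite mulmxA -(mulmxA f) E1 mulmxA fr mul1mx fr.
have lt1 : (0 < cdim X1)%N by rewrite (iso_dim iX) /=; case: (n).
have [fB [gB exB]] := biprod_ses B; have dimP := ses_dim exB.
have iX2 : injective X2 := inj_retract iP hi2 hp2 e2.
have lt2 : (cdim X2 < N)%N by lia.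
have H2 := IH _ lt2 iX2.
have H1 l : vdim X1 l = (2 * Ddim X1 l + pred_seq (Ddim X1) l + Ddim X1 l.+1)%N.
  have D1 j : Ddim X1 j = Ddim (Inj k n) j := iso_rank _ iX.
  by rewrite /vdim (iso_rank _ iX) -/(vdim _ _) Inj_dims !D1; case: l => [|l] //=; rewrite D1.
have dP l : Ddim P l = (Ddim X1 l + Ddim X2 l)%N := biprod_rank _ B.
rewrite /vdim (biprod_rank _ B) -!/(vdim _ _) H1 H2 !dP.
by case: m => [|m] /=; rewrite ?dP; lia.
Qed.

(* Summation by parts for the discrete Laplacian on the half-line. *)
Lemma sum_shift N (c u : nat -> nat) : (forall m, N <= m -> u m = 0)%N ->
  (\sum_(m < N.+1) c m * (pred_seq u m + u m.+1) = \sum_(m < N.+1) u m * (c m.+1 + pred_seq c m))%N.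
Proof.
move=> H.
have S1 : (\sum_(m < N.+1) c m * pred_seq u m = \sum_(m < N.+1) u m * c m.+1)%N.
  rewrite big_ord_recl /= muln0 add0n [RHS]big_ord_recr /= H // mul0n addn0.
  by apply: eq_bigr => i _; rewrite mulnC.
have S2 : (\sum_(m < N.+1) c m * u m.+1 = \sum_(m < N.+1) u m * pred_seq c m)%N.
  rewrite big_ord_recr /= H // muln0 addn0 [RHS]big_ord_recl /= muln0 add0n.
  by apply: eq_bigr => i _; rewrite mulnC.
under eq_bigr do rewrite mulnDr.
by rewrite big_split /= S1 S2 -big_split; apply: eq_bigr => i _; rewrite mulnDr.
Qed.

Definition wsum N (u : nat -> nat) := (\sum_(m < N) m.+1 * u m)%N.
Definition weight X := wsum (cbound X) (vdim X).

Lemma wsum_ge N M (u : nat -> nat) : (N <= M)%N -> (forall m, N <= m -> u m = 0)%N ->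
  wsum M u = wsum N u.
Proof.
move=> le H; rewrite /wsum (big_ord_widen M (fun m => m.+1 * u m)%N le) [RHS]big_mkcond /=.
by apply: eq_bigr => i _; case: ltnP => // /H ->; rewrite muln0.
Qed.

Lemma vdim_fin X m : (cbound X <= m)%N -> vdim X m = 0%N.
Proof. exact: (@rank_coact_fin X (G m)). Qed.

Lemma weight_ge X N : (cbound X <= N)%N -> wsum N (vdim X) = weight X.
Proof. by move=> le; apply: wsum_ge => // m; apply: vdim_fin. Qed.

Lemma weight_ses X Y Z (f : 'M_(cdim X, cdim Y)) (g : 'M_(cdim Y, cdim Z)) :
  is_ses f g -> weight Y = (weight X + weight Z)%N.
Proof.
move=> ex; pose N := maxn (cbound X) (maxn (cbound Y) (cbound Z)).
rewrite -(@weight_ge X N) ?leq_maxl // -(@weight_ge Y N) ?leq_max ?leqnn ?orbT //.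
rewrite -(@weight_ge Z N) ?leq_max ?leqnn ?orbT // -big_split /=.
by apply: eq_bigr => i _; rewrite (ses_vdim _ ex) mulnDr.
Qed.

Lemma weight_iso X Y : iso X Y -> weight X = weight Y.
Proof.
move=> i; rewrite -(weight_ge (leq_maxl (cbound X) (cbound Y))) -(weight_ge (leq_maxr (cbound X) (cbound Y))).
by apply: eq_bigr => m _; rewrite /vdim (iso_rank _ i).
Qed.

Lemma weight_biprod Y X1 X2 : biprod2 Y X1 X2 -> weight Y = (weight X1 + weight X2)%N.
Proof.
move=> B; pose N := maxn (cbound X1) (maxn (cbound Y) (cbound X2)).
rewrite -(@weight_ge X1 N) ?leq_maxl // -(@weight_ge Y N) ?leq_max ?leqnn ?orbT //.
rewrite -(@weight_ge X2 N) ?leq_max ?leqnn ?orbT // -big_split /=.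
by apply: eq_bigr => i _; rewrite /vdim (biprod_rank _ B) mulnDr.
Qed.

Lemma weight_eq0 X : weight X = 0%N -> cdim X = 0%N.
Proof.
move=> /eqP; rewrite sum_nat_eq0 => /forallP H; apply: vdim_dim0 => m.
have [lt|/vdim_fin //] := ltnP m (cbound X).
by have := H (Ordinal lt); rewrite /= muln_eq0 /= => /eqP.
Qed.

Lemma weight_dim0 X : cdim X = 0%N -> weight X = 0%N.
Proof. by move=> z; apply: big1 => i _; rewrite /vdim dim0_rank ?muln0. Qed.

Lemma weight_simp n : weight (simp k n) = n.+1.
Proof.
rewrite /weight /wsum big_ord_recr /= vdim_simp eqxx muln1 big1 // => i _.
by rewrite vdim_simp ltn_eqF ?muln0.
Qed.

Lemma socdim_fin X m : (cbound X <= m)%N -> socdim X m = 0%N.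
Proof. by move=> le; rewrite /socdim vdim_fin. Qed.

Lemma topdim_fin X m : (cbound X <= m)%N -> topdim X m = 0%N.
Proof. by move=> le; rewrite /topdim vdim_fin. Qed.

(** The rank of [D m] on [P] is the multiplicity of [S(m)] both in the socle of [X], whose hull is
    [P], and in the top of [Y], whose cover is [P]. *)
Lemma step_dims X Y m : step X Y ->
  [/\ (vdim X m + vdim Y m = 2 * socdim X m + pred_seq (socdim X) m + socdim X m.+1)%N & topdim Y m = socdim X m].
Proof.
move=> [P [j [p [ex pP dX dY]]]]; have iP := proj_inj pP.
have E l : Ddim P l = socdim X l := hull_socdim l ex iP dY.
split; last by rewrite -(cover_topdim m ex pP dX).
by rewrite -(ses_vdim m ex) inj_dims // !E; case: m => [|m] //=; rewrite E.
Qed.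

(* [I_n] has weight [4 (n+1)]. *)
Lemma weight_step X Y N : step X Y -> (cbound X <= N)%N -> (weight X + weight Y = 4 * wsum N (socdim X))%N.
Proof.
move=> s le; pose M := maxn N (cbound Y).
have lM : (N <= M)%N by apply: leq_maxl.
have cX : (cbound X <= M.+1)%N by apply: leq_trans le (leq_trans lM _).
have cY : (cbound Y <= M.+1)%N by apply: leq_trans (leq_maxr N _) _.
rewrite -(weight_ge cX) -(weight_ge cY).
have sf m : (N <= m)%N -> socdim X m = 0%N by move=> h; apply/socdim_fin/(leq_trans le h).
rewrite -(wsum_ge (leq_trans lM (leqnSn M)) sf) -big_split /=.
under eq_bigr => m _ do rewrite -mulnDr (step_dims m s).1 -addnA mulnDr.
rewrite big_split /= sum_shift; last by move=> m h; apply: sf; apply: leq_trans h.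
rewrite /wsum -big_split big_distrr /=; apply: eq_bigr => m _.
by case: (m : nat) => [|l] /=; lia.
Qed.

(** In units of [n+1], let [w_j] be the weight of the comodule and [u_j] that of its socle. Then
    [w_j + w_(j+1) = 4 u_j] and [w_(j+1) = u_(j+1) + u_j], with both equal to 1 at [j = 0]. *)
Lemma OmegaS_indec_weight n j : exists X, [/\ OmegaS (- j%:Z) n%:Z X, indecomposable X,
  weight X = ((2 * j).+1 * n.+1)%N &
  forall N, (cbound X <= N)%N -> wsum N (socdim X) = (j.+1 * n.+1)%N].
Proof.
elim: j => [|j [X [oX indX wX uX]]].
  exists (simp k n); split; [exact/OmegaS0/iso_refl | exact: indec_simp | |].
    by rewrite weight_simp mul1n.
  move=> N le; rewrite mul1n -(weight_simp n) -(weight_ge le).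
  by apply: eq_bigr => m _; rewrite simp_socdim vdim_simp.
have [Y s] := step_ex_up (OmegaS_Dfree oX); exists Y.
have dY := step_Dfreer s; have indY := step_indec_up s indX.
have wY : weight Y = ((2 * j.+1).+1 * n.+1)%N.
  have := weight_step s (leqnn _); rewrite uX // wX; lia.
split=> //.
  by have := OmegaS_up oX s; rewrite -opprD -PoszD addn1.
move=> N le; pose M := maxn N (cbound X).
have tY : wsum M (topdim Y) = (j.+1 * n.+1)%N.
  rewrite -(uX M) ?leq_maxr //; apply: eq_bigr => m _.
  by rewrite (step_dims m s).2.
have lY : (cbound Y <= M)%N by apply: leq_trans le (leq_maxl _ _).
have tight m : vdim Y m = (socdim Y m + topdim Y m)%N.
  (* A simple [Y] would have its whole weight in the top, that is [j+1] instead of [2j+3] times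
     [n+1]. *)
  have [iY|//] := indec_layers m dY indY.
  have : wsum M (topdim Y) = weight Y.
    by rewrite -(weight_ge lY); apply: eq_bigr => l _; rewrite (simp_topdim iY).
  rewrite tY wY; nia.
have : wsum M (vdim Y) = (wsum M (socdim Y) + wsum M (topdim Y))%N.
  by rewrite -big_split; apply: eq_bigr => m _; rewrite tight mulnDr.
rewrite (weight_ge lY) wY tY (wsum_ge (leq_maxl N (cbound X))); first by lia.
by move=> m h; apply/socdim_fin/(leq_trans le).
Qed.

Lemma OmegaS_zero i X : OmegaS i (Negz 0) X -> cdim X = 0%N.
Proof.
have z : step (zero_comod k) (zero_comod k).
  exists (zero_comod k), 0, 0; split; try exact: Dfree0.
    by apply: sesI_dim; rewrite ?mulmx0 ?/row_free ?/row_full ?mxrank0 //; exact: hom0.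
  by apply: inj_proj; apply: inj0.
have O : OmegaS i (Negz 0) (zero_comod k).
  have O0 : OmegaS 0 (Negz 0) (zero_comod k) by apply/OmegaS0; apply: iso_refl.
  case: i => n; first by elim: n => // n IH; have := OmegaS_down IH z; rewrite -PoszD addn1.
  elim: n => [|n IH]; first by have := OmegaS_up O0 z.
  by have := OmegaS_up IH z; rewrite !NegzE -opprD -PoszD addn1.
by move=> oX; rewrite -(iso_dim (OmegaS_uniq O oX)).
Qed.

(** The index [n - 1] lets the formula cover [S(-1) = 0], of weight 0. *)
Lemma OmegaS_weight j n X : OmegaS (- j%:Z) (n%:Z - 1) X -> weight X = ((2 * j).+1 * n)%N.
Proof.
case: n => [|n].
  by rewrite sub0r => /OmegaS_zero/weight_dim0 ->; rewrite muln0.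
rewrite -addn1 PoszD addrK addn1 => oX.
have [X' [oX' _ <- _]] := OmegaS_indec_weight n j.
exact: weight_iso (OmegaS_uniq oX oX').
Qed.

End Dims.

(** * Uniqueness and duality of almost split sequences *)

Section AlmostSplit.
Variable k : fieldType.
Implicit Types X Y Z U V W P Q E : comod k.

Lemma almost_split_iso X X' Y Z Z' (f : 'M_(cdim X, cdim Y)) (g : 'M_(cdim Y, cdim Z)) 
    (a : 'M_(cdim X', cdim X)) (c : 'M_(cdim Z, cdim Z')) :
  almost_split f g -> is_iso a -> is_iso c -> @almost_split k X' Y Z' (a *m f) (g *m c).
Proof.
move=> [ex indX indZ ns H] Ia Ic; have [ha [a' [ha' [aa' a'a]]]] := Ia.
have I1 := unit_iso (hom1 Y) (unitmx1 _ _).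
split.
- have := ses_transport ex Ia I1 I1 (mulmx1 _) Ic; by rewrite mulmx1 mul1mx.
- by apply: (indec_iso _ indX); apply: iso_sym; exists a.
- by apply: (indec_iso _ indZ); exists c.
- move=> [r [hr E]]; apply: ns; exists (r *m a); split; first exact: homM hr ha.
  by rewrite -[f]mul1mx -a'a -!mulmxA (mulmxA f) (mulmxA a) (mulmxA a) E mul1mx.
move=> U u hu nu; have [||h [hh E]] := H U (a' *m u); first exact: homM ha' hu.
  move=> [r [hr E]]; apply: nu; exists (r *m a'); split; first exact: homM hr ha'.
  have -> : u = a *m (a' *m u) by rewrite mulmxA aa' mul1mx.
  by rewrite -mulmxA (mulmxA _ r) E mul1mx.
exists h; split=> //; by rewrite -mulmxA E mulmxA aa' mul1mx.
Qed.

Section EndSes.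
Variables (X Y Z : comod k) (f : 'M[k]_(cdim X, cdim Y)) (g : 'M[k]_(cdim Y, cdim Z)).
Hypotheses (ex : is_ses f g) (ns : ~ split_mono f) (indZ : indecomposable Z).

Lemma ses_split_l (s : 'M_(cdim Y)) : hom Y Y s -> f *m s = f -> s *m g = 0 -> False.
Proof.
move=> hs fs sg; have [r hr E] := ses_liftl ex hs sg.
apply: ns; exists r; split=> //; apply: (row_free_inj (ses_free ex)).
by rewrite -mulmxA E fs mul1mx.
Qed.

(** If [t ^+ n] were zero, [s ^+ n] would fix [f] and be killed by [g]; it would take values in [X]
    and yield a retraction of [f]. *)
Lemma ses_end_unit (s : 'M_(cdim Y)) (t : 'M_(cdim Z)) :
  hom Y Y s -> hom Z Z t -> f *m s = f -> g *m t = s *m g -> @is_iso k Z Z t.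
Proof.
move=> hs ht fs gt; have [[n tn]|] := indec_local indZ ht; last exact: unit_iso.
have fsn : f *m s ^+ n = f.
  by elim: (n) => [|m IH]; rewrite ?mulmx1 // exprS mulmxA fs.
have gtn : g *m t ^+ n = s ^+ n *m g.
  elim: (n) => [|m IH]; first by rewrite !expr0 mulmx1 mul1mx.
  by rewrite !exprS mulmxA gt -mulmxA IH mulmxA.
by case: (@ses_split_l (s ^+ n)) => //; [exact: homX | rewrite -gtn tn mulmx0].
Qed.
End EndSes.

(** Each left map factors through the other. The induced maps between the right ends compose to
    endomorphisms covering the identity on the left, which are invertible by [ses_end_unit]. *)
Lemma almost_split_uniq X Y Z X' Y' Z' (f : 'M_(cdim X, cdim Y)) (g : 'M_(cdim Y, cdim Z))
    (f' : 'M_(cdim X', cdim Y')) (g' : 'M_(cdim Y', cdim Z')) :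
  almost_split f g -> almost_split f' g' -> iso X X' -> ses_iso f g f' g'.
Proof.
move=> [ex indX indZ ns H] [ex' indX' indZ' ns' H'] [a Ia].
have [ha [b [hb [ab ba]]]] := Ia.
have hf := ses_homl ex; have hf' := ses_homl ex'.
have hg := ses_homr ex; have hg' := ses_homr ex'.
have [||h [hh Eh]] := H _ (a *m f'); first exact: homM ha hf'.
  move=> [r [hr E]]; apply: ns'; exists (r *m a); split; first exact: homM hr ha.
  by rewrite -[f']mul1mx -ba -!mulmxA (mulmxA f') (mulmxA a) (mulmxA a) E mul1mx.
have [||h' [hh' Eh']] := H' _ (b *m f); first exact: homM hb hf.
  move=> [r [hr E]]; apply: ns; exists (r *m b); split; first exact: homM hr hb.
  by rewrite -[f]mul1mx -ab -!mulmxA (mulmxA f) (mulmxA b) (mulmxA b) E mul1mx.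
have [|c hc Ec] := ses_liftr ex (homM hh hg').
  by rewrite mulmxA Eh -mulmxA (ses_comp0 ex') mulmx0.
have [|c' hc' Ec'] := ses_liftr ex' (homM hh' hg).
  by rewrite mulmxA Eh' -mulmxA (ses_comp0 ex) mulmx0.
have I1 : @is_iso k Z Z (c *m c').
  apply: (ses_end_unit ex ns indZ (homM hh hh') (homM hc hc')).
    by rewrite mulmxA Eh -mulmxA Eh' mulmxA ab mul1mx.
  by rewrite mulmxA Ec -mulmxA Ec' mulmxA.
have I2 : @is_iso k Z' Z' (c' *m c).
  apply: (ses_end_unit ex' ns' indZ' (homM hh' hh) (homM hc' hc)).
    by rewrite mulmxA Eh' -mulmxA Eh mulmxA ba mul1mx.
  by rewrite mulmxA Ec' -mulmxA Ec mulmxA.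
have Ic : is_iso c.
  apply: full_free_iso => //.
    exact: free_compl (iso_free I1).
  exact: full_compr (iso_full I2).
have Ih : is_iso h.
  apply: dimle_iso => //.
    apply: row_freeV0 => v vh.
    have vg : v *m g = 0.
      by apply: (free_eq0 (iso_free Ic)); rewrite -mulmxA Ec mulmxA vh mul0mx.
    have [x Ex] := ses_exact ex vg.
    rewrite Ex (_ : x = 0) ?mul0mx //.
    apply: (free_eq0 (iso_free Ia)); apply: (free_eq0 (ses_free ex')).
    by rewrite -mulmxA -Eh mulmxA -Ex.
  rewrite -(ses_dim ex) -(ses_dim ex') (@iso_dim k X X') ?(@iso_dim k Z Z') //; [by exists c | by exists a].
by exists a, h, c.
Qed.

(** The sequence is pulled back along [v]. If the pullback splits, [v] lifts to [Y]. Otherwise its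
    left map factors through [f], and the induced map [z] from [Z] to [V] makes [z *m v] invertible,
    so that [v] would be a split epimorphism. *)
Lemma almost_split_right X Y Z (f : 'M_(cdim X, cdim Y)) (g : 'M_(cdim Y, cdim Z)) V
    (v : 'M_(cdim V, cdim Z)) :
  almost_split f g -> hom V Z v ->
  ~ (exists s : 'M_(cdim Z, cdim V), hom Z V s /\ s *m v = 1%:M) ->
  exists h : 'M_(cdim V, cdim Y), hom V Y h /\ h *m g = v.
Proof.
move=> [ex indX indZ ns H] hv nv; have hf := ses_homl ex; have hg := ses_homr ex.
have [T [i1 [i2 [p1 [p2 [[hi1 hi2 hp1 hp2] [e1 e2 e12 e21 e]]]]]]] := dsum_ex Y V.
have hd : hom T Z (p1 *m g - p2 *m v) by apply: homB; [exact: homM hp1 hg | exact: homM hp2 hv].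
have [W [w [hw fw Ew]]] := ker_ex hd.
have wgv : w *m p1 *m g = w *m p2 *m v.
  apply/eqP; rewrite -subr_eq0 -!mulmxA -mulmxBr; apply/eqP/sub_kermxP.
  by rewrite Ew.
have [fW hfW EfW] : exists2 fW : 'M_(cdim X, cdim W), hom X W fW & fW *m w = f *m i1.
  apply: factor_mono => //; first exact: homM hf hi1.
  rewrite Ew; apply/sub_kermxP.
  rewrite mulmxBr !mulmxA -!(mulmxA f i1) e1 e12 mulmx1 mulmx0 mul0mx subr0; exact: ses_comp0 ex.
have fW1 : fW *m (w *m p1) = f by rewrite mulmxA EfW -mulmxA e1 mulmx1.
have fW2 : fW *m (w *m p2) = 0 by rewrite mulmxA EfW -mulmxA e12 mulmx0.
have exW : is_ses fW (w *m p2).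
  apply: sesI => //.
  - exact: homM hw hp2.
  - by apply: (@free_compl _ _ _ _ _ (w *m p1)); rewrite fW1 (ses_free ex).
  - have /row_fullP[g' gg] := ses_full ex.
    have : ((v *m g' *m i1 + i2)%R <= w)%MS.
      rewrite Ew; apply/sub_kermxP; rewrite mulmxBr !mulmxDl !mulmxA.
      rewrite -!(mulmxA _ i1) e1 e12 e21 e2 !mulmx1 !mulmx0 !mul0mx mul1mx -(mulmxA v) gg.
      by rewrite mulmx1 ?addr0 ?add0r subrr.
    move=> /submxP[s Es]; apply/row_fullP; exists s.
    by rewrite mulmxA -Es mulmxDl -!mulmxA e12 e2 !mulmx0 add0r.
  move=> x xw; have x1 : x *m w *m p1 *m g = 0.
    by rewrite -(mulmxA x) -(mulmxA x) wgv !mulmxA -(mulmxA x) xw mul0mx.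
  have [y Ey] := ses_exact ex x1; apply/submxP; exists y.
  apply: (row_free_inj fw); rewrite -mulmxA EfW -[x *m w]mulmx1 -e mulmxDr !mulmxA Ey.
  by rewrite -(mulmxA x) xw mul0mx addr0.
have [[r [hr Er]]|nsW] := classic (split_mono fW).
  have hrf : hom W W (1%:M - r *m fW) by apply: homB; [exact: hom1 | exact: homM hr hfW].
  have [|s hs Es] := ses_liftr exW hrf.
    by rewrite mulmxBr mulmx1 mulmxA Er mul1mx subrr.
  have sp : s *m (w *m p2) = 1%:M.
    apply: (row_full_inj (ses_full exW)).
    by rewrite (mulmxA (w *m p2)) Es mulmxBl -(mulmxA r) fW2 mulmx0 subr0 mulmx1 mul1mx.
  exists (s *m (w *m p1)); split; first exact: homM hs (homM hw hp1).
  by rewrite -mulmxA wgv mulmxA sp mul1mx.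
have [h [hh Eh]] := H W fW hfW nsW.
have [|z hz Ez] := ses_liftr ex (homM hh (ses_homr exW)).
  by rewrite mulmxA Eh fW2.
case: nv.
have [_ [t [ht [_ tz]]]] : @is_iso k Z Z (z *m v).
  apply: (ses_end_unit ex ns indZ (homM hh (homM hw hp1)) (homM hz hv)).
    by rewrite mulmxA Eh fW1.
  by rewrite mulmxA Ez -!mulmxA (mulmxA w) -wgv !mulmxA.
by exists (t *m z); split; [exact: homM ht hz | rewrite -mulmxA].
Qed.

(** The factorization property in the definition concerns the left map only; its dual concerns the
    right map, which is [almost_split_right]. *)
Lemma almost_split_dual X Y Z (f : 'M_(cdim X, cdim Y)) (g : 'M_(cdim Y, cdim Z)) :
  almost_split f g -> @almost_split k (dual Z) (dual Y) (dual X) g^T f^T.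
Proof.
move=> as0; have [ex indX indZ ns H] := as0; split.
- exact: ses_dual.
- exact: indec_dual.
- exact: indec_dual.
- move=> [r [hr E]]; have hr' := hom_trK hr.
  have rg : r^T *m g = 1%:M by rewrite -[g]trmxK -trmx_mul E trmx1.
  apply: (ses_split_l ex ns (s := 1%:M - g *m r^T)).
  + by apply: homB; [exact: hom1 | exact: homM (ses_homr ex) hr'].
  + by rewrite mulmxBr mulmx1 mulmxA (ses_comp0 ex) mul0mx subr0.
  + by rewrite mulmxBl mul1mx -mulmxA rg mulmx1 subrr.
move=> U u hu nu; have [|h [hh E]] := almost_split_right as0 (hom_trl hu).
  move=> [s [hs E]]; apply: nu; exists s^T; split; first exact: hom_trr.
  by rewrite -[u]trmxK -trmx_mul E trmx1.
exists h^T; split; first exact: hom_trl hh.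
by rewrite -trmx_mul E trmxK.
Qed.

(** * The almost split sequences *)

Definition AR_seq_ex (n : nat) (i : int) := exists (X Y Z A C E : comod k)
    (f : 'M[k]_(cdim X, cdim Y)) (g : 'M[k]_(cdim Y, cdim Z)),
  [/\ OmegaS (i + 1) n%:Z X, OmegaS (i - 1) n%:Z Z, OmegaS i (n%:Z - 1) A, OmegaS i (n%:Z + 1) C & IsE n i E] /\
  almost_split f g /\ biprod3 Y A C E.

Lemma AR_seq_ex_0 n : AR_seq_ex n 0.
Proof.
have [X [Z [M [Y [f [g [[ka exX] [q exZ] as0 BM BY]]]]]]] := base_ex k n.
have O0 : OmegaS 0 n%:Z (simp k n) by apply/OmegaS0; exact: iso_refl.
exists X, Y, Z, (Sz k (n%:Z - 1)), (Sz k (n%:Z + 1)), (Inj k n), f, g; split; last first.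
  by split=> //; exists M.
split.
- exact: OmegaS_down O0 (base_stepX exX).
- exact: OmegaS_up O0 (base_stepZ exZ).
- by apply/OmegaS0; exact: iso_refl.
- by apply/OmegaS0; exact: iso_refl.
- by rewrite /IsE eqxx; apply/IsI_iso/iso_refl.
Qed.

Lemma AR_seq_ex_dual n i : i != 0 -> AR_seq_ex n i -> AR_seq_ex n (- i).
Proof.
move=> ni [X [Y [Z [A [C [E [f [g [[oX oZ oA oC IE] [as0 [W [BW BY]]]]]]]]]]]].
exists (dual Z), (dual Y), (dual X), (dual A), (dual C), (dual E), g^T, f^T; split.
  split; try exact: OmegaS_dual.
  - by have := OmegaS_dual oZ; rewrite opprB addrC.
  - by have := OmegaS_dual oX; rewrite opprD.
  - by move: IE; rewrite /IsE oppr_eq0 (negPf ni).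
split; first exact: almost_split_dual.
by exists (dual W); split; apply: biprod_dual.
Qed.

Lemma IsE_injective n i E : IsE n i E -> injective E.
Proof.
rewrite /IsE; case: eqP => _; last exact: inj0.
by move/IsI_iso => iE; apply: inj_iso iE (@injI k n).
Qed.

(* Applying [Omega^-1] to an almost split sequence: the middle term is computed
   up to an injective summand, which vanishes by comparing weights. *)
Section Up.
Variables (X Y Z A C E X' Z' A' C' : comod k).
Variables (f : 'M[k]_(cdim X, cdim Y)) (g : 'M[k]_(cdim Y, cdim Z)).
Hypotheses (as0 : almost_split f g) (BY : biprod3 Y A C E) (iE : injective E).
Hypotheses (sX : step X X') (sZ : step Z Z') (sA : step A A') (sC : step C C').
Hypothesis wts : (weight X' + weight Z' = weight A' + weight C')%N.

Lemma almost_split_up : exists (V : comod k) (f' : 'M[k]_(cdim X', cdim V)) (g' : 'M[k]_(cdim V, cdim Z')),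
  almost_split f' g' /\ biprod3 V A' C' (zero_comod k).
Proof.
have [ex indX indZ ns H] := as0; have hf := ses_homl ex; have hg := ses_homr ex.
have [EX [jX [pX [exX prX dX dX']]]] := sX.
have [EZ [jZ [pZ [exZ prZ dZ dZ']]]] := sZ.
have [EA [jA [pA [exA prA dA dA']]]] := sA.
have [EC [jC [pC [exC prC dC dC']]]] := sC.
have [W [BW BYW]] := BY.
have [W' BW'] := dsum_ex A' C'; have [R BR] := dsum_ex EA EC.
have [fR [gR exR]] := ses_sum exA exC BW BR BW'.
have [V BV] := dsum_ex W' (zero_comod k); have [Hh BH] := dsum_ex R E.
have exE : @is_ses k E E (zero_comod k) 1%:M 0.
  apply: sesI_dim; rewrite ?row_free_unit ?unitmx1 ?mulmx0 /row_full ?mxrank0 ?addn0 //.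
    exact: hom1.
  exact: hom0.
have [fY [gY exY]] := ses_sum exR exE BYW BH BV.
have iH : injective Hh by apply: (inj_sum BH) => //; apply: (inj_sum BR); apply: proj_inj.
have dV : Dfree V by apply: (Dfree_sum BV); [exact: Dfree_sum BW' _ _ | exact: Dfree0].
have [J BJ] := dsum_ex EX EZ.
have iJ : injective J by apply: (inj_sum BJ); apply: proj_inj.
have [i1 [i2 [p1 [p2 [[hi1 hi2 hp1 hp2] [e1 e2 e12 e21 e]]]]]] := BJ.
have [eh [heh Eeh]] := proj_inj prX hf (ses_free ex) (ses_homl exX).
(* As in the horseshoe lemma, [Y] is embedded into the sum of the hulls of [X] and [Z]; the
   component in [EX] extends [jX] along [f]. *)
pose y := eh *m i1 + g *m jZ *m i2.
have hy : hom Y J y.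
  by apply: homD; [exact: homM heh hi1 | exact: homM (homM hg (ses_homl exZ)) hi2].
have y1 : y *m p1 = eh by rewrite mulmxDl -!mulmxA e1 e21 !mulmx0 addr0 mulmx1.
have y2 : y *m p2 = g *m jZ by rewrite mulmxDl -!mulmxA e12 e2 !mulmx0 add0r mulmx1.
have fy : f *m y = jX *m i1.
  by rewrite mulmxDr !mulmxA Eeh (ses_comp0 ex) !mul0mx addr0.
have ker_y m (v : 'M_(m, cdim Y)) : v *m g *m jZ = 0 -> exists2 x, v = x *m f & v *m eh = x *m jX.
  move=> vg; have {}vg := free_eq0 (ses_free exZ) vg.
  by have [x ->] := ses_exact ex vg; exists x => //; rewrite -mulmxA Eeh.
have fry : row_free y.
  apply: row_freeV0 => v vy; have [|x Ex Ex'] := ker_y _ v.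
    by rewrite -mulmxA -y2 mulmxA vy mul0mx.
  rewrite Ex (_ : x = 0) ?mul0mx //; apply: (free_eq0 (ses_free exX)).
  by rewrite -Ex' -y1 mulmxA vy mul0mx.
have [s [hs Es]] := iJ _ _ _ _ (ses_homl exY) (ses_free exY) hy.
(* [Hh] is an injective hull of [Y] because [V] is D-free, so [s] is injective. By [wts] its
   cokernel has weight zero, which excludes a further injective summand. *)
have Is : is_iso s.
  have [_ _ _ ess] : inj_hull fY.
    apply/hullP; split=> //; [exact: ses_homl exY | exact: ses_free exY |].
    by move=> n; rewrite (eqmxP (ses_ker exY)); apply/sub_kermxP; rewrite (ses_homr exY) dV mulmx0.
  have frs : row_free s by apply: (ess _ _ hs); rewrite Es.
  have [K [q exK]] := ses_coker_ex hs frs.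
  apply: dimle_iso => //; rewrite -(ses_dim exK) (@weight_eq0 k K) ?addn0 //.
  have [fb [gb exJ]] := biprod_ses BJ.
  have := weight_ses exK; have := weight_ses exY; have := weight_ses exJ; have := weight_ses ex.
  have := weight_ses exX; have := weight_ses exZ; have := weight_biprod BV; have := weight_biprod BW'.
  rewrite (@weight_dim0 k (zero_comod k)) //; lia.
have [_ [s' [hs' [ss' s's]]]] := Is.
pose qJ := s' *m gY.
have exJ : is_ses y qJ.
  have I1 Q := unit_iso (hom1 Q) (unitmx1 _ _).
  have Is' : is_iso s' by split=> //; exists s.
  have := ses_transport exY (I1 Y) Is Is' ss' (I1 V).
  by rewrite mul1mx mulmx1 Es.
have hq := ses_homr exJ.
have [|f' hf' Ef'] := ses_liftr exX (homM hi1 hq).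
  by rewrite mulmxA -fy -mulmxA (ses_comp0 exJ) mulmx0.
have [|g' hg' Eg'] := ses_liftr exJ (homM hp2 (ses_homr exZ)).
  by rewrite mulmxA y2 -mulmxA (ses_comp0 exZ) mulmx0.
exists V, f', g'; split; last by exists W'.
have ex' : is_ses f' g'.
  apply: sesI_dim => //.
  - apply: row_freeV0 => v vf.
    have /submxP[w Ew] : (v <= pX)%MS := submx_full _ (ses_full exX).
    have [|t Et] := @ses_exact _ _ _ _ _ _ exJ _ (w *m i1).
      by rewrite -mulmxA -Ef' mulmxA -Ew.
    have [|x Ex Ex'] := ker_y _ t.
      by rewrite -mulmxA -y2 mulmxA -Et -mulmxA e12 mulmx0.
    have : w = x *m jX by rewrite -Ex' -y1 mulmxA -Et -mulmxA e1 mulmx1.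
    by move=> wE; rewrite Ew wE -mulmxA (ses_comp0 exX) mulmx0.
  - apply: (@full_compr _ _ _ _ qJ); rewrite Eg' full_comp ?(ses_full exZ) //.
    by apply/row_fullP; exists i2.
  - apply: (full_eq0 (ses_full exX)).
    by rewrite mulmxA Ef' -mulmxA Eg' mulmxA e12 mul0mx.
  - have [fb [gb exB]] := biprod_ses BJ.
    have := ses_dim exB; have := ses_dim exJ; have := ses_dim ex.
    have := ses_dim exX; have := ses_dim exZ; lia.
have prJ := inj_proj iJ.
have mf : ses_mor jX pX y qJ f i1 f' by split.
have indX' := step_indec_up sX indX.
split=> //.
- exact: step_indec_up sZ indZ.
- move=> sp; apply: ns; exact: (split_left exX exJ prX prJ mf indX dX sp).
move=> U' u' hu' nu'.
(* The test map is lowered to a map from [X] to [U], factored there through [f], and raised again.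
   The error factors through the injective [Q], hence extends along [f']. *)
have [Q [q [prQ hqQ fq _]]] := cover_ex U'.
have [U [jU exU]] := ses_ker_ex hqQ fq.
have [u [uh mu]] := lift_down exX exU prX hu'.
have [hu _ _ _ _] := mu.
have [|h [hh Eh]] := H U u hu.
  by move=> sp; apply: nu'; exact: (split_right exX exU prX mu indX' dX' sp).
have [hhat [h' mh]] := lift_up exJ exU (proj_inj prQ) hh.
have [_ _ hh' _ _] := mh.
have [|d hd Ed] := mor_right0 exX (mor_sub mu (mor_comp mf mh)); first by rewrite Eh subrr.
have [d' [hd' Ed']] := proj_inj prQ hf' (ses_free ex') hd.
exists (h' + d' *m q); split; first exact: homD hh' (homM hd' hqQ).
by rewrite mulmxDr mulmxA Ed' -Ed addrC subrK.
Qed.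
End Up.

Lemma AR_seq_ex_up n j : AR_seq_ex n (- j%:Z) -> AR_seq_ex n (- j.+1%:Z).
Proof.
move=> [X [Y [Z [A [C [E [f [g [[oX oZ oA oC IE] [as0 BY]]]]]]]]]].
have iJ : - j%:Z - 1 = - j.+1%:Z by rewrite -opprD -PoszD addn1.
have [X' sX] := step_ex_up (OmegaS_Dfree oX); have [Z' sZ] := step_ex_up (OmegaS_Dfree oZ).
have [A' sA] := step_ex_up (OmegaS_Dfree oA); have [C' sC] := step_ex_up (OmegaS_Dfree oC).
have oX' := OmegaS_up oX sX; have oZ' := OmegaS_up oZ sZ.
have oA' := OmegaS_up oA sA; have oC' := OmegaS_up oC sC.
rewrite iJ in oA' oC'; rewrite addrK in oX'; rewrite iJ in oZ'.
have E1 : n%:Z = n.+1%:Z - 1 by rewrite -addn1 PoszD addrK.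
have E2 : n%:Z + 1 = n.+2%:Z - 1 by rewrite -[n.+2]addn1 PoszD addrK -PoszD addn1.
(* In the weights, [(2j+1) + (2j+5) = 2 (2j+3)] on the outer terms matches [n + (n+2) = 2 (n+1)] on
   the middle ones. *)
have wts : (weight X' + weight Z' = weight A' + weight C')%N.
  have -> : weight X' = ((2 * j).+1 * n.+1)%N by apply: OmegaS_weight; rewrite -E1.
  have -> : weight Z' = ((2 * j.+2).+1 * n.+1)%N.
    by apply: OmegaS_weight; rewrite -E1 -[j.+2]addn1 PoszD opprD.
  have -> : weight A' = ((2 * j.+1).+1 * n)%N by apply: OmegaS_weight.
  have -> : weight C' = ((2 * j.+1).+1 * n.+2)%N by apply: OmegaS_weight; rewrite -E2.
  by nia.
have [V [f' [g' [as' BV]]]] := almost_split_up as0 BY (IsE_injective IE) sX sZ sA sC wts.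
exists X', V, Z', A', C', (zero_comod k), f', g'; split=> //; split=> //.
by rewrite -iJ subrK.
Qed.

Lemma AR_seq_ex_all n i : AR_seq_ex n i.
Proof.
have neg j : AR_seq_ex n (- j%:Z).
  by elim: j => [|j IH]; [rewrite oppr0; apply: AR_seq_ex_0 | apply: AR_seq_ex_up].
case: i => [[|j]|j]; [exact: AR_seq_ex_0 | | by rewrite NegzE].
by rewrite -[j.+1%:Z]opprK; apply: AR_seq_ex_dual.
Qed.

End AlmostSplit.

(** * The discrete wave equation on an interval *)

Definition concave K m := (m.+1 * (K - m))%N.
Definition energy K (u : nat -> nat) := (\sum_(m < K.+1) concave K m * u m)%N.

Section Wave.
(** [t], [u] and [u'] are three consecutive states of the wave. The bound [K] limits the support of
    [u] and also the weight of [t]. *)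
Variables (K : nat) (t u u' : nat -> nat).
Hypothesis wave : forall m, (u' m + t m = pred_seq u m + u m.+1)%N.
Hypothesis supp : forall m, (K <= m)%N -> u m = 0%N.
Hypothesis wut : (wsum K.+1 u <= wsum K.+1 t)%N.
Hypothesis wtK : (wsum K.+1 t <= K)%N.

Lemma wave_wsum : (wsum K.+1 u' + wsum K.+1 t = 2 * wsum K.+1 u)%N.
Proof.
rewrite -big_split /=; under eq_bigr => m _ do rewrite -mulnDr wave.
rewrite (sum_shift succn supp) /wsum big_distrr /=; apply: eq_bigr => m _.
by case: (m : nat) => [|l] /=; lia.
Qed.

Lemma wave_wsum_le : (wsum K.+1 u' <= wsum K.+1 u)%N.
Proof. by have := wave_wsum; lia. Qed.

(** In one step the support can spread to [K] at most, and a nonzero value there would cost weight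
    [K+1], above the bound [K]. *)
Lemma wave_supp m : (K <= m)%N -> u' m = 0%N.
Proof.
rewrite leq_eqVlt => /orP[/eqP <-|lt]; last first.
  have := wave m; rewrite supp; last by lia.
  by case: m lt => // m lt /=; rewrite supp; lia.
have : (K.+1 * u' K <= wsum K.+1 u')%N.
  by rewrite /wsum big_ord_recr /= leq_addl.
have := wave_wsum_le; have := wut; have := wtK.
case: (u' K) => // l; nia.
Qed.

(* The weight [concave K] has second difference [-2] on [0, K) and vanishes at
   both ends. *)
Lemma wave_energy :
  (energy K u' + energy K t + 2 * \sum_(m < K.+1) u m = 2 * energy K u)%N.
Proof.
rewrite -big_split /=; under eq_bigr => m _ do rewrite -mulnDr wave.
rewrite (sum_shift (concave K) supp) !big_distrr -big_split /=; apply: eq_bigr => m _.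
have [le|lt] := leqP K m; first by rewrite supp // !muln0.
suff : (concave K m.+1 + pred_seq (concave K) m + 2 = 2 * concave K m)%N by nia.
rewrite /concave; case: (m : nat) lt => [|l] lt /=.
  have [d ->] : exists d, K = d.+1 by exists K.-1; lia.
  by rewrite subSS !subn0; lia.
have [d ->] : exists d, K = (l.+2 + d)%N by exists (K - l.+2)%N; lia.
have -> : (l.+2 + d - l.+2 = d)%N by lia.
have -> : (l.+2 + d - l.+1 = d.+1)%N by lia.
have -> : (l.+2 + d - l = d.+2)%N by lia.
nia.
Qed.
End Wave.

(** * D-free indecomposables are syzygies of simples *)

Section Classification.
Variable k : fieldType.
Implicit Types X Y Z : comod k.

(** The state of the wave at [X]: the top of [X] is the socle of the preceding syzygy, so [topdim]
    and [socdim] are two consecutive states. *)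
Definition layers_bounded K X :=
  [/\ Dfree X, indecomposable X,
      forall l, (K <= l)%N -> socdim X l = 0%N /\ topdim X l = 0%N,
      (wsum K.+1 (socdim X) <= wsum K.+1 (topdim X))%N & (wsum K.+1 (topdim X) <= K)%N].

(** Without simples, [vdim] is socle plus top on both sides, and the top of [Y] is the socle of [X];
    so the socle of [X] occurs twice on the left of [step_dims] and cancels. *)
Lemma step_wave X Y l : step X Y -> indecomposable X ->
  ~ (exists n, iso (simp k n) X) -> ~ (exists n, iso (simp k n) Y) ->
  (socdim Y l + topdim X l = pred_seq (socdim X) l + socdim X l.+1)%N.
Proof.
move=> s indX nX nY; have [E1 topY] := step_dims l s.
have [iX|E2] := indec_layers l (step_Dfreel s) indX; first by case: nX; exists l.
have [iY|E3] := indec_layers l (step_Dfreer s) (step_indec_up s indX).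
  by case: nY; exists l.
by rewrite topY in E3; lia.
Qed.

Lemma step_socdim_neq0 X Y : step X Y -> indecomposable X -> ~ (forall l, socdim X l = 0%N).
Proof.
move=> s [pos _] z; have : cdim X = 0%N; last by move=> E; rewrite E in pos.
apply: vdim_dim0 => l; have [E1 _] := step_dims l s.
by move: E1; rewrite !z; case: (l) => [|l'] /=; rewrite ?z; lia.
Qed.

Lemma layers_step K X : layers_bounded K X ->
  (exists i n, OmegaS i (Posz n) X) \/
  exists Y, [/\ step X Y, layers_bounded K Y, energy K (topdim Y) = energy K (socdim X) &
    (energy K (socdim Y) + energy K (topdim X) + 2 <= 2 * energy K (socdim X))%N].
Proof.
move=> [dX indX sup wut wtK].
have [[n iX]|nX] := classic (exists n, iso (simp k n) X).
  by left; exists 0, n; apply/OmegaS0.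
have [Y s] := step_ex_up dX; have [[n iY]|nY] := classic (exists n, iso (simp k n) Y).
  by left; exists (0 + 1), n; apply: OmegaS_down s; apply/OmegaS0.
right; exists Y; have topY l : topdim Y l = socdim X l by case: (step_dims l s).
have wave l := step_wave l s indX nX nY.
have su l : (K <= l)%N -> socdim X l = 0%N by move/sup => [].
have wT : wsum K.+1 (topdim Y) = wsum K.+1 (socdim X) by apply: eq_bigr => l _; rewrite topY.
split=> //.
- split; [exact: step_Dfreer s | exact: step_indec_up s indX | | |].
  + by move=> l le; rewrite topY su //; split=> //; apply: (wave_supp wave su wut wtK).
  + by rewrite wT; apply: (wave_wsum_le wave su wut).
  + by rewrite wT; apply: leq_trans wut wtK.
- by apply: eq_bigr => l _; rewrite topY.
have e := wave_energy wave su.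
(* This sum is the loss of concavity in [wave_energy]; a nonzero socle turns it into a loss of at
   least 2. *)
suff : (0 < \sum_(l < K.+1) socdim X l)%N by lia.
rewrite lt0n; apply/eqP => /eqP; rewrite sum_nat_eq0 => /forallP z.
apply: (step_socdim_neq0 s indX) => l; have [/su //|lt] := leqP K l.
exact/eqP/(z (Ordinal (leqW lt))).
Qed.

(* Along [X, Omega^-1 X, Omega^-2 X, ...] the socle dimensions obey the discrete
   wave equation as long as no simple occurs. If the weight [wsum] does not
   increase, then it bounds the support, and the energy, which is concave in
   time, would become negative; hence a simple occurs. *)
Lemma reach_simple K m p X : layers_bounded K X ->
  (energy K (socdim X) <= p)%N -> (energy K (socdim X) <= energy K (topdim X) + m)%N ->
  exists i n, OmegaS i (Posz n) X.
Proof.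
(* [m] bounds the increase of the energy from top to socle, which shrinks at every step. Once [m] is
   0 the energy itself falls, and then [p], reset whenever [m] drops, counts down. *)
elim: m p X => [|m IHm] p.
  elim: p => [|p IHp] X /layers_step[//|[Y [s bY eT e]]] ep em; first by lia.
  have [||i [n oY]] := IHp Y bY; [lia | lia |].
  by exists (i + 1), n; apply: OmegaS_down oY s.
move=> X /layers_step[//|[Y [s bY eT e]]] ep em.
have [||i [n oY]] := IHm (energy K (socdim Y)) Y bY; [by [] | lia |].
by exists (i + 1), n; apply: OmegaS_down oY s.
Qed.

Lemma reach_simple_up X : Dfree X -> indecomposable X ->
  (wsum (cbound X) (socdim X) <= wsum (cbound X) (topdim X))%N -> exists i n, OmegaS i (Posz n) X.
Proof.
(* [K] has to bound the support and the weight of the top at the same time. *)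
move=> dX indX le; pose K := maxn (cbound X) (wsum (cbound X) (topdim X)).
have cK : (cbound X <= K)%N := leq_maxl _ _.
have cK' : (cbound X <= K.+1)%N by apply: leq_trans cK _.
apply: (@reach_simple K (energy K (socdim X)) (energy K (socdim X))); [|by []|by rewrite leq_addl].
split=> //.
- by move=> l h; split; [apply: socdim_fin | apply: topdim_fin]; apply: leq_trans h.
- by rewrite !(wsum_ge cK') // => l; [apply: topdim_fin | apply: socdim_fin].
- by rewrite (wsum_ge cK') ?leq_maxr // => l; apply: topdim_fin.
Qed.

Lemma indec_OmegaS X : Dfree X -> indecomposable X -> exists i n, OmegaS i (Posz n) X.
Proof.
move=> dX indX.
have [le|lt] := leqP (wsum (cbound X) (socdim X)) (wsum (cbound X) (topdim X)).
  exact: reach_simple_up.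
have [|i [n o]] := reach_simple_up (Dfree_dual dX) (indec_dual indX).
  apply: leq_trans (ltnW _) _; last first.
  - rewrite leq_eqVlt; apply/orP; left; apply/eqP; apply: eq_bigr => l _.
    by rewrite topdim_dual.
  - apply: leq_ltn_trans lt; rewrite leq_eqVlt; apply/orP; left; apply/eqP.
    by apply: eq_bigr => l _; rewrite socdim_dual.
by exists (- i), n; apply: OmegaS_iso (OmegaS_dual o) (iso_dualK X).
Qed.

End Classification.

Theorem theorem2p4p2 (k : fieldType) :
  (forall (n : nat) (i : int) (X Z A C E : comod k),
     Omega (i + 1) (IsS (n%:Z)) X ->
     Omega (i - 1) (IsS (n%:Z)) Z ->
     Omega i (IsS (n%:Z - 1)) A ->
     Omega i (IsS (n%:Z + 1)) C ->
     IsE n i E ->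
     exists (Y : comod k) (f : 'M[k]_(cdim X, cdim Y)) (g : 'M[k]_(cdim Y, cdim Z)),
       almost_split f g /\ biprod3 Y A C E)
  /\
  (forall (X Y Z : comod k) (f : 'M[k]_(cdim X, cdim Y)) (g : 'M[k]_(cdim Y, cdim Z)),
     almost_split f g ->
     exists (n : nat) (i : int) (X' Y' Z' A C E : comod k)
            (f' : 'M[k]_(cdim X', cdim Y')) (g' : 'M[k]_(cdim Y', cdim Z')),
       [/\ Omega (i + 1) (IsS (n%:Z)) X',
           Omega (i - 1) (IsS (n%:Z)) Z',
           Omega i (IsS (n%:Z - 1)) A,
           Omega i (IsS (n%:Z + 1)) C &
           IsE n i E] /\
       biprod3 Y' A C E /\ almost_split f' g' /\ ses_iso f g f' g').
Proof.
split=> [n i X Z A C E oX oZ oA oC IE | X Y Z f g as0].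
  have [X0 [Y [Z0 [A0 [C0 [E0 [f [g [[oX0 oZ0 oA0 oC0 IE0] [as0 [W [BW BY]]]]]]]]]]]] := AR_seq_ex_all k n i.
  have [a Ia] := OmegaS_uniq oX oX0; have [c Ic] := OmegaS_uniq oZ0 oZ.
  exists Y, (a *m f), (g *m c); split; first exact: almost_split_iso.
  exists W; split.
    by apply: biprod_iso BW; [exact: iso_refl | exact: OmegaS_uniq oA0 oA | exact: OmegaS_uniq oC0 oC].
  apply: biprod_iso BY; [exact: iso_refl | exact: iso_refl |].
  move: IE IE0; rewrite /IsE; case: eqP => _; last by move=> z1 z2; apply: iso_dim0.
  by move=> /IsI_iso i1 /IsI_iso i2; apply: iso_trans (iso_sym i2) i1.
have [ex indX indZ ns H] := as0.
(* An injective left end would split the sequence; hence [X] is D-free and the classification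
   applies. *)
have nX : ~ injective X.
  by move=> iX; apply: ns; apply: iX (ses_homl ex) (ses_free ex) (hom1 X).
have [i [n oX]] := indec_OmegaS (indec_Dfree indX nX) indX.
(* The left end of the sequence with index [i] is [Omega^(i+1)], so [X] requires the index
   [i - 1]. *)
have [X' [Y' [Z' [A [C [E [f' [g' [[oX' oZ oA oC IE] [as' B]]]]]]]]]] := AR_seq_ex_all k n (i - 1).
exists n, (i - 1), X', Y', Z', A, C, E, f', g'; split=> //; split=> //; split=> //.
apply: (almost_split_uniq as0 as').
by rewrite subrK in oX'; apply: OmegaS_uniq oX oX'.
Qed.
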